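(* Let $n\ge 2$ and let $(K,d)$ be a metric simplicial complex with $\mathrm{Shapes}(K)$ finite, such that $K$ is homeomorphic to $\mathbb{R}^n$. Suppose that for all $p\in K$, $i_p$ is a metric on $K_p = K\setminus\{p\}$ and the inversion $\mathrm{Inv}_p(K)$ of $K$ with respect to $p$ is a length space. Then $K$ is isometric to $\mathbb{R}^n$ (with its Euclidean metric).
   Context: $M^n_\kappa$ denotes the simply connected (complete) Riemannian $n$-manifold of constant sectional curvature $\kappa$; $D_\kappa$ is the diameter of $M^2_\kappa$ (so $D_\kappa=\infty$ if $\kappa\le 0$). An $n$-plane in $M^m_\kappa$ ($n\le m$) is a subspace isometric to $M^n_\kappa$. A set of $n+1$ points in $M^m_\kappa$ is in general position if the points do not lie in any $(n-1)$-plane. A geodesic $n$-simplex in $M^m_\kappa$ is the convex hull of $n+1$ points (its vertices) in general position; if $\kappa>0$ the vertices are required to lie in an open ball of radius $D_\kappa/2$. $M_\kappa$-simplicial complex: let $\{S_\lambda \mid \lambda\in\Lambda\}$ be a collection of geodesic simplexes with $S_\lambda\subset M^{n_\lambda}_\kappa$. Let $X=\bigcup_{\lambda\in\Lambda}(S_\lambda\times\{\lambda\})$, let $\sim$ be an equivalence relation on $X$, $K:=X/\sim$, $q:X\to K$ the quotient map, and $q_\lambda(x):=q(x,\lambda)$. $K$ is an $M_\kappa$-simplicial complex if: (1) $q_\lambda$ is injective for all $\lambda\in\Lambda$; (2) if $q_\lambda(S_\lambda)\cap q_{\lambda'}(S_{\lambda'})\ne\emptyset$ then there is an isometry $h_{\lambda,\lambda'}$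 from a face $T_\lambda\subset S_\lambda$ onto a face $T_{\lambda'}\subset S_{\lambda'}$ such that $q(x,\lambda)=q(x',\lambda')$ if and only if $x'=h_{\lambda,\lambda'}(x)$. $\mathrm{Shapes}(K)$ is the set of isometry classes of the faces of the geodesic simplexes $S_\lambda$. Natural (pseudo)metric $d$ on $K$: for $x,y\in K$ consider finite sequences $x=x_1,x_2,\dots,x_m=y$ such that every adjacent pair of points belongs to a common simplex; the length of such a sequence is the sum of the distances between adjacent points, measured in common simplexes; $d(x,y)$ is the infimum of these lengths. If $d$ is a metric, $K$ (an $M_\kappa$-simplicial complex for some $\kappa\in\mathbb{R}$) is called a metric simplicial complex; this is automatic when $\mathrm{Shapes}(K)$ is finite and $K$ is connected, and then $(K,d)$ is a complete geodesic space (theorem of Bridson). For a metric space $(X,d)$ and $p\in X$, put $X_p:=X\setminus\{p\}$ and $$i_p(x,y)=\frac{d(x,y)}{d(x,p)\,d(y,p)},\qquad x,y\in X_p.$$ When $i_p$ is a metric, the inversion $\mathrm{Inv}_p(X)=(\hat X_p,\hat i_p)$ of $X$ with respect to $p$ is the metric completion of $(X_p,i_p)$. (When $X$ is unbounded, the completion contains a unique point $p'$ which is the limit of all $d$-unbounded $i_p$-Cauchy sequences in $X_p$, i.e. corresponding to the point at infinity of $X$, and $\hat i_p(x,p')=1/d(x,p)$.) A metric space is a length space if the distance between any two points equals the infimum of the lengths of paths joining them. *)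

(* Defs.v *)
From HB Require Import structures.
From mathcomp Require Import all_boot all_order all_algebra.
From mathcomp Require Import generic_quotient.
From mathcomp Require Import all_classical all_reals all_analysis.

Set Implicit Arguments.
Unset Strict Implicit.
Unset Printing Implicit Defensive.

Import Order.TTheory GRing.Theory Num.Theory.
Import numFieldNormedType.Exports.

Local Open Scope classical_set_scope.
Local Open Scope ring_scope.
Local Open Scope quotient_scope.

Section metric_notions.
Context {R : realType}.

(* The axioms are those of the library factory [isMetric]; nonnegativity
   follows from them. *)
Definition is_metric (T : Type) (d : T -> T -> R) : Prop :=
  [/\ forall x, d x x = 0,
      forall x y, d x y = 0 -> x = y,
      forall x y, d x y = d y x &
      forall y x z, d x z <= d x y + d y z].

Definition isometry_on (T U : Type) (dT : T -> T -> R) (dU : U -> U -> R)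
    (A : set T) (h : T -> U) : Prop :=
  forall x y, A x -> A y -> dU (h x) (h y) = dT x y.

Definition isometric (T U : Type) (dT : T -> T -> R) (dU : U -> U -> R)
    (A : set T) (B : set U) : Prop :=
  exists h : T -> U, isometry_on dT dU A h /\ h @` A = B.

Definition geodesic (T : Type) (d : T -> T -> R) (x y : T) (g : R -> T) : Prop :=
  [/\ g 0 = x, g (d x y) = y &
      forall s t, s \in `[0, d x y] -> t \in `[0, d x y] ->
        d (g s) (g t) = `|s - t|].

Definition geodesically_convex (T : Type) (d : T -> T -> R) (C : set T) : Prop :=
  forall x y, C x -> C y ->
    (exists g, geodesic d x y g) /\
    (forall g, geodesic d x y g -> forall t, t \in `[0, d x y] -> C (g t)).

Definition convex_hull (T : Type) (d : T -> T -> R) (A : set T) : set T :=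
  \bigcap_(C in [set C | geodesically_convex d C /\ A `<=` C]) C.

End metric_notions.

Definition metric_space_of (R : realType) (T : choiceType) (d : T -> T -> R)
  (md : is_metric d) : Type := T.

Section metric_space_of.
Context {R : realType} {T : choiceType} {d : T -> T -> R} (md : is_metric d).

HB.instance Definition _ := Choice.on (metric_space_of md).

Let d0 x : d x x = 0. Proof. by case: md. Qed.
Let d_eq0 x y : d x y = 0 -> x = y. Proof. by case: md => _ /(_ x y). Qed.
Let dC x y : d x y = d y x. Proof. by case: md. Qed.
Let d_tri y x z : d x z <= d x y + d y z. Proof. by case: md. Qed.

HB.instance Definition _ :=
  @isMetric.Build R (metric_space_of md) d d0 d_eq0 dC d_tri.

End metric_space_of.

Definition homeomorphic (T U : topologicalType) : Prop :=
  exists (f : T -> U) (g : U -> T),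
    [/\ cancel f g, cancel g f, continuous f & continuous g].

Section length_spaces.
Context {R : realType} {Y : metricType R}.

Definition path_between (x y : Y) (g : R -> Y) : Prop :=
  [/\ {within `[0, 1], continuous g}, g 0 = x & g 1 = y].

(* A partition [s] of [0, 1] omits its left endpoint, as in [variation]. *)
Definition path_length (g : R -> Y) : \bar R :=
  ereal_sup [set (\sum_(0 <= i < size s)
                    mdist (g (nth 1 (0 :: s) i)) (g (nth 1 (0 :: s) i.+1)))%:E
            | s in itv_partition 0 1].

Definition length_space : Prop :=
  forall x y : Y,
    (mdist x y)%:E = ereal_inf [set path_length g | g in path_between x y].

End length_spaces.
Arguments length_space {R} Y.

(* [f] exhibits [Y] as the metric completion of [(T, d)]; this determines [Y]
   up to a unique isometry extending the identity of [T]. *)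
Definition is_completion (R : realType) (T : Type) (d : T -> T -> R)
    (Y : metricType R) (f : T -> Y) : Prop :=
  [/\ isometry_on d (@mdist R Y) [set: T] f,
      dense (range f) &
      forall F : set_system Y, ProperFilter F -> cauchy F -> exists l : Y, F --> l].

Section inversion.
Context {R : realType} {X : metricType R}.

Definition inv_dist (p : X) (x y : set_type [set~ p]) : R :=
  mdist (val x) (val y) / (mdist (val x) p * mdist (val y) p).

Arguments inv_dist p x y : clear implicits.

(* [Y] is the inversion of [X] with respect to [p]; meaningful when
   [inv_dist p] is a metric. *)
Definition is_inversion (p : X) (Y : metricType R) : Prop :=
  exists f : set_type [set~ p] -> Y, is_completion (inv_dist p) f.

End inversion.
Arguments inv_dist {R X} p x y.

Section model_spaces.
Context {R : realType}.

Definition dot n (x y : 'rV[R]_n) : R := \sum_i x 0 i * y 0 i.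

Definition euclidean_dist n (x y : 'rV[R]_n) : R :=
  Num.sqrt (dot (x - y) (x - y)).

Definition lorentz n (x y : 'rV[R]_n.+1) : R :=
  \sum_(i < n) x 0 (lift ord0 i) * y 0 (lift ord0 i) - x 0 ord0 * y 0 ord0.

(* The inverse of cosh : [0, +oo[ -> [1, +oo[. *)
Definition arcosh (t : R) : R := ln (t + Num.sqrt (t ^+ 2 - 1)).

(* Models of the space M^n_kappa inside R^(n+1): the unit sphere, the upper
   sheet of the unit hyperboloid, or the hyperplane x_0 = 0; the curvature
   enters through the scaling of the distance. For kappa > 0, M^1_kappa is a
   circle and M^0_kappa a pair of antipodal points. *)
Definition model_set (kappa : R) (n : nat) : set 'rV[R]_n.+1 :=
  if 0 < kappa then [set x | dot x x = 1]
  else if kappa < 0 then [set x | lorentz x x = -1 /\ 0 < x 0 ord0]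
  else [set x | x 0 ord0 = 0].

Arguments model_set kappa n : clear implicits.

Definition model (kappa : R) (n : nat) := set_type (model_set kappa n).

Definition model_dist (kappa : R) (n : nat) (x y : model kappa n) : R :=
  if 0 < kappa then acos (dot (val x) (val y)) / Num.sqrt kappa
  else if kappa < 0 then
    arcosh (- lorentz (val x) (val y)) / Num.sqrt (- kappa)
  else euclidean_dist (val x) (val y).

(* The constant usually written D_kappa. *)
Definition model_diam (kappa : R) : \bar R :=
  ereal_sup [set (model_dist x.1 x.2)%:E
            | x in [set: model kappa 2 * model kappa 2]].

Definition is_plane (kappa : R) (n m : nat) (P : set (model kappa m)) : Prop :=
  exists f : model kappa n -> model kappa m,
    isometry_on (@model_dist kappa n) (@model_dist kappa m) setT f /\
    P = range f.

(* A single point is always in general position: the (-1)-plane is empty. *)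
Definition general_position (kappa : R) (n m : nat)
    (v : 'I_n.+1 -> model kappa m) : Prop :=
  forall k, n = k.+1 ->
    forall P : set (model kappa m), is_plane k P -> ~ (range v `<=` P).

(* The bound [sdim <= amb] is not redundant: if sdim > amb + 1 there are no
   (sdim-1)-planes in the ambient space at all. *)
Record geodesic_simplex (kappa : R) := GeodesicSimplex {
  amb : nat;
  sdim : nat;
  vertex : 'I_sdim.+1 -> model kappa amb;
  sdim_le : (sdim <= amb)%N;
  vertex_general : general_position vertex;
  vertex_ball : 0 < kappa -> exists c : model kappa amb, forall i,
    ((model_dist c (vertex i))%:E < (2^-1)%:E * model_diam kappa)%E }.

Definition face (kappa : R) (S : geodesic_simplex kappa)
    (A : {set 'I_(sdim S).+1}) : set (model kappa (amb S)) :=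
  convex_hull (@model_dist kappa (amb S)) [set vertex i | i in [set` A]].

Definition body (kappa : R) (S : geodesic_simplex kappa) :
    set (model kappa (amb S)) :=
  convex_hull (@model_dist kappa (amb S)) (range (vertex (g := S))).

Arguments body {kappa} S _ : rename.

Definition disjoint_bodies (kappa : R) (L : choiceType)
    (S : L -> geodesic_simplex kappa) := {l : L & set_type (body (S l))}.

(* [L] only needs to be a set: every type is classically a [choiceType]. *)
Record simplicial_complex (kappa : R) := SimplicialComplex {
  label : choiceType;
  cell : label -> geodesic_simplex kappa;
  glue : equiv_rel (disjoint_bodies cell);
  glue_inj : forall l, injective (fun x : set_type (body (cell l)) =>
    \pi_{eq_quot glue} (existT _ l x));
  glue_face : forall l l' : label,
    range (fun x => \pi_{eq_quot glue} (existT _ l x)) `&`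
      range (fun x => \pi_{eq_quot glue} (existT _ l' x)) !=set0 ->
    exists (A : {set 'I_(sdim (cell l)).+1})
           (A' : {set 'I_(sdim (cell l')).+1})
           (h : model kappa (amb (cell l)) -> model kappa (amb (cell l'))),
      [/\ (0 < #|A|)%N, (0 < #|A'|)%N,
          isometry_on (@model_dist _ _) (@model_dist _ _) (face A) h,
          h @` face A = face A' &
          forall (x : set_type (body (cell l)))
                 (x' : set_type (body (cell l'))),
            \pi_{eq_quot glue} (existT _ l x) =
              \pi_{eq_quot glue} (existT _ l' x') <->
            face A (val x) /\ val x' = h (val x)] }.

End model_spaces.
Arguments body {R kappa} S _ : rename.

Section complexes.
Context {R : realType} {kappa : R} (K : simplicial_complex kappa).

Definition carrier : choiceType := {eq_quot (glue K)}.

Definition quo (l : label K) (x : set_type (body (cell l))) : carrier :=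
  \pi_{eq_quot (glue K)} (existT _ l x).

Definition nonempty_face :=
  {l : label K & {A : {set 'I_(sdim (cell l)).+1} | (0 < #|A|)%N}}.

Definition face_of (t : nonempty_face) :
    set (model kappa (amb (cell (projT1 t)))) := face (val (projT2 t)).

Arguments face_of t _ : clear implicits.

(* Isometry classes, as sets of faces. *)
Definition Shapes : set (set nonempty_face) :=
  [set [set t' | isometric (@model_dist _ _ _) (@model_dist _ _ _)
                   (face_of t) (face_of t')] | t in setT].

(* [x] and [y] lie in a common simplex, in which their distance is [r]. *)
Definition simplex_step (x y : carrier) (r : R) : Prop :=
  exists (l : label K) (u v : set_type (body (cell l))),
    [/\ quo u = x, quo v = y & r = model_dist (val u) (val v)].

(* [r] is the length of a chain of [m.+1] points from [x] to [y]. *)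
Definition chain_length (x y : carrier) (r : R) : Prop :=
  exists (m : nat) (c : nat -> carrier) (e : nat -> R),
    [/\ c 0%N = x, c m = y,
        forall i, (i < m)%N -> simplex_step (c i) (c i.+1) (e i) &
        r = \sum_(i < m) e i].

(* [+oo] when no chain joins [x] to [y]. *)
Definition complex_edist (x y : carrier) : \bar R :=
  ereal_inf [set r%:E | r in chain_length x y].

Definition complex_dist (x y : carrier) : R := fine (complex_edist x y).

Definition complex_metric : Prop :=
  (forall x y, complex_edist x y \is a fin_num) /\ is_metric complex_dist.

(* Topologised by its metric, not by the quotient (weak) topology. *)
Definition complex_space (mK : complex_metric) : metricType R :=
  metric_space_of (proj2 mK).

End complexes.
Arguments Shapes {R kappa} K _.

(* Main.v *)
(* The triangle inequality for all the [i_p] is Ptolemy's inequality for [d].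
   Fix [o] in the interior of a maximal simplex. A geodesic from [y] to [o] in
   the inversion at [x] consists of points of equality in Ptolemy's inequality
   and ends at [o], near which the metric is that of a model space. So this
   equality can be differentiated at [o], where the distance to [x] varies with
   the initial direction [theta x], a Euclidean unit vector, of a geodesic to
   [x]; the result is the Euclidean law of cosines for all triangles [o x y].
   Hence [E x = d(o, x) theta(x)] embeds [K] isometrically in some R^N. The
   image is convex because [K] is a length space and, its shapes being finite,
   proper. The inversions at all points, with [K] unbounded, make the image
   contain the prolongation of each of its segments, so it is a linear subspace.
   Its dimension is [n] because there is no injective continuous map
   R^m -> R^n with m > n, which follows from a discrete Poincare-Miranda
   theorem. *)
From mathcomp Require Import all_boot all_order all_algebra.
From mathcomp Require Import generic_quotient.
From mathcomp Require Import all_classical all_reals all_analysis.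
From mathcomp Require Import zify lra ring.
Require Import Defs.
Set Implicit Arguments.
Unset Strict Implicit.
Unset Printing Implicit Defensive.
Import Order.TTheory GRing.Theory Num.Theory.
Import numFieldNormedType.Exports.
Local Open Scope classical_set_scope.
Local Open Scope ring_scope.

(** * Invariance of dimension *)

(** The obstacle is that neither geodesics nor compactness of bounded sets are at hand. Length
    spaces only give points that are nearly between two others, and limits of such points exist at
    first only in a small ball around [o], inside one compact cell. So every limit taken before the
    embedding exists is forced into this ball. Only afterwards do bounded sequences cluster: the
    centres of maximal cells with different images are uniformly separated, and a bounded part of
    R^N has no room for infinitely many of them. Differentiability at [o] is half given too: the
    geometry of the cell bounds distances to nearby points from above to first order, and the
    matching lower bound has to come from Ptolemy's inequality. The three signs of curvature are
    treated together through squared chords instead of cosines, because for curvature 0 the cosine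
    degenerates to the constant 1. *)

Lemma invSn_lt {R : realType} (e : R) : 0 < e ->
  exists n : nat, forall k : nat, (n <= k)%N -> k.+1%:R^-1 < e.
Proof.
move=> e0; exists (Num.bound e^-1) => k nk.
rewrite invf_plt ?posrE ?ltr0Sn //.
apply: lt_le_trans (archi_boundP _) _; first by rewrite invr_ge0 ltW.
by rewrite ler_nat (leq_trans nk).
Qed.

Lemma invSn_gt0 {R : realType} (k : nat) : 0 < k.+1%:R^-1 :> R.
Proof. by rewrite invr_gt0 ltr0Sn. Qed.

Lemma ler_add_eps {R : realType} (x y : R) :
  (forall e, 0 < e -> x <= y + e) -> x <= y.
Proof. by move=> H; apply/ler_addgt0Pr. Qed.

Lemma norm_coord_le {R : realType} n (v : 'rV[R]_n) i : `|v 0 i| <= `|v|.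
Proof.
have /mapP[j Hj ->] : `|v 0 i| \in [seq `|v x.1 x.2| | x : 'I_1 * 'I_n].
  by apply/mapP; exists (0, i) => //=; rewrite mem_enum.
by rewrite [leRHS]/Num.norm /= mx_normrE; apply/bigmax_geP; right => /=; exists j.
Qed.

Lemma norm_row_lt {R : realType} n (v : 'rV[R]_n) e : 0 < e ->
  (forall i, `|v 0 i| < e) -> `|v| < e.
Proof.
move=> e0 H; rewrite [ltLHS]/Num.norm /= mx_normrE; apply/bigmax_ltP; split=> // -[i j] _ /=.
by rewrite (ord1 i).
Qed.

(** The explicit rate and [k <= phi k] turn later limits into estimates on indices; [phi] need not
    be increasing. *)
Lemma bolzano_weierstrass {R : realType} n (u : nat -> 'rV[R]_n) (M : R) :
  (forall k i, `|u k 0 i| <= M) ->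
  exists (phi : nat -> nat) (p : 'rV[R]_n), forall k,
    (k <= phi k)%N /\ forall i, `|u (phi k) 0 i - p 0 i| < k.+1%:R^-1.
Proof.
move=> uM.
pose A := [set v : 'rV[R]_n | forall i, v ord0 i \in `[(- M), M]].
have cA : compact A.
  apply: (@rV_compact _  _ (fun=> `[(- M), M]%classic)).
  by move=> _; apply: segment_compact.
have [] := cA (u @ \oo) _ _.
  by exists 0%N => // k _ i; rewrite /= in_itv /= -ler_norml.
move=> p [_ cp].
have cl k : exists l, (k <= l)%N /\ forall i, `|u l 0 i - p 0 i| < k.+1%:R^-1.
  have [||v [/= Hv Bv]] := cp (u @` [set l | (k <= l)%N]) (ball p k.+1%:R^-1).
  - by exists k => // l /= kl; exists l.
  - exact: (nbhsx_ballx p _ (invSn_gt0 k)).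
  case: Hv => l kl ulv; exists l; split=> // i.
  by case: Bv => _ /(_ 0 i); rewrite -ball_normE /= -ulv distrC.
have [phi Hphi] := choice cl.
by exists phi, p.
Qed.

(** * Cubical cochains modulo 2 and a discrete Poincare-Miranda theorem *)

Section cubical_cochains.
Variable m : nat.
Implicit Types (v w : {ffun 'I_m -> nat}) (J : {set 'I_m}) (j k : 'I_m).

Definition upd v j (t : nat) : {ffun 'I_m -> nat} :=
  [ffun i => if i == j then t else v i].

Definition step v j := upd v j (v j).+1.

Lemma upd_comm v j k s t : j != k -> upd (upd v j s) k t = upd (upd v k t) j s.
Proof.
move=> jk; apply/ffunP => i; rewrite !ffunE.
by case: (eqVneq i k) => // ->; rewrite eq_sym (negbTE jk).
Qed.

Lemma stepC v j k : j != k -> step (step v j) k = step (step v k) j.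
Proof.
move=> jk; rewrite /step.
by rewrite {2}/upd ffunE eq_sym (negbTE jk) [in RHS]/upd ffunE (negbTE jk) upd_comm.
Qed.

Variable s : 'I_m -> {ffun 'I_m -> nat} -> 'F_2.

(* The cup product of the 1-cochains [d (s k)], [k] in [ks], on the cube with
   lowest corner [v] spanned by the directions in [J]. *)
Fixpoint eta (ks : seq 'I_m) v J : 'F_2 :=
  if ks is k :: ks' then
    \sum_(j in J) (s k v * eta ks' v (J :\ j) +
                   s k (step v j) * eta ks' (step v j) (J :\ j))
  else 1.

Lemma addF2 (x : 'F_2) : x + x = 0.
Proof. exact/(addrr_pchar2 (pchar_Fp _)). Qed.

(** Each unordered pair of distinct directions is counted twice, and the coefficients have
    characteristic 2. *)
Lemma symmetric_sum_eq0 J (a : 'I_m -> 'I_m -> 'F_2) :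
  (forall i j, i != j -> a i j = a j i) ->
  \sum_(j in J) \sum_(i in J :\ j) a i j = 0.
Proof.
move=> asym.
have E j : \sum_(i in J :\ j) a i j =
    \sum_(i in J | (i < j)%N) a i j + \sum_(i in J | (j < i)%N) a i j.
  rewrite (bigID (fun i : 'I_m => (i < j)%N)) /=; congr (_ + _);
    apply: eq_bigl => i; rewrite !inE -val_eqE /=; case: (i \in J); rewrite ?andbF ?andbT //=; lia.
rewrite (eq_bigr _ (fun j _ => E j)) big_split /=.
rewrite [X in _ + X](exchange_big_dep (fun i => i \in J)) /=; last by move=> ? ? _ /andP[].
rewrite -big_split /= big1 // => j jJ.
rewrite [X in _ + X](_ : _ = \sum_(i in J | (i < j)%N) a i j) ?addF2 //.
apply: eq_big => [i|i /andP[_ /andP[_ ij]]]; first by rewrite jJ.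
by apply: asym; rewrite -val_eqE /=; lia.
Qed.

(** By construction [eta (k :: ks)] is the coboundary of [s k] times [eta ks], so this is the
    vanishing of a double coboundary: two directions removed in either order give the same terms. *)
Lemma eta_closed ks v J :
  \sum_(j in J) (eta ks v (J :\ j) + eta ks (step v j) (J :\ j)) = 0.
Proof.
case: ks => [|k ks] /=; first by rewrite big1 // => j _; rewrite addF2.
pose w v J := s k v * eta ks v J.
transitivity (\sum_(j in J) \sum_(i in J :\ j)
    (w v (J :\ j :\ i) + w (step v i) (J :\ j :\ i) +
     (w (step v j) (J :\ j :\ i) + w (step (step v j) i) (J :\ j :\ i)))).
  by apply: eq_bigr => j _; rewrite -big_split.
apply: symmetric_sum_eq0 => i j ij.
rewrite (stepC v ij) (_ : J :\ j :\ i = J :\ i :\ j); last by rewrite !finset.setDDl finset.setUC.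
by rewrite -!addrA; congr (_ + _); rewrite addrCA.
Qed.

(** The Leibniz rule: since [eta ks] is closed, only the coboundary of [s k] contributes. *)
Lemma eta_cons k ks v J : eta (k :: ks) v J =
  \sum_(j in J) (s k v + s k (step v j)) * eta ks (step v j) (J :\ j).
Proof.
rewrite /= big_split /= -mulr_sumr.
have /eqP := eta_closed ks v J; rewrite big_split /= addr_eq0 => /eqP ->.
have N1 (x : 'F_2) : - x = x by apply/eqP; rewrite eq_sym -addr_eq0 addF2.
rewrite N1 mulr_sumr -big_split /=.
by apply: eq_bigr => j _; rewrite mulrDl.
Qed.

Definition in_cube v J w := forall i, (v i <= w i <= v i + (i \in J))%N.

(** A nonzero product has, for each [k], a nonzero factor: an edge of the cube along which [s k]
    changes. *)
Lemma eta_neq0 ks v J : eta ks v J != 0 -> forall k, k \in ks ->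
  exists a b, [/\ in_cube v J a, in_cube v J b & s k a != s k b].
Proof.
elim: ks v J => [//|k ks IH] v J; rewrite eta_cons => H.
have [j jJ /[!mulf_eq0] /norP[sk He]] :
    exists2 j, j \in J & (s k v + s k (step v j)) * eta ks (step v j) (J :\ j) != 0.
  apply: contrapT => N; case/negP: H; rewrite big1 // => j jJ.
  by apply/eqP/negPn/negP => ?; apply: N; exists j.
move=> k'; rewrite inE => /orP[/eqP ->|k'ks].
  exists v, (step v j); split.
  - by move=> i; rewrite leqnn leq_addr.
  - move=> i; rewrite !ffunE; case: eqP => [->|_]; last by rewrite leqnn leq_addr.
    by rewrite jJ addn1 leqnn leqnSn.
  - by apply: contra sk => /eqP ->; rewrite addF2.
have [a [b [Ha Hb ab]]] := IH _ _ He _ k'ks.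
have sub w : in_cube (step v j) (J :\ j) w -> in_cube v J w.
  move=> Hw i; have := Hw i; rewrite !ffunE !inE.
  case: (eqVneq i j) => [->|_] /=; [rewrite jJ; lia | by []].
by exists a, b; split => //; exact: sub.
Qed.

Variable N : nat.

(** The corners run below [N], one for each unit cube of a grid with vertices from 0 to [N]. The
    coordinates outside [ks] are frozen, so that the same sum also runs over faces of the grid. *)
Fixpoint grid_sum (ks : seq 'I_m) (g : {ffun 'I_m -> nat} -> 'F_2) v : 'F_2 :=
  if ks is k :: ks' then \sum_(t < N) grid_sum ks' g (upd v k t) else g v.

Lemma eq_grid_sum ks g h v :
  (forall w, (forall i, i \notin ks -> w i = v i) ->
             (forall i, i \in ks -> (w i < N)%N) -> g w = h w) ->
  uniq ks -> grid_sum ks g v = grid_sum ks h v.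
Proof.
elim: ks v => [|k ks IH] v gh /=; first by move=> _; apply: gh.
move=> /andP[kks uks]; apply: eq_bigr => t _; apply: IH => // w w1 w2.
apply: gh => i; rewrite inE.
  by rewrite negb_or => /andP[ik iks]; rewrite w1 // ffunE (negbTE ik).
by case/orP=> [/eqP ->|]; [rewrite w1 // ffunE eqxx | exact: w2].
Qed.

Lemma grid_sum0 ks v : grid_sum ks (fun=> 0) v = 0.
Proof. by elim: ks v => [|k ks IH] v //=; rewrite big1. Qed.

Lemma grid_sumD ks g h v :
  grid_sum ks (fun w => g w + h w) v = grid_sum ks g v + grid_sum ks h v.
Proof.
elim: ks v => [|k ks IH] v //=; rewrite -big_split /=.
by apply: eq_bigr => t _.
Qed.

Lemma grid_sum_big ks J (g : 'I_m -> {ffun 'I_m -> nat} -> 'F_2) v :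
  grid_sum ks (fun w => \sum_(j in J) g j w) v = \sum_(j in J) grid_sum ks (g j) v.
Proof.
elim: ks v => [|k ks IH] v //=.
by rewrite exchange_big /=; apply: eq_bigr => t _.
Qed.

Lemma grid_sum_step ks g v j : j \notin ks ->
  grid_sum ks (fun w => g (step w j)) v = grid_sum ks g (step v j).
Proof.
elim: ks v => [|k ks IH] v //=; rewrite inE negb_or => /andP[jk jks].
apply: eq_bigr => t _; rewrite IH //; congr (grid_sum _ _ _).
by rewrite /step /= {2}/upd ffunE (negbTE jk) upd_comm // eq_sym.
Qed.

(** The coboundary in direction [j] telescopes to the two faces orthogonal to [j]; modulo 2 their
    signs do not matter. *)
Lemma grid_sum_telescope ks g v j : j \in ks -> uniq ks ->
  grid_sum ks (fun w => g w + g (step w j)) v =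
  grid_sum (rem j ks) g (upd v j 0) + grid_sum (rem j ks) g (upd v j N).
Proof.
elim: ks v => [//|k ks IH] v /= jks /andP[kks uks].
case: (eqVneq k j) => [E|kj].
  rewrite -E; rewrite E in kks *.
  under eq_bigr => t _.
    rewrite grid_sumD grid_sum_step //.
    rewrite (_ : step (upd v j t) j = upd v j t.+1); last first.
      by apply/ffunP => i; rewrite !ffunE eqxx; case: eqP.
    over.
  elim: (N) => [|n IHn]; first by rewrite big_ord0 addF2.
  by rewrite big_ord_recr /= IHn -addrA [X in _ + X]addrA addF2 add0r.
rewrite /=.
have jks' : j \in ks by move: jks; rewrite inE eq_sym (negbTE kj).
rewrite -big_split /=; apply: eq_bigr => t _.
by rewrite IH // !(upd_comm _ _ _ kj).
Qed.

Hypothesis s_low : forall v k, v k = 0%N -> s k v = 1.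
Hypothesis s_high : forall v k, v k = N -> s k v = 0.

(** Stokes' theorem and induction on the dimension. On the faces orthogonal to some [j] in [ks] the
    function [s j] is constant, so [eta ks] vanishes there. Of the two faces orthogonal to [k], the
    high one has the factor [s k = 0] and the low one [s k = 1], which leaves the sum for [ks]. *)
Lemma grid_sum_eta ks v : uniq ks -> grid_sum ks (fun w => eta ks w [set x in ks]) v = 1.
Proof.
elim: ks v => [//|k ks IH] v uks; have /andP[kks uks'] := uks.
set J := [set x in k :: ks].
pose w j u := s k u * eta ks u (J :\ j).
rewrite (@eq_grid_sum _ _ (fun u => \sum_(j in J) (w j u + w j (step u j)))) //.
rewrite grid_sum_big (bigD1 k); last by rewrite !inE eqxx.
have Jk : J :\ k = [set x in ks].
  apply/setP => i; rewrite !inE; case: eqVneq => // -> /=.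
  by rewrite (negbTE kks).
have face_eq0 (u : {ffun 'I_m -> nat}) j c : j \in ks -> c = 0%N \/ c = N -> u j = c -> eta ks u (J :\ j) = 0.
  move=> jks c0 uj; apply/eqP/negPn/negP => /eta_neq0 /(_ j jks) [a [b [Ha Hb]]].
  have aj : a j = c by move: (Ha j); rewrite !inE eqxx uj /= addn0; lia.
  have bj : b j = c by move: (Hb j); rewrite !inE eqxx uj /= addn0; lia.
  case: c0 => E; rewrite E in aj bj.
    by rewrite (s_low aj) (s_low bj) eqxx.
  by rewrite (s_high aj) (s_high bj) eqxx.
transitivity (grid_sum (k :: ks) (fun u => w k u + w k (step u k)) v + 0).
  apply: (congr2 +%R) => //; apply: big1 => j /andP[jJ jk].
  have jks : j \in ks by move: jJ; rewrite !inE (negbTE jk).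
  rewrite (@grid_sum_telescope (k :: ks) (w j)) ?inE ?jks ?orbT //.
  rewrite !(@eq_grid_sum _ _ (fun=> 0)) ?rem_uniq ?grid_sum0 ?addr0 //.
  - move=> u u1 _; rewrite /w (@face_eq0 _ _ N) ?mulr0 //; first by right.
    by rewrite u1 ?ffunE ?eqxx // mem_rem_uniqF.
  - move=> u u1 _; rewrite /w (@face_eq0 _ _ 0%N) ?mulr0 //; first by left.
    by rewrite u1 ?ffunE ?eqxx // mem_rem_uniqF.
rewrite addr0 (@grid_sum_telescope (k :: ks) (w k)) ?inE ?eqxx //= eqxx.
rewrite (@eq_grid_sum _ _ (fun u => eta ks u [set x in ks])) //; last first.
  by move=> u u1 _; rewrite /w Jk s_low ?mul1r // u1 // ffunE eqxx.
rewrite IH // (@eq_grid_sum _ _ (fun=> 0)) ?grid_sum0 ?addr0 //.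
by move=> u u1 _; rewrite /w s_high ?mul0r // u1 // ffunE eqxx.
Qed.

End cubical_cochains.

Lemma grid_sum_neq0 m N ks g (v : {ffun 'I_m -> nat}) : uniq ks -> grid_sum N ks g v != 0 ->
  exists w : {ffun 'I_m -> nat},
    [/\ forall i, i \in ks -> (w i < N)%N & g w != 0].
Proof.
move=> uks H; apply: contrapT => no; case/negP: H.
rewrite (@eq_grid_sum _ _ _ _ (fun=> 0)) ?grid_sum0 // => w _ w2.
by apply/eqP/negPn/negP => ?; apply: no; exists w.
Qed.

(** The labels become 0-cochains modulo 2. The product of their coboundaries has total 1 over the
    grid, so it is nonzero on some unit cube, where every label must take both values. *)
Lemma discrete_poincare_miranda m N (s : 'I_m -> {ffun 'I_m -> nat} -> bool) :
  (0 < N)%N ->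
  (forall (v : {ffun 'I_m -> nat}) k, v k = 0%N -> s k v) ->
  (forall (v : {ffun 'I_m -> nat}) k, v k = N -> ~~ s k v) ->
  exists v : {ffun 'I_m -> nat}, (forall i, (v i < N)%N) /\
    forall k, exists a b : {ffun 'I_m -> nat}, [/\ forall i, (v i <= a i <= (v i).+1)%N,
      forall i, (v i <= b i <= (v i).+1)%N, s k a & ~~ s k b].
Proof.
move=> N0 low high.
pose s' k v : 'F_2 := (s k v)%:R.
have E : grid_sum N (enum 'I_m) (fun w => eta s' (enum 'I_m) w [set x in enum 'I_m])
    [ffun=> 0%N] = 1.
  apply: grid_sum_eta (enum_uniq _) => v k vk; rewrite /s'.
    by rewrite low.
  by rewrite (negbTE (high _ _ vk)).
have E0 : grid_sum N (enum 'I_m) (fun w => eta s' (enum 'I_m) w [set x in enum 'I_m])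
    [ffun=> 0%N] != 0 by rewrite E.
have [w [w1 w2]] := grid_sum_neq0 (enum_uniq _) E0.
exists w; split=> [i|k]; first by apply: w1; rewrite mem_enum.
have [a [b [Ha Hb]]] := eta_neq0 w2 (mem_enum _ k : k \in enum 'I_m).
have cube u : in_cube w [set x in enum 'I_m] u -> forall i, (w i <= u i <= (w i).+1)%N.
  by move=> Hu i; have := Hu i; rewrite !inE mem_enum addn1.
rewrite /s'; case sa: (s k a); case sb: (s k b) => // _.
- by exists a, b; rewrite sa sb; split => //; exact: cube.
- by exists b, a; rewrite sa sb; split => //; exact: cube.
Qed.

(** * Continuous injections do not lower the dimension *)

Section invariance_of_dimension.
Context {R : realType}.
Variables (m n : nat) (f : 'rV[R]_m -> 'rV[R]_n).
Hypotheses (fc : continuous f) (fi : injective f).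

Let cube (x : 'rV[R]_m) := forall i, 0 <= x 0 i <= 1.

Lemma continuous_along (v : nat -> 'rV[R]_m) (p : 'rV[R]_m) :
  (forall k i, `|v k 0 i - p 0 i| < k.+1%:R^-1) ->
  forall e, 0 < e -> exists K : nat, forall k, (K <= k)%N -> `|f (v k) - f p| < e.
Proof.
move=> vp e e0.
have /cvgrPdist_lt /(_ e e0) /nbhs_ballP [d /= d0 Hd] := @fc p.
have [K HK] := invSn_lt d0.
exists K => k Kk; rewrite distrC; apply: Hd.
rewrite -ball_normE /=; apply: norm_row_lt => // i.
by rewrite !mxE distrC; apply: lt_trans (vp k i) (HK _ Kk).
Qed.

Lemma cube_norm x i : cube x -> `|x 0 i| <= 1.
Proof. by move=> /(_ i) /andP[x0 x1]; rewrite ger0_norm. Qed.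

Lemma cube_pair_limit (x x' : nat -> 'rV[R]_m) :
  (forall k, cube (x k)) -> (forall k, cube (x' k)) ->
  exists (phi : nat -> nat) (p p' : 'rV[R]_m), forall k, [/\ (k <= phi k)%N,
    forall i, `|x (phi k) 0 i - p 0 i| < k.+1%:R^-1 &
    forall i, `|x' (phi k) 0 i - p' 0 i| < k.+1%:R^-1].
Proof.
move=> cx cx'.
have [phi [p Hp]] := @bolzano_weierstrass _ _ x 1 (fun k i => cube_norm i (cx k)).
have [psi [p' Hp']] := @bolzano_weierstrass _ _ (x' \o phi) 1
  (fun k i => cube_norm i (cx' (phi k))).
exists (phi \o psi), p, p' => k; have [k1 H1] := Hp' k; have [k2 H2] := Hp (psi k).
split=> //=; first exact: leq_trans k1 k2.
by move=> i; apply: lt_le_trans (H2 i) _; rewrite lef_pV2 ?posrE ?ltr0Sn // ler_nat ltnS.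
Qed.

(** Otherwise compactness of the cube would give two points of opposite faces with the same
    image. *)
Lemma opposite_faces_far : exists2 e, 0 < e & forall (x x' : 'rV[R]_m) i,
  cube x -> cube x' -> x 0 i = 0 -> x' 0 i = 1 -> e <= `|f x - f x'|.
Proof.
apply: contrapT => no.
have H (k : nat) : exists z : 'rV[R]_m * 'rV[R]_m * 'I_m, [/\ cube z.1.1, cube z.1.2,
    z.1.1 0 z.2 = 0, z.1.2 0 z.2 = 1 & `|f z.1.1 - f z.1.2| < k.+1%:R^-1].
  apply: contrapT => no'; apply: no; exists k.+1%:R^-1; first exact: invSn_gt0.
  move=> x x' i cx cx' xi xi'; rewrite leNgt; apply/negP => lt.
  by apply: no'; exists (x, x', i).
have [z Hz] := choice H.
have [phi [p [p' Hp]]] := @cube_pair_limit (fun k => (z k).1.1) (fun k => (z k).1.2)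
  (fun k => let: And5 a _ _ _ _ := Hz k in a) (fun k => let: And5 _ a _ _ _ := Hz k in a).
have fpp' : f p = f p'.
  apply/eqP; rewrite -subr_eq0 -normr_eq0 -[_ == 0]negbK; apply/negP => ne0.
  have e0 : 0 < `|f p - f p'| / 3 by rewrite divr_gt0 // lt_def ne0 normr_ge0.
  have [K HK] := @continuous_along _ p (fun k => let: And3 _ a _ := Hp k in a) _ e0.
  have [K' HK'] := @continuous_along _ p' (fun k => let: And3 _ _ a := Hp k in a) _ e0.
  have [K2 HK2] := invSn_lt e0.
  pose k := maxn K (maxn K' K2).
  have := HK k (leq_maxl _ _); have := HK' k (leq_trans (leq_maxl _ _) (leq_maxr _ _)).
  have kphi : (K2 <= phi k)%N.
    by case: (Hp k) => + _ _; apply: leq_trans; rewrite /k; lia.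
  have := lt_trans (let: And5 _ _ _ _ a := Hz (phi k) in a) (HK2 _ kphi).
  move=> /= h1 h2 h3.
  have := ler_distD (f (z (phi k)).1.1) (f p) (f p').
  have := ler_distD (f (z (phi k)).1.2) (f (z (phi k)).1.1) (f p').
  by rewrite distrC in h3; lra.
have pp' := fi fpp'; subst p'; clear fpp'.
(* At index 1 the rate is 1/2, and no number is at distance less than 1/2 from both 0 and 1. *)
case: (Hp 1%N) => _ /(_ (z (phi 1%N)).2) + /(_ (z (phi 1%N)).2).
case: (Hz (phi 1%N)) => _ _ -> -> _.
by rewrite !ltr_norml => /andP[h1 h2] /andP[h3 h4]; lra.
Qed.

Lemma cube_uniform_continuity d : 0 < d -> exists K : nat, forall x x' : 'rV[R]_m,
  cube x -> cube x' -> (forall i, `|x 0 i - x' 0 i| <= K.+1%:R^-1) -> `|f x - f x'| < d.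
Proof.
move=> d0; apply: contrapT => no.
have H (k : nat) : exists z : 'rV[R]_m * 'rV[R]_m, [/\ cube z.1, cube z.2,
    forall i, `|z.1 0 i - z.2 0 i| <= k.+1%:R^-1 & d <= `|f z.1 - f z.2|].
  apply: contrapT => no'; apply: no; exists k.
  move=> x x' cx cx' xx'; rewrite ltNge; apply/negP => lt.
  by apply: no'; exists (x, x').
have [z Hz] := choice H.
have [phi [p [p' Hp]]] := @cube_pair_limit (fun k => (z k).1) (fun k => (z k).2)
  (fun k => let: And4 a _ _ _ := Hz k in a) (fun k => let: And4 _ a _ _ := Hz k in a).
have pp' : p = p'.
  apply/rowP => i; apply/eqP; rewrite -subr_eq0 -normr_eq0 -[_ == 0]negbK; apply/negP => ne0.
  have e0 : 0 < `|p 0 i - p' 0 i| / 3 by rewrite divr_gt0 // lt_def ne0 normr_ge0.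
  have [K HK] := invSn_lt e0.
  case: (Hp K) => k1 /(_ i) h1 /(_ i) h2.
  case: (Hz (phi K)) => _ _ /(_ i) h3 _.
  have := HK _ (leqnn K); have := HK _ k1 => h4 h5.
  have := ler_distD ((z (phi K)).1 0 i) (p 0 i) (p' 0 i).
  have := ler_distD ((z (phi K)).2 0 i) ((z (phi K)).1 0 i) (p' 0 i).
  rewrite distrC in h1; move: (lt_trans h1 h5) (lt_trans h2 h5) (le_lt_trans h3 h4).
  by clear; lra.
subst p'.
have e0 : 0 < d / 2 by rewrite divr_gt0.
have [K HK] := @continuous_along _ p (fun k => let: And3 _ a _ := Hp k in a) _ e0.
have [K' HK'] := @continuous_along _ p (fun k => let: And3 _ _ a := Hp k in a) _ e0.
have := HK _ (leq_maxl K K'); have := HK' _ (leq_maxr K K').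
case: (Hz (phi (maxn K K'))) => _ _ _ + h1 h2.
have := ler_distD (f p) (f (z (phi (maxn K K'))).1) (f (z (phi (maxn K K'))).2).
by rewrite distrC in h1; rewrite (distrC (f p) (f _.2)) in h1 *; lra.
Qed.

Lemma floor_eq_near (t t' d : R) : (forall z : int, d <= `|t - z%:~R|) -> `|t - t'| < d ->
  Num.floor t = Num.floor t'.
Proof.
move=> far near; apply/eqP; rewrite floor_eq.
have /andP[h1 h2] := floor_itv t'.
move: near; rewrite ltr_norml => /andP[n1 n2].
apply/andP; split.
  rewrite leNgt; apply/negP => lt; have := far (Num.floor t').
  by rewrite ler0_norm; lra.
rewrite ltNge; apply/negP => le; have := far (Num.floor t' + 1).
by rewrite ger0_norm; lra.
Qed.

(* The grids of mesh [1] shifted by [k / m] have pairwise distant walls, so a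
   point with fewer than [m] coordinates is far from the walls of one of them. *)
Lemma exists_far_shift (y : 'I_n -> R) : (n < m)%N ->
  exists k : 'I_m, forall c (z : int), (4 * m%:R)^-1 <= `|y c - k%:R / m%:R - z%:~R|.
Proof.
move=> nm; apply: contrapT => no.
have m0 : (0 < m%:R :> R) by rewrite ltr0n (leq_ltn_trans _ nm).
have H (k : 'I_m) : exists cz : 'I_n * int,
    `|y cz.1 - k%:R / m%:R - cz.2%:~R| < (4 * m%:R)^-1.
  apply: contrapT => no'; apply: no; exists k => c z.
  by rewrite leNgt; apply/negP => lt; apply: no'; exists (c, z).
have [g Hg] := choice H.
(* By the pigeonhole principle two shifts put the same coordinate near a wall. Then [(k' - k) / m]
   is within [1 / (2 m)] of an integer, hence equal to it, which is absurd. *)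
have /injectivePn[k [k' kk' E]] : ~~ injectiveb (fun k => (g k).1).
  by apply/negP => /injectiveP /leq_card; rewrite !card_ord leqNgt nm.
have := Hg k; have := Hg k'; rewrite -E => h1 h2.
have h3 : `|(k'%:R - k%:R) / m%:R + ((g k').2%:~R - (g k).2%:~R)| < (2 * m%:R)^-1 :> R.
  have -> : (2 * m%:R)^-1 = (4 * m%:R)^-1 + (4 * m%:R)^-1 :> R by field; rewrite gt_eqF.
  move: h1 h2; rewrite !ltr_norml => /andP[a1 a2] /andP[a3 a4].
  by rewrite mulrBl; apply/andP; split; lra.
have h4 : `|(k' : int)%:~R - (k : int)%:~R + m%:Z%:~R * ((g k').2%:~R - (g k).2%:~R)| < 1 :> R.
  have := h3; rewrite -(ltr_pM2r m0) -[X in _ * X < _ -> _]gtr0_norm // -normrM mulrDl.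
  rewrite divfK ?gt_eqF // [X in _ + X]mulrC.
  have -> : (2 * m%:R)^-1 * m%:R = 2^-1 :> R by field; rewrite gt_eqF.
  by move=> /lt_trans; apply; lra.
have : `|(k' : int) - (k : int) + m%:Z * ((g k').2 - (g k).2)| < 1.
  by rewrite -(@ltr_int R) intr_norm !(rmorphD, rmorphM, rmorphN) /=.
have := ltn_ord k; have := ltn_ord k' => l1 l2 l3.
have E0 : (k' : int) - (k : int) + m%:Z * ((g k').2 - (g k).2) = 0 by lia.
case/negP: kk'; apply/eqP/val_inj => /=.
case: (eqVneq ((g k').2 - (g k).2) 0) => [zz|zz]; first by lia.
have : (m%:Z <= m%:Z * `|(g k').2 - (g k).2|) by nia.
by nia.
Qed.

(** If [n < m], cut R^n into boxes of side [e], once for each of the [m] shifts, and let [s k] mark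
    the grid points whose image lies in a box of the [k]-th tiling that meets the image of the face
    [x k = 0]. Such a box misses the image of the opposite face, so some small cube carries both
    values of every label. But for one [k] the image of its vertices stays in a single box of the
    [k]-th tiling. *)
Theorem injective_continuous_leq : (m <= n)%N.
Proof.
rewrite leqNgt; apply/negP => nm.
have m0 : (0 < m%:R :> R) by rewrite ltr0n (leq_ltn_trans _ nm).
have [e e0 far] := opposite_faces_far.
(* The distance to the walls given by [exists_far_shift], rescaled to boxes of side [e]. *)
have de0 : 0 < (4 * m%:R)^-1 * e :> R by rewrite mulr_gt0 // invr_gt0 mulr_gt0.
have [K uc] := cube_uniform_continuity de0.
(* Truncation keeps [pt v] in the cube for every [v], since labels are needed on the whole of
   N^m. *)
pose pt (v : {ffun 'I_m -> nat}) : 'rV[R]_m := \row_i ((minn (v i) K.+1)%:R / K.+1%:R).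
have cpt v : cube (pt v).
  move=> i; rewrite mxE divr_ge0 //= ler_pdivrMr ?ltr0Sn // mul1r ler_nat.
  by rewrite geq_minr.
pose box (k : 'I_m) (y : 'rV[R]_n) (c : 'I_n) : int := Num.floor (y 0 c / e - k%:R / m%:R).
pose s (k : 'I_m) v := `[< exists x, [/\ cube x, x 0 k = 0 & box k (f x) =1 box k (f (pt v))] >].
have box_small k y y' : box k y =1 box k y' -> `|y - y'| < e.
  move=> bb; apply: norm_row_lt => // c; rewrite !mxE.
  have := bb c; rewrite /box => E.
  have /andP[] := floor_itv (y 0 c / e - k%:R / m%:R).
  have /andP[] := floor_itv (y' 0 c / e - k%:R / m%:R).
  rewrite E => h1 h2 h3 h4.
  have : `|y 0 c / e - y' 0 c / e| < 1.
    by rewrite ltr_norml; move: h2 h4; rewrite !rmorphD /=; lra.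
  by rewrite -mulrBl normrM normfV (gtr0_norm e0) ltr_pdivrMr // mul1r.
have [|v k vk|v k vk|v [vN Hv]] := @discrete_poincare_miranda m K.+1 s.
- by [].
- by apply/asboolP; exists (pt v); split=> //; rewrite mxE vk min0n mul0r.
- apply/asboolPn => -[x [cx xk /box_small]]; apply/negP; rewrite -leNgt.
  by apply: far (cx) (cpt v) xk _; rewrite mxE vk minnn divff // pnatr_eq0.
have [k Hk] := exists_far_shift (fun c => f (pt v) 0 c / e) nm.
have same (w : {ffun 'I_m -> nat}) : (forall i, (v i <= w i <= (v i).+1)%N) -> box k (f (pt w)) =1 box k (f (pt v)).
  move=> vw c; apply/esym/floor_eq_near; first exact: Hk.
  rewrite [X in `|X|](_ : _ = (f (pt v) 0 c - f (pt w) 0 c) / e); last by ring.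
  rewrite normrM normfV (gtr0_norm e0) ltr_pdivrMr //.
  have near i : `|pt v 0 i - pt w 0 i| <= K.+1%:R^-1.
    rewrite !mxE -mulrBl normrM normfV [X in _ * X^-1]ger0_norm //.
    rewrite ler_pdivrMr ?ltr0Sn // mulVf ?pnatr_eq0 //.
    have := vw i; have := vN i => h1 h2.
    have -> : minn (v i) K.+1 = v i by lia.
    have -> : minn (w i) K.+1 = w i by lia.
    rewrite distrC ger0_norm ?subr_ge0 ?ler_nat; last lia.
    by rewrite -natrB ?(ler_nat _ _ 1); lia.
  apply: le_lt_trans (uc _ _ (cpt v) (cpt w) near).
  by have := norm_coord_le (f (pt v) - f (pt w)) c; rewrite !mxE.
have [a [b [/same Ha /same Hb /asboolP [x [cx xk bx]] /asboolPn]]] := Hv k.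
by apply; exists x; split=> // c; rewrite bx Ha Hb.
Qed.

End invariance_of_dimension.

(** * The model spaces *)

Section dot_product.
Context {R : realType} {n : nat}.
Implicit Types (x y z : 'rV[R]_n) (a : R).

Lemma dotC x y : dot x y = dot y x.
Proof. by apply: eq_bigr => i _; rewrite mulrC. Qed.

Lemma dotDl x y z : dot (x + y) z = dot x z + dot y z.
Proof. by rewrite -big_split; apply: eq_bigr => i _; rewrite mxE mulrDl. Qed.

Lemma dotZl a x y : dot (a *: x) y = a * dot x y.
Proof. by rewrite mulr_sumr; apply: eq_bigr => i _; rewrite mxE mulrA. Qed.

Lemma dotDr x y z : dot x (y + z) = dot x y + dot x z.
Proof. by rewrite dotC dotDl !(dotC x). Qed.

Lemma dotZr a x y : dot x (a *: y) = a * dot x y.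
Proof. by rewrite dotC dotZl (dotC x). Qed.

Lemma dotNl x y : dot (- x) y = - dot x y.
Proof. by rewrite -scaleN1r dotZl mulN1r. Qed.

Lemma dotNr x y : dot x (- y) = - dot x y.
Proof. by rewrite dotC dotNl dotC. Qed.

Lemma dot0l y : dot 0 y = 0.
Proof. by rewrite -[0](scale0r 0) dotZl mul0r. Qed.

Definition dotE := (dotDl, dotDr, dotNl, dotNr, dotZl, dotZr).

Lemma dot_ge0 x : 0 <= dot x x.
Proof. by apply: sumr_ge0 => i _; rewrite -expr2 sqr_ge0. Qed.

Lemma dot_eq0 x : dot x x = 0 -> x = 0.
Proof.
move=> /eqP; rewrite psumr_eq0; last by move=> i _; rewrite -expr2 sqr_ge0.
move=> /allP H; apply/rowP => i; rewrite mxE; apply/eqP.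
by have := H i (mem_index_enum _); rewrite mulf_eq0 orbb.
Qed.

Lemma cauchy_schwarz x y : dot x y ^+ 2 <= dot x x * dot y y.
Proof.
have [y0|y0] := eqVneq (dot y y) 0.
  by rewrite (dot_eq0 y0) -[X in dot x X](scale0r 0) dotZr mul0r expr0n mulr_ge0 ?dot_ge0.
have := dot_ge0 (dot y y *: x - dot x y *: y).
rewrite !dotE (dotC y x) => H.
have y1 : 0 < dot y y by rewrite lt_def y0 dot_ge0.
have : 0 <= dot y y * (dot x x * dot y y - dot x y ^+ 2) by lra.
by rewrite pmulr_rge0 // subr_ge0.
Qed.

Lemma dot_unit_le1 x y : dot x x = 1 -> dot y y = 1 -> -1 <= dot x y <= 1.
Proof.
move=> x1 y1; have := cauchy_schwarz x y; rewrite x1 y1 mulr1 => H.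
by rewrite -ler_norml -(@ler_sqr _ `|dot x y|) ?nnegrE // real_normK ?num_real // expr1n.
Qed.

End dot_product.

(** * Trigonometry uniform in the sign of the curvature *)

Section generalized_trigonometry.
Context {R : realType} (kappa : R).

Definition cn (t : R) : R := if 0 < kappa then cos t
  else if kappa < 0 then (expR t + expR (- t)) / 2 else 1.

Definition sn (t : R) : R := if 0 < kappa then sin t
  else if kappa < 0 then (expR t - expR (- t)) / 2 else t.

(* The squared chord subtended by an arc of length [t]. *)
Definition chord2 (t : R) : R := if 0 < kappa then 2 * (1 - cos t)
  else if kappa < 0 then 2 * ((expR t + expR (- t)) / 2 - 1) else t ^+ 2.

Local Notation sigma := (Num.sg kappa).

(** Replaces the sign and both tests at once in goals where [cn], [sn] or [chord2] is unfolded. *)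
Lemma sg_cases (P : R -> bool -> bool -> Prop) : P 1 true false -> P (-1) false true ->
  P 0 false false -> P sigma (0 < kappa) (kappa < 0).
Proof.
move=> P1 P2 P3; case: (ltrgtP kappa 0) => k0.
- by rewrite ltr0_sg.
- by rewrite gtr0_sg.
- by rewrite k0 sgr0.
Qed.

Lemma expRN_mul (t : R) : expR t * expR (- t) = 1.
Proof. by rewrite -expRD subrr expR0. Qed.

Lemma sg_chord2 t : sigma * chord2 t = 2 * (1 - cn t).
Proof. by rewrite /chord2 /cn; elim/sg_cases: _ => /=; lra. Qed.

Lemma cn2_sn2 t : cn t ^+ 2 + sigma * sn t ^+ 2 = 1.
Proof.
rewrite /cn /sn; elim/sg_cases: _ => /=.
- by rewrite mul1r cos2Dsin2.
- by rewrite -[RHS](expRN_mul t); field.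
- by rewrite mul0r addr0 expr1n.
Qed.

Lemma snD a b : sn (a + b) = sn a * cn b + cn a * sn b.
Proof.
rewrite /cn /sn; elim/sg_cases: _ => /=.
- exact: sinD.
- by rewrite opprD !expRD; field.
- by rewrite mulr1 mul1r.
Qed.

Lemma cnN a : cn (- a) = cn a.
Proof. by rewrite /cn; elim/sg_cases: _ => /=; rewrite ?cosN // opprK addrC. Qed.

Lemma snN a : sn (- a) = - sn a.
Proof. by rewrite /sn; elim/sg_cases: _ => /=; rewrite ?sinN // opprK; lra. Qed.

Lemma cn0 : cn 0 = 1.
Proof. by rewrite /cn; elim/sg_cases: _ => /=; rewrite ?cos0 // oppr0 expR0; lra. Qed.

Lemma sn0 : sn 0 = 0.
Proof. by rewrite /sn; elim/sg_cases: _ => /=; rewrite ?sin0 // oppr0 subrr mul0r. Qed.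

Lemma chord2_0 : chord2 0 = 0.
Proof.
by rewrite /chord2; elim/sg_cases: _ => /=; rewrite ?cos0 ?oppr0 ?expR0 ?expr0n //; lra.
Qed.

Lemma chord2N a : chord2 (- a) = chord2 a.
Proof.
by rewrite /chord2; elim/sg_cases: _ => /=; rewrite ?cosN ?sqrrN // opprK (addrC (expR a)).
Qed.

Lemma chord2_norm a : chord2 `|a| = chord2 a.
Proof. by case: (ger0P a) => // _; rewrite chord2N. Qed.

(** An addition formula that keeps its content for curvature 0: the right side is the squared chord
    between points at distances [a] and [b] in opposite directions. *)
Lemma chord2D a b :
  chord2 (a + b) = sigma * (cn a - cn b) ^+ 2 + (sn a + sn b) ^+ 2.
Proof.
rewrite /chord2 /cn /sn; elim/sg_cases: _ => /=.
- by rewrite cosD; have := cos2Dsin2 a; have := cos2Dsin2 b; nra.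
- have := expRN_mul a; have := expRN_mul b; rewrite opprD !expRD.
  move: (expR a) (expR b) (expR (- a)) (expR (- b)) => x y x' y' h1 h2.
  have -> : 2 * ((x * y + x' * y') / 2 - 1) = x * y + x' * y' - 1 - 1 by field.
  by rewrite -{1}h1 -{1}h2; field.
- by rewrite mul0r add0r.
Qed.

(** The possible distances after rescaling to curvature -1, 0 or 1; on them [chord2] is strictly
    increasing. *)
Definition in_range (t : R) := 0 <= t /\ (0 < kappa -> t <= pi).

Lemma expR_sub_gt0 (t : R) : 0 < t -> 0 < expR t - expR (- t).
Proof. by move=> t0; rewrite subr_gt0 ltr_expR; lra. Qed.

Lemma sn_gt0 t : 0 < t -> (0 < kappa -> t < pi) -> 0 < sn t.
Proof.
rewrite /sn; elim/sg_cases: _ => //= t0 H.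
- by rewrite sin_gt0_pi // t0 H.
- by rewrite divr_gt0 // expR_sub_gt0.
Qed.

Lemma sn_ge0 t : in_range t -> 0 <= sn t.
Proof.
move=> [+ H]; rewrite le_eqVlt => /orP[/eqP <-|t0]; first by rewrite sn0.
have [tp|tp] := pselect (0 < kappa -> t < pi); first exact/ltW/sn_gt0.
have [k0 tpi] : 0 < kappa /\ t = pi.
  move/not_implyP: tp => [k0 /negP]; rewrite -leNgt => tp; split=> //.
  by apply/eqP; rewrite eq_le tp H.
by rewrite /sn k0 tpi sinpi.
Qed.

Lemma sn_gt0_range a b : 0 < a -> 0 < b -> (0 < kappa -> a <= pi /\ b < pi) ->
  0 < sn (a + b) -> 0 < kappa -> a + b < pi.
Proof.
move=> a0 b0 H s0 k0; have [ap bp] := H k0; rewrite ltNge; apply/negP => le.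
move: s0; rewrite /sn k0.
have -> : a + b = (a + b - pi) + pi by lra.
rewrite sinDpi ltNge oppr_le0; case/negP.
by apply: sin_ge0_pi; apply/andP; split; lra.
Qed.

Lemma chord2_lt a b : 0 <= a -> a < b -> (0 < kappa -> b <= pi) -> chord2 a < chord2 b.
Proof.
rewrite /chord2; elim/sg_cases: _ => //= a0 ab H.
- have bp := H isT; suff : cos b < cos a by lra.
  by rewrite ltr_cos // in_itv /=; apply/andP; split; lra.
- have ea : 1 <= expR a by rewrite -expR0 ler_expR.
  have eb : expR a < expR b by rewrite ltr_expR.
  have := expRN_mul a; have := expRN_mul b; have := expR_gt0 (- a); have := expR_gt0 (- b).
  move: (expR a) (expR b) (expR (- a)) (expR (- b)) ea eb => x y x' y' x1 xy y0 x0 hy hx.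
  have x'1 : x' <= 1 by nra.
  have y'1 : y' < 1 by nra.
  have : 0 < (y - x) * (1 - x' * y') by rewrite mulr_gt0 ?subr_gt0 //; nra.
  have -> : (y - x) * (1 - x' * y') = y - x - x' * (y * y') + y' * (x * x') by ring.
  by rewrite hx hy; lra.
- by rewrite ltr_pXn2r // nnegrE; lra.
Qed.

Lemma chord2_le_inv a b : in_range a -> in_range b -> chord2 a <= chord2 b -> a <= b.
Proof.
move=> [a0 Ha] [b0 Hb]; rewrite leNgt => /negP H; rewrite leNgt; apply/negP => ba.
by apply: H; exact: chord2_lt.
Qed.

Lemma chord2_inj a b : in_range a -> in_range b -> chord2 a = chord2 b -> a = b.
Proof.
move=> Ia Ib E; apply/eqP; rewrite eq_le.
by rewrite (chord2_le_inv Ia Ib) ?E // (chord2_le_inv Ib Ia) ?E.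
Qed.

Lemma is_derive_chord2 (t : R) : is_derive t 1 chord2 (2 * sn t).
Proof.
rewrite /chord2 /sn; elim/sg_cases: _ => /=.
- by apply: is_derive_eq; rewrite /GRing.scale /=; lra.
- by apply: is_derive_eq; rewrite /GRing.scale /=; lra.
- by apply: is_derive_eq; rewrite /GRing.scale /=; lra.
Qed.

End generalized_trigonometry.

(** * Bilinear forms and tangent vectors of the models *)

Section model_forms.
Context {R : realType} (kappa : R) {n : nat}.
Local Notation V := 'rV[R]_n.+1.
Local Notation sigma := (Num.sg kappa).
Implicit Types (x y z u w : V) (a : R).

Definition tl x : 'rV[R]_n := \row_i x 0 (lift ord0 i).

Lemma tlD x y : tl (x + y) = tl x + tl y.
Proof. by apply/rowP => i; rewrite !mxE. Qed.

Lemma tlZ a x : tl (a *: x) = a *: tl x.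
Proof. by apply/rowP => i; rewrite !mxE. Qed.

Lemma tlN x : tl (- x) = - tl x.
Proof. by apply/rowP => i; rewrite !mxE. Qed.

Lemma headtl_eq x y : x 0 0 = y 0 0 -> tl x = tl y -> x = y.
Proof.
move=> h t; apply/rowP => i; case: (unliftP ord0 i) => [j|] ->; last exact: h.
by move/rowP: t => /(_ j); rewrite !mxE.
Qed.

Lemma dot_recl x y : dot x y = x 0 0 * y 0 0 + dot (tl x) (tl y).
Proof.
by rewrite /dot big_ord_recl; congr (_ + _); apply: eq_bigr => i _; rewrite !mxE.
Qed.

Lemma lorentz_recl x y : lorentz x y = dot (tl x) (tl y) - x 0 0 * y 0 0.
Proof. by congr (_ - _); apply: eq_bigr => i _; rewrite !mxE. Qed.

(* [AA] cuts out the model space as [AA x x = 1] and [BB] restricts to its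
   Riemannian metric; when [kappa = 0] both are degenerate and the model is
   the affine hyperplane [x 0 0 = 1]. *)
Definition AA x y := x 0 0 * y 0 0 + sigma * dot (tl x) (tl y).
Definition BB x y := dot (tl x) (tl y) + sigma * (x 0 0 * y 0 0).

Definition tlE := (tlD, tlZ, tlN).

Lemma AAC x y : AA x y = AA y x.
Proof. by rewrite /AA dotC mulrC. Qed.
Lemma AADl x y z : AA (x + y) z = AA x z + AA y z.
Proof. by rewrite /AA !(tlE, dotE, mxE); ring. Qed.
Lemma AAZl a x z : AA (a *: x) z = a * AA x z.
Proof. by rewrite /AA !(tlE, dotE, mxE); ring. Qed.
Lemma AADr x y z : AA z (x + y) = AA z x + AA z y.
Proof. by rewrite !(AAC z) AADl. Qed.
Lemma AAZr a x z : AA z (a *: x) = a * AA z x.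
Proof. by rewrite !(AAC z) AAZl. Qed.
Lemma AANl x y : AA (- x) y = - AA x y.
Proof. by rewrite -scaleN1r AAZl mulN1r. Qed.
Lemma AANr x y : AA y (- x) = - AA y x.
Proof. by rewrite !(AAC y) AANl. Qed.
Lemma BBC x y : BB x y = BB y x.
Proof. by rewrite /BB dotC (mulrC (x 0 0)). Qed.
Lemma BBDl x y z : BB (x + y) z = BB x z + BB y z.
Proof. by rewrite /BB !(tlE, dotE, mxE); ring. Qed.
Lemma BBZl a x z : BB (a *: x) z = a * BB x z.
Proof. by rewrite /BB !(tlE, dotE, mxE); ring. Qed.
Lemma BBDr x y z : BB z (x + y) = BB z x + BB z y.
Proof. by rewrite !(BBC z) BBDl. Qed.
Lemma BBZr a x z : BB z (a *: x) = a * BB z x.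
Proof. by rewrite !(BBC z) BBZl. Qed.
Lemma BBNl x y : BB (- x) y = - BB x y.
Proof. by rewrite -scaleN1r BBZl mulN1r. Qed.
Lemma BBNr x y : BB y (- x) = - BB y x.
Proof. by rewrite !(BBC y) BBNl. Qed.

Definition AAE := (AADl, AADr, AANl, AANr, AAZl, AAZr).
Definition BBE := (BBDl, BBDr, BBNl, BBNr, BBZl, BBZr).

(** The sign condition selects the upper sheet of the hyperboloid, or the hyperplane [x 0 0 = 1]
    rather than [x 0 0 = -1] when [kappa = 0]. *)
Definition inM x := AA x x = 1 /\ (~~ (0 < kappa) -> 0 < x 0 0).

Lemma sg_BB x y : sigma * BB x y = sigma ^+ 2 * AA x y.
Proof.
rewrite /AA /BB; case: (ltrgtP kappa 0) => k0.
- by rewrite ltr0_sg //; ring.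
- by rewrite gtr0_sg //; ring.
- by rewrite k0 sgr0 expr0n !mul0r.
Qed.

Lemma inM_flat x : kappa = 0 -> inM x -> x 0 0 = 1.
Proof.
rewrite /inM /AA => ->; rewrite sgr0 ltxx mul0r addr0 => -[h /(_ isT) h2].
by apply/eqP; rewrite -[_ == _](@eqrXn2 _ 2) ?ltW // expr1n expr2 h.
Qed.

Lemma inM_hyp z : kappa < 0 -> inM z -> z 0 0 ^+ 2 = 1 + dot (tl z) (tl z) /\ 0 < z 0 0.
Proof.
move=> k0 []; rewrite /AA ltr0_sg // => h; rewrite ltNge (ltW k0) => /(_ isT) z0.
by split=> //; rewrite expr2; lra.
Qed.

Lemma tangent_flat z u : kappa = 0 -> inM z -> AA z u = 0 -> u 0 0 = 0.
Proof.
move=> k0 Mz; rewrite /AA (inM_flat k0 Mz) k0 sgr0 mul0r addr0 mul1r.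
by [].
Qed.

Lemma tangent_AA z u w : inM z -> AA z u = 0 -> AA z w = 0 -> AA u w = sigma * BB u w.
Proof.
move=> Mz Tu Tw; case: (ltrgtP kappa 0) => k0.
- by rewrite sg_BB ltr0_sg // sqrrN expr1n mul1r.
- by rewrite sg_BB gtr0_sg // expr1n mul1r.
- by rewrite /AA (tangent_flat k0 Mz Tu) k0 sgr0 !mul0r addr0.
Qed.

(** By Cauchy-Schwarz, a point of the lower sheet pairs negatively with every point of the upper
    sheet. *)
Lemma inM_pos x z : inM z -> AA x x = 1 -> 0 < AA x z -> inM x.
Proof.
move=> Mz x1 xz; split=> // /negP k1.
case: (ltrgtP kappa 0) => k0 //.
  have [z2 z0] := inM_hyp k0 Mz.
  move: x1 xz; rewrite /AA ltr0_sg // => x1 xz.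
  have cs := cauchy_schwarz (tl x) (tl z).
  rewrite ltNge; apply/negP => x0.
  set D := dot (tl x) (tl z) in xz cs.
  have X0 := dot_ge0 (tl x); have Z0 := dot_ge0 (tl z).
  have xz0 : x 0 0 * z 0 0 <= 0 by rewrite mulr_le0_ge0 // ltW.
  have h : 0 <= (x 0 0 * z 0 0 - D) * - (D + x 0 0 * z 0 0) by rewrite mulr_ge0 //; lra.
  have e : (x 0 0 * z 0 0) ^+ 2 = (1 + dot (tl x) (tl x)) * (1 + dot (tl z) (tl z)).
    by rewrite exprMn z2; congr (_ * _); rewrite expr2; lra.
  by nra.
by move: xz; rewrite /AA (inM_flat k0 Mz) k0 sgr0 mul0r addr0 mulr1.
Qed.

Let e0 : V := delta_mx 0 0.

(* For [kappa < 0], the Lorentz boost taking the tangent space at [z] to the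
   one at [(1, 0, .., 0)]. *)
Definition tangent_coord z u : V :=
  if kappa < 0 then
    u - u 0 0 *: e0 -
      (dot (tl u) (tl z) / (z 0 0 * (z 0 0 + 1))) *: (z - z 0 0 *: e0)
  else u.

(** For [kappa > 0] the form [BB] is the dot product, and for [kappa = 0] tangent vectors have first
    coordinate 0. For [kappa < 0] tangency expresses the first coordinate by the others. *)
Lemma tangent_coord_dot z u w : inM z -> AA z u = 0 -> AA z w = 0 ->
  dot (tangent_coord z u) (tangent_coord z w) = BB u w.
Proof.
move=> Mz Tu Tw; rewrite /tangent_coord; case: ifPn => k0.
  have [z2 z0] := inM_hyp k0 Mz.
  have tle0 : tl e0 = 0 by apply/rowP => i; rewrite !mxE.
  have e00 : e0 0 0 = 1 by rewrite mxE !eqxx.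
  move: (e0) e00 tle0 => e e00 tle0.
  rewrite dot_recl !mxE !e00 !mulr1 !subrr !mulr0 !subr0 mul0r add0r.
  rewrite !(tlD, tlN, tlZ) tle0 !scaler0 !subr0 !dotE (dotC (tl z)).
  rewrite /BB ltr0_sg //.
  move: Tu Tw; rewrite /AA ltr0_sg // => Tu Tw.
  have hu : u 0 0 = dot (tl u) (tl z) / z 0 0.
    apply: (canRL (mulfK _)); first by rewrite gt_eqF.
    by rewrite (dotC (tl u)); lra.
  have hw : w 0 0 = dot (tl w) (tl z) / z 0 0.
    apply: (canRL (mulfK _)); first by rewrite gt_eqF.
    by rewrite (dotC (tl w)); lra.
  have -> : dot (tl z) (tl z) = z 0 0 ^+ 2 - 1 by rewrite z2; lra.
  rewrite hu hw; field.
  by rewrite gt_eqF // gt_eqF //; lra.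
rewrite dot_recl /BB addrC; congr (_ + _).
case: (ltrgtP kappa 0) k0 => // k0 _; first by rewrite gtr0_sg // mul1r.
by rewrite k0 sgr0 mul0r (tangent_flat k0 Mz Tu) mul0r.
Qed.

Lemma tangent_BB_ge0 z u : inM z -> AA z u = 0 -> 0 <= BB u u.
Proof. by move=> Mz Tu; rewrite -(tangent_coord_dot Mz Tu Tu) dot_ge0. Qed.

Lemma tangent_BB_eq0 z u : inM z -> AA z u = 0 -> BB u u = 0 -> u = 0.
Proof.
move=> Mz Tu Bu; case: (ltrgtP kappa 0) => k0.
- have [z2 z0] := inM_hyp k0 Mz.
  move: Tu Bu; rewrite /AA /BB ltr0_sg // => Tu Bu.
  have cs := cauchy_schwarz (tl z) (tl u).
  have u0 : u 0 0 ^+ 2 = 0.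
    apply/eqP; rewrite eq_le sqr_ge0 andbT.
    have e1 : dot (tl z) (tl u) = z 0 0 * u 0 0 by lra.
    have e2 : dot (tl u) (tl u) = u 0 0 ^+ 2 by rewrite expr2; lra.
    by move: cs; rewrite e1 e2 exprMn z2; lra.
  have u00 : u 0 0 = 0 by apply/eqP; rewrite -sqrf_eq0 u0.
  apply: headtl_eq; first by rewrite mxE.
  have -> : tl u = 0 by apply: dot_eq0; move: Bu; rewrite u00; lra.
  by apply/rowP => i; rewrite !mxE.
- by apply: dot_eq0; rewrite dot_recl -Bu /BB gtr0_sg // mul1r addrC.
- apply: dot_eq0; rewrite dot_recl (tangent_flat k0 Mz Tu) mul0r add0r.
  by rewrite -Bu /BB k0 sgr0 mul0r addr0.
Qed.

Lemma tangent_unit z u w : inM z -> AA z u = 0 -> AA z w = 0 -> BB u u = 1 -> BB w w = 1 ->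
  -1 <= BB u w <= 1.
Proof.
move=> Mz Tu Tw u1 w1; rewrite -(tangent_coord_dot Mz Tu Tw).
by apply: dot_unit_le1; rewrite tangent_coord_dot.
Qed.

Lemma polar_inM z u t : inM z -> AA z u = 0 -> BB u u = 1 ->
  AA (cn kappa t *: z + sn kappa t *: u) (cn kappa t *: z + sn kappa t *: u) = 1.
Proof.
move=> Mz Tu u1; rewrite !AAE (AAC u z) Tu (tangent_AA Mz Tu Tu) u1.
by case: Mz => -> _; rewrite -[RHS](cn2_sn2 kappa t); ring.
Qed.

Lemma polar_pos z u t : inM z -> AA z u = 0 -> BB u u = 1 -> ~~ (0 < kappa) ->
  0 < (cn kappa t *: z + sn kappa t *: u) 0 0.
Proof.
move=> Mz Tu u1 k1; have := polar_inM t Mz Tu u1; set x := _ + _ => x1.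
have xz : 0 < AA x z.
  rewrite /x !AAE (AAC u z) Tu mulr0 addr0.
  case: (Mz) => -> _; rewrite mulr1 /cn (negbTE k1); case: ifP => // _.
  by rewrite divr_gt0 // addr_gt0 // expR_gt0.
by case: (inM_pos Mz x1 xz) => _; apply.
Qed.

(* The law of cosines. *)
Lemma polar_chord z u w a b : inM z -> AA z u = 0 -> AA z w = 0 ->
  BB u u = 1 -> BB w w = 1 ->
  BB ((cn kappa a *: z + sn kappa a *: u) - (cn kappa b *: z + sn kappa b *: w))
     ((cn kappa a *: z + sn kappa a *: u) - (cn kappa b *: z + sn kappa b *: w)) =
  chord2 kappa (a + b) - 2 * sn kappa a * sn kappa b * (1 + BB u w).
Proof.
move=> Mz Tu Tw u1 w1; rewrite chord2D.
have bz v : AA z v = 0 -> (cn kappa a - cn kappa b) * BB z v = 0.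
  move=> Tv; case: (eqVneq kappa 0) => [k0|k0].
    by rewrite /cn k0 ltxx subrr mul0r.
  have /eqP := sg_BB z v; rewrite Tv mulr0 mulf_eq0 sgr_eq0 (negbTE k0) /= => /eqP ->.
  by rewrite mulr0.
have bzz : (cn kappa a - cn kappa b) ^+ 2 * BB z z = (cn kappa a - cn kappa b) ^+ 2 * sigma.
  case: (eqVneq kappa 0) => [k0|k0].
    by rewrite /cn k0 ltxx subrr expr0n !mul0r.
  congr (_ * _); have := sg_BB z z; case: Mz => -> _; rewrite mulr1 expr2.
  by apply: mulfI; rewrite sgr_eq0.
have -> : (cn kappa a *: z + sn kappa a *: u) - (cn kappa b *: z + sn kappa b *: w) =
   (cn kappa a - cn kappa b) *: z + (sn kappa a *: u - sn kappa b *: w).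
  by rewrite scalerBl opprD addrACA.
rewrite !BBE u1 w1 (BBC w u) (BBC u z) (BBC w z).
transitivity ((cn kappa a - cn kappa b) ^+ 2 * BB z z +
    2 * sn kappa a * ((cn kappa a - cn kappa b) * BB z u) -
    2 * sn kappa b * ((cn kappa a - cn kappa b) * BB z w) +
    sn kappa a ^+ 2 + sn kappa b ^+ 2 - 2 * sn kappa a * sn kappa b * BB u w).
  by ring.
by rewrite !bz // bzz; ring.
Qed.

End model_forms.

(** * Distances and betweenness in a model space *)

Section model_geometry.
Context {R : realType} (kappa : R) {n : nat}.
Local Notation V := 'rV[R]_n.+1.
Local Notation M := (model kappa n).
Local Notation A := (AA kappa).
Local Notation B := (BB kappa).
Local Notation cs := (cn kappa).
Local Notation ss := (sn kappa).
Local Notation d := (@model_dist R kappa n).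
Implicit Types (p q r : M) (x y z u w : V) (a b t : R).

(* Moves the flat model to the hyperplane [x 0 0 = 1], off the origin. *)
Definition lft p : V := if 0 < kappa then val p else if kappa < 0 then val p
  else val p + delta_mx 0 0.

Lemma lft_inM p : inM kappa (lft p).
Proof.
have := set_mem (valP p); rewrite /lft; move: (val p) => x; rewrite /inM /model_set /AA.
case: (ltrgtP kappa 0) => k0.
- by rewrite /= ltr0_sg // lorentz_recl => -[h1 h2]; split=> //; lra.
- by rewrite /= gtr0_sg // mul1r dot_recl.
- rewrite /= => h; rewrite k0 sgr0 mul0r addr0 !mxE h !eqxx add0r mulr1.
  by split.
Qed.

Lemma inM_lft x : inM kappa x -> exists p, lft p = x.
Proof.
move=> Mx.
pose y := if 0 < kappa then x else if kappa < 0 then x else x - delta_mx 0 0.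
have yM : @model_set R kappa n y.
  move: (Mx); rewrite /y /inM /model_set /AA.
  case: (ltrgtP kappa 0) => k0.
  - by rewrite /= ltr0_sg // lorentz_recl => -[h1 h2]; split; [lra|exact: h2].
  - by rewrite /= gtr0_sg // mul1r dot_recl => -[].
  - by move=> _; rewrite /= !mxE !eqxx (inM_flat k0 Mx) subrr.
exists (exist _ y (mem_set yM)); rewrite /lft /= /y.
by case: (ltrgtP kappa 0) => k0 //; rewrite subrK.
Qed.

Lemma lft_inj p q : lft p = lft q -> p = q.
Proof.
move=> E; apply: val_inj; move: E; rewrite /lft; move: (val p) (val q) => x y.
by case: ifP => // _; case: ifP => // _; apply: addIr.
Qed.

Definition sc : R := if 0 < kappa then Num.sqrt kappa
  else if kappa < 0 then Num.sqrt (- kappa) else 1.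

Lemma sc_gt0 : 0 < sc.
Proof. by rewrite /sc; case: (ltrgtP kappa 0) => k0 //; rewrite sqrtr_gt0 // oppr_gt0. Qed.

(** The distance rescaled to curvature -1, 0 or 1. *)
Definition nd p q := sc * d p q.

(** The reversed Cauchy-Schwarz inequality on the hyperboloid. *)
Lemma hyp_AA_ge1 x y : kappa < 0 -> inM kappa x -> inM kappa y -> 1 <= A x y.
Proof.
move=> k0 Mx My; have [x2 x0] := inM_hyp k0 Mx; have [y2 y0] := inM_hyp k0 My.
rewrite /AA ltr0_sg //.
have cs := cauchy_schwarz (tl x) (tl y).
have := dot_ge0 (tl x - tl y); rewrite !dotE (dotC (tl y)) => h.
rewrite leNgt; apply/negP => lt.
move: cs h lt; set D := dot (tl x) (tl y) => cs h lt.
have xy0 : 0 < x 0 0 * y 0 0 by rewrite mulr_gt0.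
have e : (x 0 0 * y 0 0) ^+ 2 = (1 + dot (tl x) (tl x)) * (1 + dot (tl y) (tl y)).
  by rewrite exprMn x2 y2.
have : (x 0 0 * y 0 0) ^+ 2 < (1 + D) ^+ 2.
  by rewrite ltr_pXn2r ?nnegrE //; lra.
by rewrite e; nra.
Qed.

Lemma sph_AA_itv x y : 0 < kappa -> inM kappa x -> inM kappa y -> -1 <= A x y <= 1.
Proof.
move=> k0 [+ _] [+ _]; rewrite /AA gtr0_sg // !mul1r -!dot_recl.
exact: dot_unit_le1.
Qed.

(** These two facts determine the distance because [chord2] is injective on its range. Only here is
    [model_dist] unfolded. *)
Lemma ndP p q : in_range kappa (nd p q) /\
  chord2 kappa (nd p q) = B (lft p - lft q) (lft p - lft q).
Proof.
move: (set_mem (valP p)) (set_mem (valP q)) (lft_inM p) (lft_inM q).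
rewrite /nd /sc /in_range /chord2 /model_dist /lft; move: (val p) (val q) => x y.
rewrite /model_set; case: (ltrgtP kappa 0) => k0 hp hq Mp Mq.
- have := hyp_AA_ge1 k0 Mp Mq; case: Mp Mq => [+ _] [+ _].
  rewrite !BBE (BBC _ y x) /AA /BB /= ltr0_sg //.
  rewrite (mulrC (Num.sqrt _)) divfK; last by rewrite gt_eqF // sqrtr_gt0 oppr_gt0.
  have -> : - lorentz x y = x 0 0 * y 0 0 + -1 * dot (tl x) (tl y).
    by rewrite lorentz_recl; lra.
  set t := x 0 0 * y 0 0 + _ => {}hp {}hq t1.
  have s0 := sqrtr_ge0 (t ^+ 2 - 1).
  have s2 : Num.sqrt (t ^+ 2 - 1) ^+ 2 = t ^+ 2 - 1.
    by rewrite sqr_sqrtr // subr_ge0 -(expr1n _ 2) lerXn2r ?nnegrE //; lra.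
  rewrite /arcosh; set s := Num.sqrt _ in s0 s2 *.
  have ts0 : 0 < t + s by lra.
  split; first by split=> //; rewrite ln_ge0 //; lra.
  rewrite -lnV ?posrE // !lnK ?posrE ?invr_gt0 //.
  have -> : (t + s)^-1 = t - s.
    apply: (mulfI (lt0r_neq0 ts0)); rewrite mulfV ?gt_eqF //.
    by rewrite mulrC -subr_sqr s2; ring.
  rewrite (_ : (t + s + (t - s)) / 2 = t); last by field.
  by move: hp hq; rewrite /t; lra.
- have := sph_AA_itv k0 Mp Mq; case: Mp Mq => [+ _] [+ _].
  rewrite !BBE (BBC _ y x) /AA /BB /= gtr0_sg //.
  rewrite (mulrC (Num.sqrt _)) divfK; last by rewrite gt_eqF // sqrtr_gt0.
  rewrite !mul1r -!dot_recl => {}hp {}hq h.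
  rewrite acos_ge0 // acosK ?in_itv //=; split; first by split=> // _; exact: acos_lepi.
  by move: hp hq; rewrite !dot_recl; lra.
- move: hp hq; rewrite k0 mul1r /= => hp hq; split; first by split=> //; exact: sqrtr_ge0.
  rewrite /euclidean_dist sqr_sqrtr ?dot_ge0 // dot_recl /BB sgr0.
  have tle0 : tl (delta_mx 0 0 : V) = 0 by apply/rowP => i; rewrite !mxE.
  by rewrite !mxE hp hq subrr !mul0r addr0 add0r !tlD !tlN !tlD tle0 !addr0.
Qed.

Lemma nd_range p q : in_range kappa (nd p q). Proof. by case: (ndP p q). Qed.

Lemma nd_ge0 p q : 0 <= nd p q. Proof. by case: (nd_range p q). Qed.

Lemma nd_chord p q : chord2 kappa (nd p q) = B (lft p - lft q) (lft p - lft q).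
Proof. by case: (ndP p q). Qed.

Lemma AA_nd p q : A (lft p) (lft q) = cs (nd p q).
Proof.
case: (eqVneq kappa 0) => [k0|k0].
  by rewrite /AA (inM_flat k0 (lft_inM p)) (inM_flat k0 (lft_inM q)) /cn k0 ltxx sgr0; lra.
have := sg_chord2 kappa (nd p q); rewrite nd_chord sg_BB !AAE (AAC _ (lft q) (lft p)).
case: (lft_inM p) => -> _; case: (lft_inM q) => -> _.
rewrite (_ : Num.sg kappa ^+ 2 = 1) ?mul1r; first by lra.
by rewrite sqr_sg k0.
Qed.

Lemma nd_unique p q t : in_range kappa t ->
  chord2 kappa t = B (lft p - lft q) (lft p - lft q) -> nd p q = t.
Proof. by move=> It E; apply: (chord2_inj (nd_range p q) It); rewrite nd_chord E. Qed.

Lemma nd0 p : nd p p = 0.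
Proof.
apply: nd_unique; first by split=> // _; exact: pi_ge0.
by have := BBZl kappa 0 (0 : V) 0; rewrite subrr chord2_0 scale0r mul0r => ->.
Qed.

Lemma ndC p q : nd p q = nd q p.
Proof.
apply: nd_unique; first exact: nd_range.
by rewrite nd_chord -opprB BBNl BBNr opprK.
Qed.

(** The normalised component of [lft q] orthogonal to [lft p] is the initial direction of a
    geodesic. A positive sine excludes equal and antipodal points. *)
Lemma nd_direction p q : 0 < ss (nd p q) ->
  exists u, [/\ A (lft p) u = 0, B u u = 1 &
    lft q = cs (nd p q) *: lft p + ss (nd p q) *: u].
Proof.
move=> s0; have sn0 : ss (nd p q) != 0 by rewrite gt_eqF.
have u1 : A (lft p) (lft q - cs (nd p q) *: lft p) = 0.
  by rewrite !AAE (AA_nd p q); case: (lft_inM p) => -> _; ring.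
exists ((ss (nd p q))^-1 *: (lft q - cs (nd p q) *: lft p)); split.
- by rewrite AAZr u1 mulr0.
- rewrite !BBE (BBC _ (lft p) (lft q)).
  suff : B (lft q) (lft q) - 2 * cs (nd p q) * B (lft q) (lft p) +
    cs (nd p q) ^+ 2 * B (lft p) (lft p) = ss (nd p q) ^+ 2.
    move=> E; transitivity ((ss (nd p q))^-1 ^+ 2 * ss (nd p q) ^+ 2); last by field.
    by rewrite -E; ring.
  case: (eqVneq kappa 0) => [k0|k0].
    have := nd_chord p q; rewrite /cn /sn /chord2 k0 ltxx !BBE (BBC _ (lft p) (lft q)) => ->.
    by ring.
  have sg2 : Num.sg kappa ^+ 2 = 1 by rewrite sqr_sg k0.
  have E x y : B x y = Num.sg kappa * A x y.
    apply: (mulfI (_ : Num.sg kappa != 0)); first by rewrite sgr_eq0.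
    by rewrite sg_BB mulrA expr2.
  rewrite !E (AAC _ (lft q) (lft p)) (AA_nd p q).
  case: (lft_inM p) => -> _; case: (lft_inM q) => -> _.
  have E2 := cn2_sn2 kappa (nd p q).
  have : Num.sg kappa * (cs (nd p q) ^+ 2 + Num.sg kappa * ss (nd p q) ^+ 2) = Num.sg kappa.
    by rewrite E2 mulr1.
  rewrite mulrDr mulrA -expr2 sg2; lra.
- by rewrite scalerA divff // scale1r addrC subrK.
Qed.

Lemma nd_eq0 p q : nd p q = 0 -> p = q.
Proof.
move=> d0; apply: lft_inj; apply/eqP; rewrite -subr_eq0; apply/eqP.
have := nd_chord p q; rewrite d0 chord2_0 => E.
apply: (tangent_BB_eq0 (lft_inM p)) => //.
rewrite !AAE (AA_nd p q) d0 cn0; case: (lft_inM p) => -> _; lra.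
Qed.

Definition near p q := 0 < kappa -> nd p q < pi.

Lemma nearC p q : near p q -> near q p.
Proof. by rewrite /near ndC. Qed.

Lemma ss_gt0 p q : near p q -> p <> q -> 0 < ss (nd p q).
Proof.
move=> npq pq; apply: sn_gt0 => //; rewrite lt_def nd_ge0 andbT.
by apply/eqP => /nd_eq0.
Qed.

(* Law of cosines at [r], in the form without [cos]. *)
Lemma nd_cosine r p q u w : A (lft r) u = 0 -> A (lft r) w = 0 -> B u u = 1 -> B w w = 1 ->
  lft p = cs (nd r p) *: lft r + ss (nd r p) *: u ->
  lft q = cs (nd r q) *: lft r + ss (nd r q) *: w ->
  chord2 kappa (nd p q) = chord2 kappa (nd r p + nd r q) -
     2 * ss (nd r p) * ss (nd r q) * (1 + B u w).
Proof.
move=> Tu Tw u1 w1 Ep Eq; rewrite nd_chord Ep Eq.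
by rewrite (polar_chord _ _ (lft_inM r)).
Qed.

(** The law of cosines with [B u w >= -1]; if the right side reaches [pi] in positive curvature, the
    range of the distance suffices. *)
Lemma nd_triangle r p q : nd p q <= nd p r + nd r q.
Proof.
have [le|lt] := pselect (0 < kappa /\ pi <= nd p r + nd r q).
  by apply: le_trans (proj2 le); case: (nd_range p q) => _; apply; exact: proj1 le.
have sum_lt : 0 < kappa -> nd p r + nd r q < pi.
  by move=> k0; rewrite ltNge; apply/negP => le; apply: lt.
have p0 := nd_ge0 p r; have q0 := nd_ge0 r q.
have [->|pr] := pselect (p = r); first by rewrite nd0 add0r.
have [->|rq] := pselect (r = q); first by rewrite nd0 addr0.
have nrp : near r p by move=> k0; have := sum_lt k0; rewrite ndC; lra.
have nrq : near r q by move=> k0; have := sum_lt k0; lra.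
have s1 := ss_gt0 nrp (nesym pr); have s2 := ss_gt0 nrq rq.
have [u [Tu u1 Ep]] := nd_direction s1.
have [w [Tw w1 Eq]] := nd_direction s2.
apply: (@chord2_le_inv _ kappa); first exact: nd_range.
  by split=> [|/sum_lt/ltW //]; exact: addr_ge0.
rewrite (nd_cosine Tu Tw u1 w1 Ep Eq) ndC lerBlDr lerDl.
have /andP[g _] := tangent_unit (lft_inM r) Tu Tw u1 w1.
have g0 : 0 <= 1 + B u w by lra.
by rewrite !mulr_ge0 // ?(ndC p r) ltW.
Qed.

(** Equality in the triangle inequality forces [B u w = -1], so [w + u] is a tangent vector of
    length 0. *)
Lemma opposite_directions r p q u w : A (lft r) u = 0 -> A (lft r) w = 0 ->
  B u u = 1 -> B w w = 1 -> 0 < ss (nd r p) -> 0 < ss (nd r q) ->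
  lft p = cs (nd r p) *: lft r + ss (nd r p) *: u ->
  lft q = cs (nd r q) *: lft r + ss (nd r q) *: w ->
  nd p r + nd r q = nd p q -> w = - u.
Proof.
move=> Tu Tw u1 w1 s1 s2 Ep Eq E.
have := nd_cosine Tu Tw u1 w1 Ep Eq.
rewrite (ndC r p) E -[X in X = _]addr0 => /addrI /esym/eqP.
rewrite oppr_eq0 !mulf_eq0 pnatr_eq0 (ndC p r) (gt_eqF s1) (gt_eqF s2) /= => /eqP g.
have uw : w + u = 0.
  apply: (tangent_BB_eq0 (lft_inM r)); first by rewrite AADr Tu Tw addr0.
  by rewrite !BBE u1 w1 (BBC _ w u); lra.
by have /eqP := uw; rewrite addr_eq0 => /eqP.
Qed.

(** In polar coordinates at [r] the ends [p] and [q] have opposite directions, and the addition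
    formula for the sine yields the coefficients. *)
Lemma between_lft p q r : near p q -> p <> q -> nd p r + nd r q = nd p q ->
  lft r = (ss (nd r q) / ss (nd p q)) *: lft p + (ss (nd p r) / ss (nd p q)) *: lft q.
Proof.
move=> npq pq E; have s0 := ss_gt0 npq pq.
have [pr|pr] := pselect (p = r).
  by rewrite -pr nd0 sn0 mul0r scale0r addr0 divff ?gt_eqF // scale1r.
have [rq|rq] := pselect (r = q).
  by rewrite rq nd0 sn0 mul0r scale0r add0r divff ?gt_eqF // scale1r.
have p0 := nd_ge0 p r; have q0 := nd_ge0 r q.
have nrp : near r p by move=> k0; have := npq k0; rewrite (ndC r p); lra.
have nrq : near r q by move=> k0; have := npq k0; lra.
have s1 := ss_gt0 nrp (nesym pr); have s2 := ss_gt0 nrq rq.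
have [u [Tu u1 Ep]] := nd_direction s1.
have [w [Tw w1 Eq]] := nd_direction s2.
have uw := opposite_directions Tu Tw u1 w1 s1 s2 Ep Eq E.
have D0 : ss (nd p q) != 0 by rewrite gt_eqF.
have ED : ss (nd p q) = ss (nd r p) * cs (nd r q) + cs (nd r p) * ss (nd r q).
  by rewrite -E snD (ndC p r).
rewrite {1}Ep {1}Eq uw (ndC p r); move: D0; rewrite ED.
move: (ss (nd r p)) (cs (nd r p)) (ss (nd r q)) (cs (nd r q)) => sa ca sb cb D0.
by apply/rowP => i; rewrite !mxE; field.
Qed.

Lemma between_unique p q r r' : near p q -> nd p r + nd r q = nd p q ->
  nd p r' + nd r' q = nd p q -> nd p r = nd p r' -> r = r'.
Proof.
move=> npq E E' pr; have [pq|pq] := pselect (p = q).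
  subst q; move: E E'; rewrite nd0 => E E'.
  have e1 : nd p r = 0 by move: E (nd_ge0 p r); rewrite (ndC r p); lra.
  by rewrite -(nd_eq0 e1); apply: nd_eq0; rewrite -pr.
apply: lft_inj; rewrite (between_lft npq pq E) (between_lft npq pq E') pr.
by rewrite (_ : nd r q = nd r' q) //; lra.
Qed.

(** Converse of [between_lft]. At [r] the tangential parts of [a *: lft p] and [b *: lft q] cancel,
    so [p] and [q] lie in opposite directions and the law of cosines equates two chords. It remains
    to see that the sum of the distances does not pass [pi]. *)
Lemma combination_between p q r a b : near p q -> 0 <= a -> 0 <= b ->
  lft r = a *: lft p + b *: lft q -> nd p r + nd r q = nd p q.
Proof.
move=> npq a0 b0 Er; rewrite (ndC p r).
have one c x y : inM kappa x -> inM kappa y -> 0 <= c -> x = c *: y -> x = y.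
  move=> Mx My c0 E; rewrite E (_ : c = 1) ?scale1r //.
  case: (Mx); rewrite E !AAE; case: My => -> _ + _; rewrite mulr1 -expr2 => /eqP.
  by rewrite sqrf_eq1 => /orP[/eqP|/eqP] //; lra.
have [rp|rp] := pselect (r = p); first by rewrite rp nd0 add0r.
have [rq|rq] := pselect (r = q); first by rewrite rq nd0 addr0 ndC.
have Mr := lft_inM r; have Mp := lft_inM p; have Mq := lft_inM q.
have a1 : 0 < a.
  rewrite lt_def a0 andbT; apply/eqP => az; apply: rq; apply: lft_inj.
  by apply: (one b) => //; rewrite Er az scale0r add0r.
have b1 : 0 < b.
  rewrite lt_def b0 andbT; apply/eqP => bz; apply: rp; apply: lft_inj.
  by apply: (one a) => //; rewrite Er bz scale0r addr0.
(* If [r] were antipodal to [s], then [t'] would be a negative multiple of [s], hence antipodal to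
   [s] as well, against [near s t']. *)
have antip (s t' : M) c e : near s t' -> 0 < c -> 0 < e -> lft r = c *: lft s + e *: lft t' ->
    r <> s -> near r s.
  move=> nst c1 e1 E rs k0; case: (nd_range r s) => _ /(_ k0).
  rewrite le_eqVlt => /orP[/eqP pi_|//].
  have Ms := lft_inM s; have Mt := lft_inM t'.
  have As : A (lft r) (lft s) = -1 by rewrite AA_nd pi_ /cn k0 cospi.
  have rs0 : lft r + lft s = 0.
    have : A (lft r + lft s) (lft r + lft s) = 0.
      by rewrite !AAE (AAC _ (lft s) (lft r)) As; case: (Mr) => -> _; case: (Ms) => -> _; lra.
    by rewrite /AA gtr0_sg // mul1r -dot_recl => /dot_eq0.
  have st : lft t' = - lft s.
    have /eqP : (c + 1) *: lft s + e *: lft t' = 0.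
      by rewrite scalerDl scale1r addrAC -E.
    rewrite addr_eq0 => /eqP E2.
    have Mt' : inM kappa (- lft t').
      by split; [rewrite !AAE; case: Mt => -> _; lra | rewrite k0].
    rewrite -[lft t']opprK; congr (- _); apply/esym.
    apply: (one (e / (c + 1))) => //; first by rewrite divr_ge0 //; lra.
    rewrite scalerN (mulrC e) -scalerA -scalerN -E2 scalerA mulVf ?scale1r //.
    by rewrite gt_eqF //; lra.
  have := nst k0; have : A (lft s) (lft t') = -1 by rewrite st !AAE; case: Ms => -> _.
  rewrite AA_nd /cn k0 => c1'.
  case: (nd_range s t') => h1 /(_ k0) h2 h3.
  have : cos pi < cos (nd s t').
    rewrite ltr_cos // in_itv /=; apply/andP; split=> //; exact: pi_ge0.
  by rewrite cospi c1' ltxx.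
have nrp := antip p q a b npq a1 b1 Er rp.
have nrq : near r q.
  by apply: (antip q p b a) => //; [exact: nearC | rewrite addrC].
have s1 := ss_gt0 nrp rp; have s2 := ss_gt0 nrq rq.
have [u [Tu u1 Ep]] := nd_direction s1.
have [w [Tw w1 Eq]] := nd_direction s2.
have c1 : a * cs (nd r p) + b * cs (nd r q) = 1.
  have : A (lft r) (lft r) = 1 by case: Mr.
  by rewrite {2}Er !AAE !AA_nd.
have perp : a * ss (nd r p) *: u + b * ss (nd r q) *: w = 0.
  have : a *: lft p + b *: lft q - lft r = 0 by rewrite -Er subrr.
  rewrite {1}Ep {1}Eq !scalerDr !scalerA addrACA -scalerDl c1 scale1r.
  by rewrite addrAC subrr add0r.
have uw : w = - u /\ a * ss (nd r p) = b * ss (nd r q).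
  have /eqP := perp; rewrite addr_eq0 => /eqP E.
  have E2 : (a * ss (nd r p)) ^+ 2 = (b * ss (nd r q)) ^+ 2.
    have := congr1 (fun v => B v v) E; rewrite /= !BBE u1 w1; lra.
  have E3 : a * ss (nd r p) = b * ss (nd r q).
    by apply/eqP; rewrite -(@eqrXn2 _ 2) ?E2 // mulr_ge0 // ltW.
  split=> //; move: E; rewrite E3 => /eqP; rewrite -scalerN -subr_eq0 -scalerBr.
  rewrite scaler_eq0 mulf_eq0 (gt_eqF b1) (gt_eqF s2) /= opprK.
  by rewrite addr_eq0 => /eqP ->; rewrite opprK.
case: uw => uw E3.
apply/esym/nd_unique; last first.
  by rewrite -nd_chord (nd_cosine Tu Tw u1 w1 Ep Eq) uw BBNr u1 subrr mulr0 subr0.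
split; first by rewrite addr_ge0 ?nd_ge0.
move=> k0; apply/ltW/(@sn_gt0_range _ kappa) => //.
- by rewrite lt_def nd_ge0 andbT; apply/eqP => /nd_eq0.
- by rewrite lt_def nd_ge0 andbT; apply/eqP => /nd_eq0.
- by move=> _; split; [exact/ltW/nrp | exact: nrq].
(* By [c1] and [E3], the sine of the sum multiplied by [a] is [ss (nd r q)]. *)
rewrite snD -(pmulr_rgt0 _ a1).
move: (ss (nd r p)) (cs (nd r p)) (ss (nd r q)) (cs (nd r q)) c1 E3 s2 => sa ca sb cb c1 E3 s2.
have -> : a * (sa * cb + ca * sb) = (a * sa) * cb + (a * ca) * sb by ring.
have -> : a * ca = 1 - b * cb by lra.
by rewrite E3; move: s2; lra.
Qed.

Lemma ray_point p u t : A (lft p) u = 0 -> B u u = 1 -> exists q,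
  lft q = cs t *: lft p + ss t *: u.
Proof.
move=> Tu u1; apply: inM_lft; split; first exact: (polar_inM _ (lft_inM p)).
exact: (polar_pos _ (lft_inM p)).
Qed.

Lemma ray_dist p u s t q r : A (lft p) u = 0 -> B u u = 1 ->
  lft q = cs s *: lft p + ss s *: u -> lft r = cs t *: lft p + ss t *: u ->
  in_range kappa `|s - t| -> nd q r = `|s - t|.
Proof.
move=> Tu u1 Eq Er I; apply: nd_unique => //; rewrite chord2_norm.
have Er' : lft r = cs (- t) *: lft p + ss (- t) *: (- u).
  by rewrite Er cnN snN scaleNr scalerN opprK.
rewrite Eq Er' (polar_chord _ _ (lft_inM p)) ?AANr ?Tu ?oppr0 ?BBNr ?BBNl ?opprK //.
by rewrite u1; ring.
Qed.

End model_geometry.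

Lemma kernel_vector (F : fieldType) p q (C : 'M[F]_(p, q)) : (q < p)%N ->
  exists2 x : 'rV[F]_p, x != 0 & x *m C = 0.
Proof.
move=> qp; exists (nz_row (kermx C)).
  rewrite nz_row_eq0 -mxrank_eq0 mxrank_ker subn_eq0 -ltnNge.
  exact: leq_ltn_trans (rank_leq_col C) qp.
by apply/eqP; rewrite -sub_kermx nz_row_sub.
Qed.

(** * General position implies linear independence of the lifted vertices *)

Section independence_of_vertices.
Context {R : realType} (kappa : R).
Local Notation A := (AA kappa).
Local Notation B := (BB kappa).

Lemma AA_sumr m (I : finType) (a : I -> R) (x : I -> 'rV[R]_m.+1) z :
  A z (\sum_i a i *: x i) = \sum_i a i * A z (x i).
Proof.
elim/big_rec2: _ => [|i c s _ IH]; first by rewrite -(scale0r (0 : 'rV_m.+1)) AAZr mul0r.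
by rewrite AADr AAZr IH.
Qed.

Lemma BB_sumr m (I : finType) (a : I -> R) (x : I -> 'rV[R]_m.+1) z :
  B z (\sum_i a i *: x i) = \sum_i a i * B z (x i).
Proof.
elim/big_rec2: _ => [|i c s _ IH]; first by rewrite -(scale0r (0 : 'rV_m.+1)) BBZr mul0r.
by rewrite BBDr BBZr IH.
Qed.

Lemma tangent_sum m (I : finType) (a : I -> R) (x : I -> 'rV[R]_m.+1) z :
  (forall i, A z (x i) = 0) -> A z (\sum_i a i *: x i) = 0.
Proof. by move=> H; rewrite AA_sumr big1 // => i _; rewrite H mulr0. Qed.

(** These are [l + 1] linear equations in [m + 1] unknowns. *)
Lemma tangent_perp m (z : 'rV[R]_m.+1) l (e : 'I_l -> 'rV[R]_m.+1) : (l < m)%N ->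
  exists x, [/\ x != 0, A z x = 0 & forall b, B (e b) x = 0].
Proof.
move=> lm.
pose C : 'M[R]_(m.+1, l.+1) := \matrix_(i, b)
  if unlift ord0 b is Some b' then B (e b') (delta_mx 0 i) else A z (delta_mx 0 i).
have [|x x0 xC] := @kernel_vector _ _ _ C; first by rewrite ltnS.
exists x; split=> [//||b].
- move/rowP: xC => /(_ ord0); rewrite !mxE => E.
  rewrite [x]row_sum_delta AA_sumr -[RHS]E.
  by apply: eq_bigr => i _; rewrite mxE unlift_none.
- move/rowP: xC => /(_ (lift ord0 b)); rewrite !mxE => E.
  rewrite [x]row_sum_delta BB_sumr -[RHS]E.
  by apply: eq_bigr => i _; rewrite mxE liftK.
Qed.

(* Gram-Schmidt in the tangent space at [z], which has dimension [m]; vectors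
   depending on the previous ones are replaced by arbitrary ones. *)
Lemma orthonormal_tangent m (z : 'rV[R]_m.+1) l (u : 'I_l -> 'rV[R]_m.+1) :
  inM kappa z -> (l <= m)%N -> (forall a, A z (u a) = 0) ->
  exists e : 'I_l -> 'rV[R]_m.+1, [/\ forall a, A z (e a) = 0,
    forall a b, B (e a) (e b) = (a == b)%:R &
    forall a, exists t : 'I_l -> R, u a = \sum_b t b *: e b].
Proof.
move=> Mz; elim: l u => [|l IH] u lm Tu.
  by exists (fun=> 0); split=> -[].
have [e [Te ee ue]] := IH (fun a => u (lift ord_max a)) (ltnW lm) (fun a => Tu _).
pose r := u ord_max - \sum_b B (u ord_max) (e b) *: e b.
have Br b : B (e b) r = 0.
  rewrite /r BBDr BBNr BB_sumr (bigD1 b) //= ee eqxx mulr1 big1 ?addr0.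
    by rewrite (BBC _ (u _)) subrr.
  by move=> c cb; rewrite ee eq_sym (negbTE cb) mulr0.
have Tr : A z r = 0 by rewrite /r AADr AANr Tu tangent_sum // subr0.
have [x [x0 Tx Bx ux]] : exists x, [/\ x != 0, A z x = 0, forall b, B (e b) x = 0 &
    exists t, r = t *: x].
  have [r0|r0] := eqVneq r 0.
    have [x [x0 Tx Bx]] := tangent_perp z e lm.
    by exists x; split=> //; exists 0; rewrite scale0r r0.
  by exists r; split=> //; exists 1; rewrite scale1r.
have B0 : 0 < B x x.
  rewrite lt_def (tangent_BB_ge0 Mz Tx) andbT; apply: contra x0 => /eqP E.
  by apply/eqP; exact: (tangent_BB_eq0 Mz Tx).
have s0 : Num.sqrt (B x x) != 0 by rewrite gt_eqF // sqrtr_gt0.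
pose x1 := (Num.sqrt (B x x))^-1 *: x.
have x11 : B x1 x1 = 1.
  rewrite !BBE -{3}(sqr_sqrtr (ltW B0)); field; exact: s0.
have ex1 b : B (e b) x1 = 0 by rewrite BBZr Bx mulr0.
pose e' a := if unlift ord_max a is Some b then e b else x1.
have e'l b : e' (lift ord_max b) = e b by rewrite /e' liftK.
have e'm : e' ord_max = x1 by rewrite /e' unlift_none.
have sume' (t : 'I_l -> R) c :
    exists t' : 'I_l.+1 -> R, \sum_b t b *: e b + c *: x1 = \sum_b t' b *: e' b.
  exists (fun a => if unlift ord_max a is Some b then t b else c).
  rewrite (bigD1 ord_max) //= unlift_none e'm addrC; congr (_ + _).
  rewrite (reindex_omap (lift ord_max) (unlift ord_max)) /=; last first.
    by move=> i; case: unliftP => [j ->|->] //; rewrite ?eqxx.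
  apply: eq_big => [i|i _]; first by rewrite eq_sym neq_lift liftK eqxx.
  by rewrite liftK e'l.
exists e'; split.
- by move=> a; rewrite /e'; case: unliftP => // _; rewrite AAZr Tx mulr0.
- move=> a b; case: (unliftP ord_max a) => [a' ->|->]; case: (unliftP ord_max b) => [b' ->|->].
  + by rewrite !e'l ee (inj_eq lift_inj).
  + by rewrite e'l e'm ex1 eq_sym (negbTE (neq_lift _ _)).
  + by rewrite e'l e'm BBC ex1 (negbTE (neq_lift _ _)).
  + by rewrite e'm x11 eqxx.
- move=> a; case: (unliftP ord_max a) => [a' ->|->].
    have [t ->] := ue a'; have [t' E] := sume' t 0; exists t'.
    by rewrite -E scale0r addr0.
  have [t rx] := ux.
  have [t' E] := sume' (fun b => B (u ord_max) (e b)) (t * Num.sqrt (B x x)).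
  exists t'; rewrite -E scalerA mulfK // -rx /r addrC subrK //.
Qed.

Lemma cn_gt0 t : ~~ (0 < kappa) -> 0 < cn kappa t.
Proof.
move=> k1; rewrite /cn (negbTE k1); case: ifP => // _.
by rewrite divr_gt0 // addr_gt0 // expR_gt0.
Qed.

(** The linear map [F] taking the standard frame to [z] and the [e a] preserves [AA], and [BB] on
    differences of model points. Hence it carries the [l]-dimensional model isometrically onto the
    slice of the larger one by the span. *)
Lemma plane_through m l (z : 'rV[R]_m.+1) (e : 'I_l -> 'rV[R]_m.+1) : inM kappa z ->
  (forall a, A z (e a) = 0) -> (forall a b, B (e a) (e b) = (a == b)%:R) ->
  exists2 P : set (model kappa m), is_plane l P &
    forall p, (exists c (t : 'I_l -> R), lft p = c *: z + \sum_a t a *: e a) -> P p.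
Proof.
move=> Mz Te ee.
pose F (x : 'rV[R]_l.+1) := x 0 0 *: z + \sum_a x 0 (lift ord0 a) *: e a.
have FD x y : F (x - y) = F x - F y.
  rewrite /F opprD addrACA -scalerBl !mxE; congr (_ + _).
  by rewrite -sumrB; apply: eq_bigr => a _; rewrite !mxE scalerBl.
have sumB (t s : 'I_l -> R) :
    B (\sum_a t a *: e a) (\sum_a s a *: e a) = \sum_a t a * s a.
  rewrite BB_sumr; apply: eq_bigr => a _; rewrite BBC BB_sumr (bigD1 a) //=.
  rewrite ee eqxx mulr1 big1 ?addr0 1?mulrC // => b ba.
  by rewrite ee eq_sym (negbTE ba) mulr0.
have AF x y : A (F x) (F y) = A x y.
  have T t : A z (\sum_a t a *: e a) = 0 := tangent_sum _ Te.
  rewrite /F AADl !AADr !AAZl !AAZr T (AAC _ (\sum_a _) z) T !mulr0 addr0 add0r.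
  rewrite (tangent_AA Mz (T _) (T _)) sumB; case: (Mz) => -> _.
  rewrite /AA /dot mulr1; congr (_ + _ * _).
  by apply: eq_bigr => a _; rewrite !mxE.
have zF x : A z (F x) = x 0 0.
  by rewrite /F AADr AAZr tangent_sum // addr0; case: Mz => ->; rewrite mulr1.
have FM x : inM kappa x <-> inM kappa (F x).
  split=> -[x1 x0].
    split; first by rewrite AF.
    move=> k1; have x1' : A (F x) (F x) = 1 by rewrite AF.
    have xz : 0 < A (F x) z by rewrite AAC zF x0.
    by case: (inM_pos Mz x1' xz) => _; apply.
  split; first by rewrite -AF.
  move=> k1; rewrite -zF.
  have [p Ep] := inM_lft Mz; have [q Eq] := inM_lft (conj x1 x0).
  by rewrite -Ep -Eq AA_nd cn_gt0.
have BF x y : inM kappa x -> inM kappa y -> B (F (x - y)) (F (x - y)) = B (x - y) (x - y).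
  move=> Mx My; case: (eqVneq kappa 0) => [k0|k0].
    have h0 : (x - y) 0 0 = 0 by rewrite !mxE !(inM_flat k0) // subrr.
    rewrite /F h0 scale0r add0r sumB /BB h0 !mul0r mulr0 addr0.
    by apply: eq_bigr => a _; rewrite !mxE.
  apply: (mulfI (_ : Num.sg kappa != 0)); first by rewrite sgr_eq0.
  by rewrite !sg_BB AF.
have H (p : model kappa l) : exists q : model kappa m, lft q = F (lft p).
  by apply: inM_lft; exact: (proj1 (FM _) (lft_inM p)).
have [f Hf] := choice H.
exists (range f).
  exists f; split=> // p q _ _.
  apply: (mulfI (lt0r_neq0 (sc_gt0 kappa))); apply: nd_unique; first exact: nd_range.
  by rewrite -/(nd p q) nd_chord !Hf -FD BF //; exact: lft_inM.
move=> p [c [t Ep]].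
pose x : 'rV[R]_l.+1 := \row_i if unlift ord0 i is Some a then t a else c.
have Fx : F x = lft p.
  rewrite Ep /F mxE unlift_none; congr (_ + _).
  by apply: eq_bigr => a _; rewrite mxE liftK.
have [q Eq] : exists q : model kappa l, lft q = x.
  by apply: inM_lft; apply: (proj2 (FM x)); rewrite Fx; exact: lft_inM.
by exists q => //; apply: lft_inj; rewrite Hf Eq.
Qed.

(** A relation with [c i0 != 0] puts the lift of [v i0] in the span of the others, so a plane of
    dimension one less than the simplex contains all the vertices. For a single vertex the lift is
    nonzero. *)
Lemma general_position_free m k (v : 'I_k.+1 -> model kappa m) : (k <= m)%N ->
  general_position v -> forall c : 'I_k.+1 -> R, \sum_i c i *: lft (v i) = 0 ->
  forall i, c i = 0.
Proof.
move=> km gp c c0 i0; apply/eqP/negPn/negP => ci0.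
case: k => [|k] in v km gp c c0 i0 ci0 *.
  move: c0; rewrite big_ord1 (ord1 i0) in ci0 * => /eqP.
  rewrite scaler_eq0 (negbTE ci0) /= => /eqP E.
  have [] := lft_inM (v ord0); rewrite E -(scale0r (0 : 'rV_m.+1)) AAZl mul0r => /eqP.
  by rewrite eq_sym oner_eq0.
pose j := lift i0 ord0; pose w (a : 'I_k) := v (lift i0 (lift ord0 a)).
have Mz := lft_inM (v j); set z := lft (v j) in Mz.
pose u a := lft (w a) - A z (lft (w a)) *: z.
have Tu a : A z (u a) = 0.
  by rewrite /u AADr AANr AAZr; case: Mz => -> _; rewrite mulr1 subrr.
have [e [Te ee ue]] := orthonormal_tangent Mz (ltnW km) Tu.
have [P plP HP] := plane_through Mz Te ee.
apply: (gp k erefl P plP) => p [i _ <-].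
have other i' : i' != i0 ->
    exists c t, lft (v i') = c *: z + \sum_(a < k) t a *: e a.
  case: (unliftP i0 i') => [i1 ->|->]; rewrite ?eqxx // => _.
  case: (unliftP ord0 i1) => [a ->|->].
    have [t Ht] := ue a; exists (A z (lft (w a))), t.
    by rewrite -Ht /u addrC subrK.
  by exists 1, (fun=> 0); rewrite scale1r big1 ?addr0 // => a _; rewrite scale0r.
apply: HP; case: (eqVneq i i0) => [->|]; last exact: other.
have H i' : exists ct : R * ('I_k -> R), i' != i0 ->
    lft (v i') = ct.1 *: z + \sum_a ct.2 a *: e a.
  case: (eqVneq i' i0) => [->|ne]; first by exists (0, fun=> 0).
  by have [c' [t E]] := other i' ne; exists (c', t).
have [g Hg] := choice H.
have E : lft (v i0) = \sum_(i' | i' != i0) (- (c i0)^-1 * c i') *: lft (v i').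
  move: c0; rewrite (bigD1 i0) //= => /eqP; rewrite addr_eq0 => /eqP E.
  apply: (scalerI ci0); rewrite E scaler_sumr -sumrN; apply: eq_bigr => i' _.
  by rewrite scalerA mulrA mulrN divff // mulN1r scaleNr.
exists (\sum_(i' | i' != i0) (- (c i0)^-1 * c i') * (g i').1),
  (fun a => \sum_(i' | i' != i0) (- (c i0)^-1 * c i') * (g i').2 a).
rewrite E scaler_suml (eq_bigr (fun a => \sum_(i' | i' != i0)
   ((- (c i0)^-1 * c i') * (g i').2 a) *: e a)); last by move=> a _; rewrite scaler_suml.
rewrite exchange_big -big_split /=; apply: eq_bigr => i' ne.
rewrite Hg // scalerDr scalerA scaler_sumr; congr (_ + _).
by apply: eq_bigr => a _; rewrite scalerA.
Qed.

End independence_of_vertices.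

(** * Geodesic simplices *)

Definition clusters {R : realType} (T : Type) (d : T -> T -> R) (u : nat -> T) (p : T) :=
  forall e, 0 < e -> forall N : nat, exists k : nat, (N <= k)%N /\ d (u k) p < e.

Definition seq_compact {R : realType} (T : Type) (d : T -> T -> R) (A : set T) :=
  forall u : nat -> T, (forall k, A (u k)) -> exists2 p, A p & clusters d u p.

(* The points through which every segment in [A] ending there can be prolonged
   inside [A]: a notion of interior that only depends on the metric of [A]. *)
Definition extendable {R : realType} (T : Type) (d : T -> T -> R) (A : set T) (x : T) :=
  A x /\ forall y, A y -> y <> x ->
    exists z, [/\ A z, z <> x & d y x + d x z = d y z].

Section model_metric.
Context {R : realType} {kappa : R} {m : nat}.
Local Notation M := (model kappa m).
Local Notation d := (@model_dist R kappa m).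
Implicit Types p q r : M.

Lemma model_distE p q : d p q = nd p q / sc kappa.
Proof. by rewrite /nd mulrC mulKf // gt_eqF // sc_gt0. Qed.

Lemma model_dist_ge0 p q : 0 <= d p q.
Proof. by rewrite model_distE divr_ge0 ?nd_ge0 // ltW // sc_gt0. Qed.

Lemma model_dist0 p : d p p = 0.
Proof. by rewrite model_distE nd0 mul0r. Qed.

Lemma model_distC p q : d p q = d q p.
Proof. by rewrite !model_distE ndC. Qed.

Lemma model_dist_eq0 p q : d p q = 0 -> p = q.
Proof. by move=> E; apply: nd_eq0; rewrite /nd E mulr0. Qed.

Lemma model_dist_triangle r p q : d p q <= d p r + d r q.
Proof.
by rewrite !model_distE -mulrDl ler_pM2r ?invr_gt0 ?sc_gt0 // nd_triangle.
Qed.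

Lemma model_dist_gt0 p q : p <> q -> 0 < d p q.
Proof. by move=> pq; rewrite lt_def model_dist_ge0 andbT; apply/eqP => /model_dist_eq0. Qed.

Lemma model_dist_nd_sum p q r : (d p r + d r q = d p q) <-> (nd p r + nd r q = nd p q).
Proof.
rewrite !model_distE -mulrDl; split=> [|-> //].
by apply: mulIf; rewrite invr_eq0 gt_eqF // sc_gt0.
Qed.

Lemma near_geodesic p q : near p q -> exists g, geodesic d p q g.
Proof.
move=> npq; have [->|pq] := pselect (p = q).
  exists (fun=> q); split=> // s t; rewrite !model_dist0 !in_itv /= -!eq_le.
  by move=> /eqP <- /eqP <-; rewrite subrr normr0.
have [u [Tu u1 Eq]] := nd_direction (ss_gt0 npq pq).
have [g Hg] := choice (fun t : R => ray_point (sc kappa * t) Tu u1).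
have s0 := sc_gt0 kappa.
have iso s t : s \in `[0, d p q] -> t \in `[0, d p q] -> d (g s) (g t) = `|s - t|.
  rewrite !in_itv /= => /andP[s1 s2] /andP[t1 t2].
  apply: (mulfI (lt0r_neq0 s0)).
  rewrite -/(nd (g s) (g t)) (ray_dist Tu u1 (Hg s) (Hg t)).
    by rewrite -mulrBr normrM gtr0_norm.
  rewrite -mulrBr normrM gtr0_norm //; split; first by rewrite mulr_ge0 // ltW.
  move=> k0; have := ltW (npq k0); apply: le_trans.
  by rewrite /nd ler_pM2l // ler_norml; apply/andP; split; lra.
exists g; split=> //.
- by apply: lft_inj; rewrite Hg mulr0 cn0 sn0 scale1r scale0r addr0.
- by apply: lft_inj; rewrite Hg Eq.
Qed.

Lemma geodesic_dist p q g t : geodesic d p q g -> t \in `[0, d p q] ->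
  d p (g t) = t /\ d (g t) q = d p q - t.
Proof.
case=> <- g1 iso It.
have [I0 I1] : 0 \in `[0, d (g 0) q] /\ d (g 0) q \in `[0, d (g 0) q].
  by rewrite !in_itv /= !lexx model_dist_ge0.
have /andP[t0 t1] : 0 <= t <= d (g 0) q by move: It; rewrite in_itv.
rewrite iso // sub0r normrN ger0_norm //; split=> //.
by rewrite -[X in d (g t) X = _]g1 iso // distrC ger0_norm // subr_ge0.
Qed.

End model_metric.

(** * Convex hulls as slices of convex cones *)

Section cone_hull.
Context {R : realType} {kappa : R} {m k : nat} (v : 'I_k.+1 -> model kappa m).
Local Notation M := (model kappa m).
Local Notation V := 'rV[R]_m.+1.
Local Notation d := (@model_dist R kappa m).
Local Notation A := (AA kappa).
Local Notation B := (BB kappa).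
Implicit Types (p q r : M) (t s : 'I_k.+1 -> R) (D : {set 'I_k.+1}).

(** An open half-space containing the lifted vertices; it keeps antipodal pairs out of the cone they
    span. *)
Variable c : V.
Hypothesis c_pos : forall i, 0 < A c (lft (v i)).

Definition comb t : V := \sum_i t i *: lft (v i).

Definition hull_of D : set M := [set p | exists t, [/\ forall i, 0 <= t i,
  forall i, i \notin D -> t i = 0 & lft p = comb t]].

Lemma combD t s : comb (fun i => t i + s i) = comb t + comb s.
Proof. by rewrite -big_split; apply: eq_bigr => i _; rewrite scalerDl. Qed.

Lemma combZ a t : comb (fun i => a * t i) = a *: comb t.
Proof. by rewrite scaler_sumr; apply: eq_bigr => i _; rewrite scalerA. Qed.

Lemma comb_delta i : comb (fun j => (j == i)%:R) = lft (v i).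
Proof.
rewrite /comb (bigD1 i) //= eqxx scale1r big1 ?addr0 // => j ji.
by rewrite (negbTE ji) scale0r.
Qed.

Lemma lft_neq0 p : lft p != 0.
Proof.
apply/eqP => E; have [] := lft_inM p; rewrite E -(scale0r (0 : V)) AAZl mul0r => /eqP.
by rewrite eq_sym oner_eq0.
Qed.

Lemma comb_pos t i : (forall i, 0 <= t i) -> 0 < t i -> 0 < A c (comb t).
Proof.
move=> t0 ti; rewrite /comb AA_sumr (bigD1 i) //= ltr_wpDr ?mulr_gt0 //.
by apply: sumr_ge0 => j _; rewrite mulr_ge0 // ltW.
Qed.

Lemma hull_coef_gt0 p t : (forall i, 0 <= t i) -> lft p = comb t -> exists i, 0 < t i.
Proof.
move=> t0 E; apply: contrapT => no; have := lft_neq0 p.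
rewrite E /comb big1 ?eqxx // => i _.
rewrite (_ : t i = 0) ?scale0r //; apply/eqP; rewrite eq_le t0 andbT leNgt.
by apply/negP => ti; apply: no; exists i.
Qed.

Lemma hull_pos D p : hull_of D p -> 0 < A c (lft p).
Proof.
move=> [t [t0 _ E]]; have [i ti] := hull_coef_gt0 t0 E.
by rewrite E; exact: comb_pos ti.
Qed.

Lemma pos_near p q : 0 < A c (lft p) -> 0 < A c (lft q) -> near p q.
Proof.
move=> cp cq k0; case: (nd_range p q) => _ /(_ k0).
rewrite le_eqVlt => /orP[/eqP E|//].
have AE : A (lft p) (lft q) = -1 by rewrite AA_nd E /cn k0 cospi.
have : A (lft p + lft q) (lft p + lft q) = 0.
  rewrite !AAE (AAC _ (lft q) (lft p)) AE.
  by case: (lft_inM p) => -> _; case: (lft_inM q) => -> _; lra.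
rewrite /AA gtr0_sg // mul1r -dot_recl => /dot_eq0 E2.
have : A c (lft p + lft q) = 0 by rewrite E2 -(scale0r (0 : V)) AAZr mul0r.
by rewrite AADr; lra.
Qed.

Lemma hull_near D D' p q : hull_of D p -> hull_of D' q -> near p q.
Proof. by move=> /hull_pos ? /hull_pos; exact: pos_near. Qed.

(** In positive curvature [AA] is the dot product and the half-space makes the combination nonzero.
    Otherwise [AA] is positive on any two points of the model. *)
Lemma comb_AA_gt0 t i : (forall i, 0 <= t i) -> 0 < t i -> 0 < A (comb t) (comb t).
Proof.
move=> t0 ti; case: (boolP (0 < kappa)) => k0.
  have /negP c0 : ~ comb t == 0.
    move=> /eqP E; have := comb_pos t0 ti.
    by rewrite E -(scale0r (0 : V)) AAZr mul0r ltxx.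
  rewrite /AA gtr0_sg // mul1r -dot_recl lt_def dot_ge0 andbT.
  by apply: contra c0 => /eqP /dot_eq0 ->.
have Av j : 0 < A (lft (v j)) (comb t).
  rewrite /comb AA_sumr (bigD1 i) //= ltr_wpDr ?mulr_gt0 // ?AA_nd ?cn_gt0 //.
  by apply: sumr_ge0 => l _; rewrite mulr_ge0 // AA_nd ltW // cn_gt0.
rewrite {2}/comb AA_sumr (bigD1 i) //= ltr_wpDr ?mulr_gt0 // 1?AAC //.
by apply: sumr_ge0 => j _; rewrite mulr_ge0 // AAC ltW.
Qed.

Lemma normalize t i : (forall i, 0 <= t i) -> 0 < t i ->
  exists2 p, hull_of (finset.setTfor _) p & lft p = (Num.sqrt (A (comb t) (comb t)))^-1 *: comb t.
Proof.
move=> t0 ti; have A0 := comb_AA_gt0 t0 ti.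
set rho := (Num.sqrt _)^-1.
have r0 : 0 < rho by rewrite invr_gt0 sqrtr_gt0.
have [p Ep] : exists p : M, lft p = rho *: comb t.
  apply: inM_lft; split.
    rewrite AAZl AAZr -[X in rho * (rho * X)](sqr_sqrtr (ltW A0)) /rho; field.
    by rewrite gt_eqF // sqrtr_gt0.
  move=> k0; rewrite mxE mulr_gt0 // /comb summxE (bigD1 i) //= mxE.
  have v0 j : 0 < lft (v j) 0 0 by case: (lft_inM (v j)) => _; apply.
  rewrite ltr_wpDr ?mulr_gt0 //; apply: sumr_ge0 => j _.
  by rewrite mxE mulr_ge0 // ltW.
exists p => //; exists (fun i => rho * t i); split=> //.
- by move=> j; rewrite mulr_ge0 // ltW.
- by move=> j; rewrite inE.
- by rewrite combZ.
Qed.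

Lemma hull_between D p q r : hull_of D p -> hull_of D q -> d p r + d r q = d p q ->
  hull_of D r.
Proof.
move=> Dp Dq /model_dist_nd_sum E.
have npq := hull_near Dp Dq; have [pq|pq] := pselect (p = q).
  subst q; suff <- : p = r by [].
  by apply: nd_eq0; move: E (nd_ge0 p r); rewrite nd0 (ndC r p); lra.
have s0 := ss_gt0 npq pq.
case: Dp => t [t0 tD Et]; case: Dq => s [s0' sD Es].
have Er := between_lft npq pq E.
have I (a b : R) : 0 <= a -> a <= b -> in_range kappa b -> in_range kappa a.
  by move=> a0 ab [_ H]; split=> // /H; exact: le_trans.
have Ipq := nd_range p q; have p0 := nd_ge0 p r; have q0 := nd_ge0 r q.
set a := _ / _ in Er; set b := _ / _ in Er.
have a0 : 0 <= a by rewrite divr_ge0 ?(ltW s0) // sn_ge0 //; apply: I Ipq => //; lra.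
have b0 : 0 <= b by rewrite divr_ge0 ?(ltW s0) // sn_ge0 //; apply: I Ipq => //; lra.
exists (fun i => a * t i + b * s i); split.
- by move=> i; rewrite addr_ge0 // mulr_ge0.
- by move=> i iD; rewrite tD // sD // !mulr0 addr0.
- by rewrite combD !combZ -Et -Es.
Qed.

Lemma hull_convex D : geodesically_convex d (hull_of D).
Proof.
move=> p q Dp Dq; split; first exact/near_geodesic/(hull_near Dp Dq).
move=> g geo t It; apply: (hull_between Dp Dq).
by have [-> ->] := geodesic_dist geo It; rewrite addrC subrK.
Qed.

Lemma vertex_hull D i : i \in D -> hull_of D (v i).
Proof.
move=> iD; exists (fun j => (j == i)%:R); split=> //; last by rewrite comb_delta.
by move=> j; case: (eqVneq j i) => // ->; rewrite iD.
Qed.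

Lemma convex_hull_sub D : convex_hull d [set v i | i in [set` D]] `<=` hull_of D.
Proof.
move=> p; apply; split; first exact: hull_convex.
by move=> _ [i iD <-]; exact: vertex_hull.
Qed.

(** Induction on the number of nonzero coefficients: after splitting off a vertex, [p] lies between
    this vertex and the normalised remainder. *)
Lemma hull_sub_convex D : hull_of D `<=` convex_hull d [set v i | i in [set` D]].
Proof.
move=> p [t [t0 tD Et]] C [convC vC].
have [N leN] := ubnP #|[pred i | t i != 0]|.
elim: N => [//|N IH] in p t t0 tD Et leN *.
have [i ti] := hull_coef_gt0 t0 Et.
have iD : i \in D by apply/negPn/negP => /tD E; rewrite E ltxx in ti.
have Cvi : C (v i) by apply: vC; exists i.
pose t' j := if j == i then 0 else t j.
have t'0 j : 0 <= t' j by rewrite /t'; case: ifP.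
have Ett' : comb t = t i *: lft (v i) + comb t'.
  rewrite /comb (bigD1 i) //= [X in _ = _ + X](bigD1 i) //= /t' eqxx scale0r add0r.
  by congr (_ + _); apply: eq_bigr => j /negbTE ->.
have [[j t'j]|no] := pselect (exists j, 0 < t' j); last first.
  have E : lft p = t i *: lft (v i).
    rewrite Et Ett' [X in _ + X]big1 ?addr0 // => j _.
    rewrite (_ : t' j = 0) ?scale0r //; apply/eqP; rewrite eq_le t'0 andbT leNgt.
    by apply/negP => tj; apply: no; exists j.
  suff -> : p = v i by [].
  apply: lft_inj; rewrite E; have [+ _] := lft_inM p; rewrite E AAZl AAZr.
  case: (lft_inM (v i)) => -> _ /eqP; rewrite mulr1 -expr2 sqrf_eq1.
  by move=> /orP[/eqP ->|/eqP E1]; [rewrite scale1r | by move: ti; rewrite E1 oppr_gt0 ltr10].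
have [r _ Er] := normalize t'0 t'j.
have A0 := comb_AA_gt0 t'0 t'j.
have sq0 : 0 < Num.sqrt (A (comb t') (comb t')) by rewrite sqrtr_gt0.
have Dr : lft r = comb (fun i => (Num.sqrt (A (comb t') (comb t')))^-1 * t' i).
  by rewrite combZ.
have Cr : C r.
  apply: (IH r _ _ _ Dr).
  - by move=> l; rewrite mulr_ge0 // invr_ge0 ltW.
  - by move=> l lD; rewrite /t' tD // if_same mulr0.
  - rewrite -ltnS; apply: leq_trans leN; rewrite ltnS; apply: proper_card.
    apply/properP; split.
      apply/fintype.subsetP => l; rewrite !inE /=; apply: contra => /eqP tl.
      by rewrite /t'; case: ifP; rewrite ?tl mulr0.
    by exists i; rewrite !inE /=; [rewrite gt_eqF | rewrite /t' eqxx mulr0 eqxx].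
have nvr : near (v i) r.
  apply: pos_near => //; rewrite Er AAZr mulr_gt0 ?invr_gt0 //; exact: comb_pos t'j.
have E : nd (v i) p + nd p r = nd (v i) r.
  apply: (@combination_between _ _ _ _ _ _ (t i) (Num.sqrt (A (comb t') (comb t')))) => //.
  by rewrite Er scalerA divff ?gt_eqF // scale1r -Ett'.
have [g geo] := near_geodesic nvr.
have [_ Cg] := convC _ _ Cvi Cr.
have Ed : d (v i) p + d p r = d (v i) r by apply/model_dist_nd_sum.
have It : d (v i) p \in `[0, d (v i) r].
  by rewrite in_itv /= model_dist_ge0 -Ed lerDl model_dist_ge0.
have [g1 g2] := geodesic_dist geo It.
rewrite (_ : p = g (d (v i) p)); first exact: (Cg g geo _ It).
apply: (between_unique nvr E); last by rewrite /nd g1.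
by apply/model_dist_nd_sum; rewrite g1 g2 addrC subrK.
Qed.

Lemma convex_hullE D : convex_hull d [set v i | i in [set` D]] = hull_of D.
Proof. by apply/seteqP; split; [exact: convex_hull_sub | exact: hull_sub_convex]. Qed.

Hypothesis v_free : forall t, comb t = 0 -> forall i, t i = 0.

Lemma comb_inj t s : comb t = comb s -> t =1 s.
Proof.
move=> E i; apply/eqP; rewrite -subr_eq0; apply/eqP.
apply: (v_free (t := fun i => t i - s i)).
rewrite -(subrr (comb s)) -{1}E -scaleN1r -combZ -combD.
by apply: eq_bigr => j _; rewrite mulN1r.
Qed.

Lemma pos_collinear p q a : 0 < A c (lft p) -> 0 < A c (lft q) -> lft q = a *: lft p -> p = q.
Proof.
move=> cp cq E; apply: lft_inj; rewrite E.
have a0 : 0 < a by move: cq; rewrite E AAZr pmulr_lgt0.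
have [+ _] := lft_inM q; rewrite E AAZl AAZr.
case: (lft_inM p) => -> _ /eqP; rewrite mulr1 -expr2 sqrf_eq1.
by move=> /orP[/eqP ->|/eqP E1]; [rewrite scale1r | by move: a0; rewrite E1 oppr_gt0 ltr10].
Qed.

(** Prolonging the segment from [v i] through [p] shows that the [i]-th coefficient of [p] is
    positive. Conversely, positive coefficients leave room for a small step beyond [p], away from
    any [q]. *)
Lemma extendable_coef p : extendable d (hull_of (finset.setTfor _)) p <->
  exists2 t, (forall i, 0 < t i) & lft p = comb t.
Proof.
split=> [[Hp ext]|[t t0 Et]].
  have [t [t0 _ Et]] := Hp; exists t => // i.
  rewrite lt_def t0 andbT; apply/eqP => ti.
  have Hv : hull_of (finset.setTfor _) (v i) by apply: vertex_hull; rewrite inE.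
  have vp : v i <> p.
    move=> E; have := comb_inj (t := t) (s := fun j => (j == i)%:R).
    rewrite comb_delta E -Et => /(_ erefl i); rewrite ti eqxx => /eqP.
    by rewrite eq_sym oner_eq0.
  have [z [Hz zp /model_dist_nd_sum E]] := ext _ Hv vp.
  have nvz := hull_near Hv Hz.
  have vz : v i <> z.
    move=> vz; move: E; rewrite -vz nd0 (ndC p) => E; apply: vp.
    by apply: nd_eq0; move: (nd_ge0 (v i) p); lra.
  have := between_lft nvz vz E; have [s [_ _ Es]] := Hz.
  set a := _ / _; set b := _ / _ => Ep.
  have a0 : 0 < a.
    by rewrite divr_gt0 // ss_gt0 //; [exact: hull_near Hp Hz | exact: nesym].
  have b0 : 0 <= b.
    rewrite divr_ge0 ?sn_ge0 ?(ltW (ss_gt0 nvz vz)) //; exact: nd_range.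
  have := comb_inj (t := t) (s := fun j => a * (j == i)%:R + b * s j).
  rewrite combD !combZ comb_delta -Et -Es => /(_ Ep i); rewrite ti eqxx mulr1 => E0.
  case: Hz => s' [s'0 _ Es'].
  have ss' := comb_inj (etrans (esym Es) Es').
  have : 0 <= b * s i by rewrite ss' mulr_ge0.
  by lra.
have Hp : hull_of (finset.setTfor _) p.
  by exists t; split=> // i; [exact: ltW | rewrite inE].
split=> // q Hq qp; have [s [s0 _ Es]] := Hq.
(* Small enough for [e * s i <= t i], so that [t + e (t - s)] has nonnegative coefficients. *)
pose e := (1 + \sum_i s i / t i)^-1.
have sum0 : 0 <= \sum_i s i / t i.
  by apply: sumr_ge0 => i _; rewrite divr_ge0 // ltW.
have e0 : 0 < e by rewrite invr_gt0; lra.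
have es i : e * s i <= t i.
  rewrite /e mulrC ler_pdivrMr; last by lra.
  rewrite mulrC -ler_pdivrMr // (bigD1 i) //=.
  suff : 0 <= \sum_(j | j != i) s j / t j by lra.
  by apply: sumr_ge0 => j _; rewrite divr_ge0 // ltW.
pose w i := t i + e * (t i - s i).
have w0 i : 0 <= w i by rewrite /w; have := es i; have := t0 i; nra.
have Ew : comb w = lft p + e *: (lft p - lft q).
  rewrite /w combD combZ -Et; congr (_ + _ *: _).
  rewrite Et Es -scaleN1r -combZ -combD.
  by apply: eq_bigr => j _; rewrite mulN1r.
have [i wi] : exists i, 0 < w i.
  apply: contrapT => no.
  have E0 : comb w = 0.
    rewrite /comb big1 // => i _; rewrite (_ : w i = 0) ?scale0r //.
    by apply/eqP; rewrite eq_le w0 andbT leNgt; apply/negP => wi; apply: no; exists i.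
  apply: qp; apply/esym.
  apply: (pos_collinear (a := (1 + e) / e)); [exact: hull_pos Hp | exact: hull_pos Hq|].
  have /eqP := E0; rewrite Ew scalerBr addrA subr_eq0 -{1}[lft p]scale1r -scalerDl => /eqP E.
  by rewrite mulrC -scalerA E scalerA mulVf ?scale1r // gt_eqF.
have [z Hz Ez] := normalize w0 wi.
have A0 := comb_AA_gt0 w0 wi.
have sq0 : 0 < Num.sqrt (A (comb w) (comb w)) by rewrite sqrtr_gt0.
set rho := Num.sqrt _ in Ez sq0.
have Ez' : rho *: lft z = lft p + e *: (lft p - lft q).
  by rewrite Ez scalerA divff ?gt_eqF // scale1r.
exists z; split=> //.
- move=> zp; apply: qp; apply/esym.
  apply: (pos_collinear (a := (1 + e - rho) / e)); [exact: hull_pos Hp | exact: hull_pos Hq|].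
  rewrite mulrC -scalerA.
  have -> : (1 + e - rho) *: lft p = e *: lft q.
    rewrite scalerBl -{2}zp Ez'; apply/rowP => j; rewrite !mxE; ring.
  by rewrite scalerA mulVf ?scale1r // gt_eqF.
- apply/model_dist_nd_sum.
  (* The coefficients come from [Ez'] solved for [lft p]. *)
  apply: (@combination_between _ _ _ _ _ _ (e / (1 + e)) (rho / (1 + e))).
  + exact: hull_near Hq Hz.
  + by rewrite divr_ge0 //; lra.
  + by rewrite divr_ge0 //; lra.
  + rewrite -!(mulrC (1 + e)^-1) -!scalerA Ez' -scalerDr.
    apply: (scalerI (_ : 1 + e != 0)); first by rewrite gt_eqF //; lra.
    rewrite scalerA divff ?scale1r; last by rewrite gt_eqF //; lra.
    by apply/rowP => j; rewrite !mxE; ring.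
Qed.

End cone_hull.

Lemma derive_pos {R : realType} (f : R -> R) (l : R) : is_derive (0 : R) (1 : R) f l ->
  f 0 = 0 -> 0 < l -> exists2 e, 0 < e & forall t, 0 < t < e -> 0 < f t.
Proof.
move=> [fd fl] f0 l0.
have : (fun h : R => h^-1 *: (f (h *: 1 + 0) - f 0)) @ 0^' --> l.
  by rewrite -fl; exact: fd.
move=> /cvgrPdist_lt /(_ l l0); rewrite near_withinE => /nbhs_ballP [e /= e0 He].
exists e => // t /andP[t0 te].
have := He t; rewrite -ball_normE /= sub0r normrN gtr0_norm // => /(_ te).
rewrite gt_eqF // f0 subr0 addr0 /GRing.scale /= mulr1 => /(_ isT).
rewrite ltr_distlC => /andP[+ _]; rewrite subrr.
by rewrite pmulr_rgt0 // invr_gt0.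
Qed.

Section chord_derivative.
Context {R : realType} (kappa : R).

Lemma is_derive_sn (t : R) : is_derive t 1 (sn kappa) (cn kappa t).
Proof.
rewrite /sn /cn; case: (ltrgtP kappa 0) => _ /=.
- by apply: is_derive_eq; rewrite /GRing.scale /=; lra.
- by apply: is_derive_eq; rewrite /GRing.scale /=; lra.
- by apply: is_derive_eq; rewrite /GRing.scale /=; lra.
Qed.

(** By the law of cosines the left side is the squared distance chord from a point at distance [a]
    to one at distance [t], when the directions have cosine [g]. Both sides agree at [t = 0], and
    there the derivative of their difference is [2 * sn kappa a * e > 0]. *)
Lemma chord2_first_variation (a g e : R) : 0 < sn kappa a -> 0 < e ->
  exists2 d, 0 < d & forall t, 0 < t < d ->
    chord2 kappa (a + t) - 2 * sn kappa a * sn kappa t * (1 + g) <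
    chord2 kappa (a + t * (e - g)).
Proof.
move=> sa e0.
have h1 := is_derive_chord2 kappa; have h2 := is_derive_sn.
pose F := fun t : R => chord2 kappa (a + (e - g) * t) - chord2 kappa (a + 1 * t) +
  (2 * sn kappa a * (1 + g)) * sn kappa t.
have lin (b : R) : is_derive (0 : R) 1 (fun t : R => chord2 kappa (a + b * t)) (2 * sn kappa a * b).
  have D : is_derive (0 : R) (1 : R) (fun t : R => a + b * t) b.
    by apply: is_derive_eq; rewrite /GRing.scale /=; lra.
  have D2 : is_derive (a + b * 0) (1 : R) (chord2 kappa) (2 * sn kappa a).
    by have := h1 (a + b * 0); rewrite mulr0 addr0.
  have := @is_derive1_comp R (chord2 kappa) (fun t : R => a + b * t) 0 _ _ D2 D.
  by [].
have DF : is_derive (0 : R) 1 F (2 * sn kappa a * e).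
  have := lin (e - g); have := lin 1; have := h2 0 => d1 d2 d3.
  apply: is_derive_eq; rewrite /GRing.scale /= cn0; ring.
have F0 : F 0 = 0 by rewrite /F !mulr0 sn0 mulr0 addr0 subrr.
have [|d d0 Hd] := derive_pos DF F0; first by rewrite !mulr_gt0.
exists d => // t /Hd; rewrite /F mul1r (mulrC (e - g)) => H.
move: (chord2 kappa (a + t * (e - g))) (chord2 kappa (a + t)) (sn kappa a) (sn kappa t) H.
by move=> x y z w; lra.
Qed.

End chord_derivative.

(** * Compactness and interior of a cone hull *)

Section cone_hull_topology.
Context {R : realType} {kappa : R} {m k : nat} (v : 'I_k.+1 -> model kappa m).
Local Notation M := (model kappa m).
Local Notation V := 'rV[R]_m.+1.
Local Notation d := (@model_dist R kappa m).
Local Notation A := (AA kappa).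
Local Notation B := (BB kappa).
Implicit Types (p q r : M) (t s : 'I_k.+1 -> R) (D : {set 'I_k.+1}).
Variable c : V.
Hypothesis c_pos : forall i, 0 < A c (lft (v i)).
Local Notation comb := (comb v).
Local Notation hull_of := (hull_of v).

Lemma cvg_comb (x : nat -> 'I_k.+1 -> R) s (F : V -> R) :
  (forall (t : 'I_k.+1 -> R), F (comb t) = \sum_i t i * F (lft (v i))) ->
  (forall i, (fun n => x n i) @ \oo --> s i) -> (fun n => F (comb (x n))) @ \oo --> F (comb s).
Proof.
move=> HF xs; rewrite HF.
rewrite (_ : (fun n => _) = (fun n => \sum_i x n i * F (lft (v i)))); last first.
  by apply/funext => n; rewrite HF.
apply: cvg_big => [|i _]; first exact: add_continuous.
by apply: cvgMl; exact: xs.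
Qed.

Lemma cvg_comb2 (x : nat -> 'I_k.+1 -> R) s (F : V -> V -> R) :
  (forall t y, F (comb t) y = \sum_i t i * F (lft (v i)) y) ->
  (forall t y, F y (comb t) = \sum_i t i * F y (lft (v i))) ->
  (forall i, (fun n => x n i) @ \oo --> s i) ->
  (fun n => F (comb (x n)) (comb (x n))) @ \oo --> F (comb s) (comb s).
Proof.
move=> F1 F2 xs; rewrite F1.
rewrite (_ : (fun n => _) = (fun n => \sum_i x n i * F (lft (v i)) (comb (x n)))); last first.
  by apply/funext => n; rewrite F1.
apply: cvg_big => [|i _]; first exact: add_continuous.
by apply: cvgM; [exact: xs | apply: cvg_comb => // t; exact: F2].
Qed.

(** Coefficients rescaled to sum 1 have a convergent subsequence, and normalising back to the model
    is continuous; [chord2] converts convergence of lifts into convergence of distances. *)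
Lemma hull_seq_compact D : seq_compact d (hull_of D).
Proof.
move=> u Hu; have [t Ht] := choice Hu.
pose T n := \sum_i t n i.
have T0 n : 0 < T n.
  case: (Ht n) => t0 _ E; have [i ti] := hull_coef_gt0 t0 E.
  by rewrite /T (bigD1 i) //= ltr_wpDr // sumr_ge0.
pose x n i := t n i / T n.
have x0 n i : 0 <= x n i by rewrite divr_ge0 ?(ltW (T0 n)) //; case: (Ht n).
have x1 n : \sum_i x n i = 1 by rewrite -mulr_suml -/(T n) divff // gt_eqF.
have x_le1 n i : x n i <= 1.
  by rewrite -(x1 n) (bigD1 i) //= lerDl sumr_ge0.
have [phi [w Hw]] := @bolzano_weierstrass R _ (fun n => \row_i x n i) 1
  (fun n i => ltac:(by rewrite mxE ger0_norm)).
pose s i := w 0 i.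
have xs i : (fun n => x (phi n) i) @ \oo --> s i.
  apply/cvgrPdist_lt => e e0; have [N HN] := invSn_lt e0.
  exists N => // n /= Nn; case: (Hw n) => _ /(_ i); rewrite mxE distrC => /lt_trans.
  by apply; exact: HN.
have s0 i : 0 <= s i.
  by apply: (cvgr_to_ge (xs i)); near=> n; exact: x0.
have s1 : \sum_i s i = 1.
  have cs : (fun n => \sum_i x (phi n) i) @ \oo --> \sum_i s i.
    by apply: cvg_big => [|i _]; [exact: add_continuous | exact: xs].
  apply/esym/(cvg_unique _ _ cs) => //.
  rewrite (_ : (fun n => _) = (fun=> 1)); last by apply/funext => n; rewrite x1.
  exact: cvg_cst.
have sD i : i \notin D -> s i = 0.
  move=> iD; apply/(cvg_unique _ (xs i)) => //.
  rewrite (_ : (fun n => _) = (fun=> 0)); first exact: cvg_cst.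
  by apply/funext => n; rewrite /x; case: (Ht (phi n)) => _ -> //; rewrite mul0r.
have [i si] : exists i, 0 < s i.
  apply: contrapT => no; have : \sum_i s i = 0.
    rewrite big1 // => i _; apply/eqP; rewrite eq_le s0 andbT leNgt.
    by apply/negP => si; apply: no; exists i.
  by rewrite s1 => /eqP; rewrite oner_eq0.
have [q _ Eq] := normalize c_pos s0 si.
have A0 := comb_AA_gt0 c_pos s0 si.
set rho := (Num.sqrt _)^-1 in Eq.
have rho0 : 0 <= rho by rewrite invr_ge0 sqrtr_ge0.
exists q.
  exists (fun i => rho * s i); split=> [j|j jD|]; first by rewrite mulr_ge0.
    by rewrite sD // mulr0.
  by rewrite combZ.
pose r n := (Num.sqrt (A (comb (x n)) (comb (x n))))^-1.
have Eu n : lft (u n) = r n *: comb (x n).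
  case: (Ht n) => t0 _ E; have xE : comb (x n) = (T n)^-1 *: lft (u n).
    by rewrite E -combZ; apply: eq_bigr => j _; rewrite mulrC.
  rewrite /r xE AAZl AAZr; case: (lft_inM (u n)) => -> _; rewrite mulr1 -expr2.
  rewrite sqrtr_sqr ger0_norm; last by rewrite invr_ge0 ltW.
  by rewrite scalerA invrK divff ?scale1r // gt_eqF.
have cr : (fun n => r (phi n)) @ \oo --> rho.
  apply: cvgV; first by rewrite gt_eqF // sqrtr_gt0.
  apply: continuous_cvg; first exact: sqrt_continuous.
  apply: (@cvg_comb2 (fun n => x (phi n)) s A) => // t' y; rewrite ?AA_sumr // AAC AA_sumr.
  by apply: eq_bigr => j _; rewrite AAC.
have cB : (fun n => B (lft (u (phi n)) - lft q) (lft (u (phi n)) - lft q)) @ \oo --> (0 : R).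
  have E n : B (lft (u (phi n)) - lft q) (lft (u (phi n)) - lft q) =
      r (phi n) * r (phi n) * B (comb (x (phi n))) (comb (x (phi n))) -
      2 * r (phi n) * B (lft q) (comb (x (phi n))) + B (lft q) (lft q).
    by rewrite Eu !BBE (BBC _ _ (lft q)); ring.
  rewrite (funext E).
  have E0 : 0 = rho * rho * B (comb s) (comb s) - 2 * rho * B (lft q) (comb s) + B (lft q) (lft q).
    by rewrite Eq !BBE; ring.
  rewrite [X in _ --> X]E0.
  apply: cvgD; last exact: cvg_cst.
  apply: cvgB; apply: cvgM.
  - exact: cvgM.
  - apply: (@cvg_comb2 (fun n => x (phi n)) s B) => // t' y; rewrite ?BB_sumr // BBC BB_sumr.
    by apply: eq_bigr => j _; rewrite BBC.
  - by apply: cvgMr.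
  - by apply: (@cvg_comb (fun n => x (phi n)) s (fun y => B (lft q) y)) => // t'; rewrite BB_sumr.
move=> e e0 N.
(* The bound 1 keeps [e'] in the range where [chord2] is increasing. *)
pose e' := Num.min (sc kappa * e) 1.
have e'0 : 0 < e' by rewrite lt_min ltr01 andbT mulr_gt0 // sc_gt0.
have Ie' : in_range kappa e'.
  split; first exact: ltW.
  by move=> _; apply: le_trans (_ : 1 <= pi); [rewrite ge_min lexx orbT | have := @pi_ge2 R; lra].
have ch0 : 0 < chord2 kappa e'.
  by rewrite -(chord2_0 kappa); apply: chord2_lt => //; case: Ie'.
have /cvgrPdist_lt /(_ _ ch0) [K _ HK] := cB.
exists (phi (maxn N K)); split.
  by apply: leq_trans (leq_maxl N K) _; case: (Hw (maxn N K)).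
have := HK (maxn N K) (leq_maxr _ _); rewrite /= sub0r normrN => H.
have : nd (u (phi (maxn N K))) q < e'.
  rewrite ltNge; apply/negP => le.
  have := ler_norm (B (lft (u (phi (maxn N K))) - lft q) (lft (u (phi (maxn N K))) - lft q)).
  rewrite -nd_chord => le2; move: H; rewrite -nd_chord => H.
  have : chord2 kappa e' <= chord2 kappa (nd (u (phi (maxn N K))) q).
    move: le; rewrite le_eqVlt => /orP[/eqP <- //|lt]; apply/ltW/chord2_lt => //.
      exact: ltW.
    by case: (nd_range (u (phi (maxn N K))) q).
  by rewrite leNgt (le_lt_trans le2 H).
rewrite lt_min /nd => /andP[+ _].
by rewrite ltr_pM2l // sc_gt0.
Unshelve. all: by end_near.
Qed.

Lemma seq_compact_dist_pos (X : set M) p : seq_compact d X -> ~ X p ->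
  exists2 e, 0 < e & forall q, X q -> e <= d p q.
Proof.
move=> cX Xp; apply: contrapT => no.
have H (n : nat) : exists q, X q /\ d p q < n.+1%:R^-1.
  apply: contrapT => no'; apply: no; exists n.+1%:R^-1; first exact: invSn_gt0.
  by move=> q Xq; rewrite leNgt; apply/negP => lt; apply: no'; exists q.
have [u Hu] := choice H.
have [q Xq cq] := cX u (fun n => proj1 (Hu n)).
suff E : p = q by apply: Xp; rewrite E.
apply: model_dist_eq0; apply/eqP; rewrite eq_le model_dist_ge0 andbT.
apply: ler_add_eps => e e0; rewrite add0r.
have e2 : 0 < e / 2 by rewrite divr_gt0.
have [N HN] := invSn_lt e2.
have [n [Nn un]] := cq (e / 2) e2 N.
move: (lt_trans (proj2 (Hu n)) (HN n Nn)) (model_dist_triangle (u n) p q).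
by move: un; lra.
Qed.

Hypothesis v_free : forall t, comb t = 0 -> forall i, t i = 0.

Lemma hull_coef_mem D t p i : lft p = comb t -> 0 < t i -> hull_of D p -> i \in D.
Proof.
move=> E ti [s [_ sD Es]]; apply/negPn/negP => /sD si.
by move: ti; rewrite (comb_inj v_free (etrans (esym E) Es)) si ltxx.
Qed.

(** A point of the hull that is not extendable lies on a facet [D i], and each facet is compact and
    misses [p]. *)
Lemma extendable_open p : extendable d (hull_of (finset.setTfor _)) p ->
  exists2 r : R, 0 < r & forall q, hull_of (finset.setTfor _) q -> d p q < r ->
    extendable d (hull_of (finset.setTfor _)) q.
Proof.
move=> /(extendable_coef c_pos v_free)[t t0 Et].
pose D i : {set 'I_k.+1} := finset.setC [set i].
have H i : exists r : R, 0 < r /\ forall q, hull_of (D i) q -> r <= d p q.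
  have [|r r0 Hr] := seq_compact_dist_pos (@hull_seq_compact (D i)) (_ : ~ hull_of (D i) p).
    by move=> /(hull_coef_mem Et (t0 i)); rewrite !inE eqxx.
  by exists r.
have [r Hr] := choice H.
have S0 : 0 <= \sum_i (r i)^-1.
  by apply: sumr_ge0 => i _; rewrite invr_ge0 ltW //; case: (Hr i).
(* A positive number below every [r i]. *)
exists (1 + \sum_i (r i)^-1)^-1; first by rewrite invr_gt0; lra.
move=> q [s [s0 _ Es]] pq; apply/(extendable_coef c_pos v_free).
exists s => // i; rewrite lt_def s0 andbT; apply/eqP => si.
have : hull_of (D i) q.
  by exists s; split=> // j; rewrite !inE negbK => /eqP ->.
have [r0 Hri] := Hr i => /Hri rd.
have : (r i)^-1 <= 1 + \sum_i (r i)^-1.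
  rewrite (bigD1 i) //=.
  suff : 0 <= \sum_(j | j != i) (r j)^-1 by lra.
  by apply: sumr_ge0 => j _; rewrite invr_ge0 ltW //; case: (Hr j).
rewrite -[X in _ <= X]invrK lef_pV2 ?posrE ?invr_gt0 //; last by lra.
by move=> /le_lt_trans /(_ (le_lt_trans rd pq)); rewrite ltxx.
Qed.

Lemma extendable_hull D p : extendable d (hull_of (finset.setTfor _)) p -> hull_of D p ->
  D = finset.setTfor _.
Proof.
move=> /(extendable_coef c_pos v_free)[t t0 Et] Dp.
by apply/setP => i; rewrite inE (hull_coef_mem Et (t0 i) Dp).
Qed.

Lemma extendable_exists : exists p, extendable d (hull_of (finset.setTfor _)) p.
Proof.
have t0 (i : 'I_k.+1) : 0 <= 1 :> R by [].
have [p _ Ep] := normalize c_pos (t := fun=> 1) t0 (ltr01 : 0 < (fun=> 1) (ord0 : 'I_k.+1) :> R).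
exists p; apply/(extendable_coef c_pos v_free).
exists (fun i => (Num.sqrt (A (comb (fun=> 1)) (comb (fun=> 1))))^-1 * 1); last first.
  by rewrite combZ.
move=> i; rewrite mulr1 invr_gt0 sqrtr_gt0.
exact: (comb_AA_gt0 c_pos t0 (i := ord0)).
Qed.

End cone_hull_topology.

(** * First variation of the distance in a model space *)

Section directions.
Context {R : realType} {kappa : R} {m : nat}.
Local Notation M := (model kappa m).
Local Notation V := 'rV[R]_m.+1.
Local Notation d := (@model_dist R kappa m).
Local Notation A := (AA kappa).
Local Notation B := (BB kappa).
Local Notation cs := (cn kappa).
Local Notation ss := (sn kappa).
Implicit Types (o p q r w z : M) (t : R).

Lemma ray_between o z w (u : V) t : A (lft o) u = 0 -> B u u = 1 ->
  lft z = cs (nd o z) *: lft o + ss (nd o z) *: u ->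
  lft w = cs (sc kappa * t) *: lft o + ss (sc kappa * t) *: u ->
  0 <= t <= d o z -> d o w = t /\ d o w + d w z = d o z.
Proof.
move=> Tu u1 Ez Ew /andP[t0 tz]; have s0 := sc_gt0 kappa.
have st0 : 0 <= sc kappa * t by rewrite mulr_ge0 // ltW.
have stz : sc kappa * t <= nd o z by rewrite ler_pM2l.
have Eo : lft o = cs 0 *: lft o + ss 0 *: u by rewrite cn0 sn0 scale1r scale0r addr0.
have Iz := nd_range o z; have [z0 zpi] := Iz.
have I a : 0 <= a <= nd o z -> in_range kappa a.
  by move=> /andP[a0 az]; split=> // k0; apply: le_trans az (zpi k0).
have ow : nd o w = sc kappa * t.
  rewrite (ray_dist Tu u1 Eo Ew) sub0r normrN ger0_norm //.
  by apply: I; rewrite st0 stz.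
have wz : nd w z = nd o z - sc kappa * t.
  have l0 : 0 <= nd o z - sc kappa * t by rewrite subr_ge0.
  rewrite (ray_dist Tu u1 Ew Ez) distrC ger0_norm //.
  by apply: I; rewrite l0 /=; lra.
split; first by apply: (mulfI (lt0r_neq0 s0)).
by apply/model_dist_nd_sum; rewrite ow wz addrC subrK.
Qed.

Lemma ray_first_variation o z' (u' u : V) (e : R) :
  near o z' -> o <> z' ->
  A (lft o) u' = 0 -> B u' u' = 1 -> A (lft o) u = 0 -> B u u = 1 ->
  lft z' = cs (nd o z') *: lft o + ss (nd o z') *: u' -> 0 < e ->
  exists2 D, 0 < D & forall t w, 0 < t < D ->
    lft w = cs (sc kappa * t) *: lft o + ss (sc kappa * t) *: u ->
    d z' w <= d z' o - t * B u' u + e * t.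
Proof.
move=> noz oz Tu' u'1 Tu u1 Ez e0; have s0 := sc_gt0 kappa.
have sa := ss_gt0 noz oz.
have a0 : 0 < nd o z' by rewrite lt_def nd_ge0 andbT; apply/eqP => /nd_eq0.
set g := B u' u.
have [D1 D10 HD1] := chord2_first_variation g sa e0.
pose c := `|e - g| + 1; have c0 : 0 < c by rewrite ltr_wpDl.
(* The margin between [nd o z'] and the ends of the range; it keeps the comparison value where
   [chord2] can be inverted. *)
pose b := if 0 < kappa then Num.min (nd o z') (pi - nd o z') else nd o z'.
have b0 : 0 < b.
  by rewrite /b; case: ifP => // k0; rewrite lt_min a0 subr_gt0 noz.
pose D := Num.min D1 (b / c) / sc kappa.
have D0 : 0 < D by rewrite divr_gt0 // lt_min D10 divr_gt0.
exists D => // t w /andP[t0 tD] Ew.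
pose tau := sc kappa * t.
have tau0 : 0 < tau by rewrite mulr_gt0.
have : tau < Num.min D1 (b / c) by rewrite /tau mulrC -ltr_pdivlMr.
rewrite lt_min => /andP[tau1 tau2].
have small : `|tau * (e - g)| < b.
  rewrite normrM gtr0_norm // (le_lt_trans (_ : _ <= tau * c)) //.
    by rewrite ler_pM2l // /c lerDl.
  by rewrite -ltr_pdivlMr.
have Ia : in_range kappa (nd o z' + tau * (e - g)).
  move: small; rewrite ltr_norml => /andP[h1 h2]; split.
    have : b <= nd o z' by rewrite /b; case: ifP => // _; rewrite ge_min lexx.
    by move: h1; lra.
  move=> k0; have : b <= pi - nd o z' by rewrite /b k0 ge_min lexx orbT.
  by move: h2; lra.
have H : chord2 kappa (nd z' w) < chord2 kappa (nd o z' + tau * (e - g)).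
  rewrite nd_chord Ez Ew (polar_chord _ _ (lft_inM o)) //.
  by apply: HD1; rewrite tau0 tau1.
have := chord2_le_inv (nd_range z' w) Ia (ltW H).
rewrite ndC (ndC o) /nd /tau => le.
rewrite -(ler_pM2l s0) model_distC; apply: le_trans le _.
rewrite le_eqVlt; apply/orP; left; apply/eqP; rewrite model_distC; ring.
Qed.

End directions.

(** * Faces, interior points and directions of a geodesic simplex *)

Section simplex_geometry.
Context {R : realType} {kappa : R} (S : geodesic_simplex kappa).
Local Notation M := (model kappa (amb S)).
Local Notation d := (@model_dist R kappa (amb S)).
Local Notation A := (AA kappa).
Local Notation B := (BB kappa).
Local Notation v := (vertex (g := S)).
Local Notation full := (finset.setTfor 'I_(sdim S).+1).
Implicit Types (o p q z : M).

Lemma model_diam_le : 0 < kappa -> (@model_diam R kappa <= (pi / sc kappa)%:E)%E.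
Proof.
move=> k0; apply: ge_ereal_sup => _ [[x y] _ <-]; rewrite lee_fin model_distE.
rewrite ler_pM2r ?invr_gt0 ?sc_gt0 //; case: (nd_range x y) => _; exact.
Qed.

(** In positive curvature the vertices lie in an open hemisphere, and its centre has positive cosine
    with them. Otherwise the first coordinate is positive on the whole model. *)
Lemma simplex_halfspace : exists c, forall i, 0 < A c (lft (v i)).
Proof.
have [k0|k0] := boolP (0 < kappa); last first.
  exists (delta_mx 0 0) => i; rewrite /AA (_ : tl _ = 0); last first.
    by apply/rowP => j; rewrite !mxE.
  rewrite dot0l mulr0 addr0 mxE !eqxx mul1r.
  by case: (lft_inM (v i)) => _; apply.
have [c Hc] := @vertex_ball _ _ S k0; exists (lft c) => i; rewrite AA_nd /cn k0.
have : ((model_dist c (v i))%:E < (2^-1)%:E * (pi / sc kappa)%:E)%E.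
  apply: lt_le_trans (Hc i) _; apply: lee_wpmul2l; last exact: model_diam_le.
  by rewrite lee_fin invr_ge0.
rewrite -EFinM lte_fin model_distE mulrA ltr_pM2r ?invr_gt0 ?sc_gt0 // => H.
apply: cos_gt0_pihalf; have := nd_ge0 c (v i); have := @pi_gt0 R.
by move=> h1 h2; apply/andP; split; lra.
Qed.

Lemma simplex_free t : comb v t = 0 -> forall i, t i = 0.
Proof. by move=> E; exact: (general_position_free (sdim_le S) (vertex_general (g := S)) E). Qed.

Lemma bodyE : body S = hull_of v full.
Proof.
have [c c_pos] := simplex_halfspace.
rewrite /body -(convex_hullE c_pos full); congr (convex_hull _ _).
by apply/seteqP; split=> _ [i _ <-]; exists i => //=; rewrite inE.
Qed.

Lemma face_fullE : face full = body S.
Proof. by have [c c_pos] := simplex_halfspace; rewrite bodyE /face (convex_hullE c_pos). Qed.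

Lemma faceE D : face D = hull_of v D.
Proof. by have [c c_pos] := simplex_halfspace; rewrite /face (convex_hullE c_pos). Qed.

Lemma body_seq_compact : seq_compact d (body S).
Proof. by have [c c_pos] := simplex_halfspace; rewrite bodyE; exact: (hull_seq_compact c_pos). Qed.

Lemma body_near p q : body S p -> body S q -> near p q.
Proof. by have [c c_pos] := simplex_halfspace; rewrite bodyE; exact: hull_near. Qed.

Lemma body_between p q z : body S p -> body S q -> d p z + d z q = d p q -> body S z.
Proof. by have [c c_pos] := simplex_halfspace; rewrite bodyE; exact: (hull_between c_pos). Qed.

Lemma body_geodesic p q t : body S p -> body S q -> 0 <= t <= d p q ->
  exists z, [/\ body S z, d p z = t & d z q = d p q - t].
Proof.
move=> Sp Sq It; have [g geo] := near_geodesic (body_near Sp Sq).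
have It' : t \in `[0, d p q] by rewrite in_itv.
have [g1 g2] := geodesic_dist geo It'.
by exists (g t); split=> //; apply: (body_between Sp Sq); rewrite g1 g2 addrC subrK.
Qed.

Lemma body_extendable_open p : extendable d (body S) p ->
  exists2 r, 0 < r & forall q, body S q -> d p q < r -> extendable d (body S) q.
Proof.
have [c c_pos] := simplex_halfspace; rewrite bodyE.
exact: (extendable_open c_pos simplex_free).
Qed.

Lemma body_extendable_exists : exists p, extendable d (body S) p.
Proof.
have [c c_pos] := simplex_halfspace; rewrite bodyE.
exact: (extendable_exists c_pos simplex_free).
Qed.

(** Ensures that a gluing which involves an interior point of a simplex involves the whole
    simplex. *)
Lemma extendable_face D p : extendable d (body S) p -> face D p -> D = full.
Proof.
have [c c_pos] := simplex_halfspace; rewrite bodyE faceE.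
exact: (extendable_hull c_pos simplex_free).
Qed.

(** [th z] is the initial direction from [o] to [z] in Euclidean coordinates of the tangent space;
    [W z t] and [W' z t] are the points at distance [t] from [o] in this direction and the opposite
    one. The latter stay in the simplex because the segment from [z] to [o] can be prolonged. *)
Lemma local_directions o : extendable d (body S) o ->
  exists (th : M -> 'rV[R]_(amb S).+1) (W W' : M -> R -> M),
  forall z, body S z -> z <> o -> [/\ dot (th z) (th z) = 1,
    exists2 t0, 0 < t0 & forall t, 0 < t < t0 ->
      [/\ body S (W z t), body S (W' z t), d o (W z t) = t, d o (W' z t) = t &
          d (W z t) (W' z t) = 2 * t] &
    forall z', body S z' -> z' <> o -> forall e, 0 < e -> exists2 D, 0 < D &
      forall t, 0 < t < D ->
        d z' (W z t) <= d z' o - t * dot (th z') (th z) + e * t /\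
        d z' (W' z t) <= d z' o + t * dot (th z') (th z) + e * t].
Proof.
move=> [So ext]; have s0 := sc_gt0 kappa; have Mo := lft_inM o.
have Hu z : exists u, body S z -> z <> o -> [/\ A (lft o) u = 0, B u u = 1 &
    lft z = cn kappa (nd o z) *: lft o + sn kappa (nd o z) *: u].
  have [[Sz zo]|no] := pselect (body S z /\ z <> o); last first.
    by exists 0 => Sz zo; case: no.
  have [u Hu] := nd_direction (ss_gt0 (body_near So Sz) (nesym zo)).
  by exists u.
have [u {}Hu] := choice Hu.
(* A single choice for both rays: the first component is the sign of the direction. *)
have HW (x : R * (M * R)) : exists w : M, body S x.2.1 -> x.2.1 <> o -> `|x.1| = 1 ->
    lft w = cn kappa (sc kappa * x.2.2) *: lft o +
            sn kappa (sc kappa * x.2.2) *: (x.1 *: u x.2.1).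
  case: x => a [z t] /=.
  have [[Sz zo]|no] := pselect (body S z /\ z <> o); last first.
    by exists o => Sz zo; case: no.
  have [a1|a1] := pselect (`|a| = 1); last by exists o.
  have [Tu u1 _] := Hu z Sz zo.
  have Tau : A (lft o) (a *: u z) = 0 by rewrite AAZr Tu mulr0.
  have au1 : B (a *: u z) (a *: u z) = 1.
    by rewrite BBZl BBZr u1 mulr1 -expr2 -real_normK ?num_real // a1 expr1n.
  by have [w Hw] := ray_point (sc kappa * t) Tau au1; exists w.
have [w {}HW] := choice HW.
have HW1 z t : body S z -> z <> o -> lft (w (1, (z, t))) =
    cn kappa (sc kappa * t) *: lft o + sn kappa (sc kappa * t) *: u z.
  by move=> Sz zo; rewrite (HW (1, (z, t))) //= ?scale1r // normr1.
have HW2 z t : body S z -> z <> o -> lft (w (-1, (z, t))) =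
    cn kappa (sc kappa * t) *: lft o + sn kappa (sc kappa * t) *: (- u z).
  by move=> Sz zo; rewrite (HW (-1, (z, t))) //= ?scaleN1r // normrN1.
exists (fun z => tangent_coord kappa (lft o) (u z)), (fun z t => w (1, (z, t))),
  (fun z t => w (-1, (z, t))) => z Sz zo.
have [Tu u1 Ez] := Hu z Sz zo.
have TNu : A (lft o) (- u z) = 0 by rewrite AANr Tu oppr0.
have Nu1 : B (- u z) (- u z) = 1 by rewrite BBNl BBNr opprK.
split; first by rewrite tangent_coord_dot.
  have [z' [Sz' z'o /model_dist_nd_sum E]] := ext z Sz zo.
  have [Tu' u'1 Ez'] := Hu z' Sz' z'o.
  have s1 := ss_gt0 (body_near So Sz) (nesym zo).
  have s2 := ss_gt0 (body_near So Sz') (nesym z'o).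
  have uN := opposite_directions Tu Tu' u1 u'1 s1 s2 Ez Ez' E.
  rewrite uN in Ez'.
  have d1 := model_dist_gt0 (nesym zo); have d2 := model_dist_gt0 (nesym z'o).
  exists (Num.min (d o z) (d o z')); first by rewrite lt_min d1.
  move=> t /andP[t0]; rewrite lt_min => /andP[tz tz'].
  have I1 : 0 <= t <= d o z by apply/andP; split; lra.
  have I2 : 0 <= t <= d o z' by apply/andP; split; lra.
  have [e1 b1] := ray_between Tu u1 Ez (HW1 z t Sz zo) I1.
  have [e2 b2] := ray_between TNu Nu1 Ez' (HW2 z t Sz zo) I2.
  split=> //; [exact: (body_between So Sz) | exact: (body_between So Sz') |].
  have E2 : lft (w (-1, (z, t))) = cn kappa (- (sc kappa * t)) *: lft o +
      sn kappa (- (sc kappa * t)) *: u z.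
    by rewrite HW2 // cnN snN scaleNr scalerN.
  apply: (mulfI (lt0r_neq0 s0)); rewrite -/(nd _ _).
  have st0 : 0 <= sc kappa * t by rewrite mulr_ge0 // ltW.
  rewrite (ray_dist Tu u1 (HW1 z t Sz zo) E2) opprK ger0_norm ?addr_ge0 //; first by ring.
  split; first exact: addr_ge0.
  (* [2 t] is at most the distance from [z] to [z'] through [o]. *)
  move=> k0; case: (nd_range z z') => _ /(_ k0); apply: le_trans.
  by rewrite -E (ndC z o) /nd lerD // ler_pM2l // ltW.
move=> z' Sz' z'o e e0; have [Tu' u'1 Ez'] := Hu z' Sz' z'o.
have noz' := body_near So Sz'.
have [D1 D10 H1] := ray_first_variation noz' (nesym z'o) Tu' u'1 Tu u1 Ez' e0.
have [D2 D20 H2] := ray_first_variation noz' (nesym z'o) Tu' u'1 TNu Nu1 Ez' e0.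
exists (Num.min D1 D2); first by rewrite lt_min D10.
move=> t /andP[t0]; rewrite lt_min => /andP[tD1 tD2].
rewrite tangent_coord_dot //; split.
  by apply: H1; rewrite ?t0 // HW1.
have := H2 t (w (-1, (z, t))); rewrite t0 tD2 BBNr => /(_ isT (HW2 z t Sz zo)).
by rewrite mulrN opprK.
Qed.

End simplex_geometry.

(** * Simplicial complexes *)

Local Open Scope quotient_scope.

(** If [p] stays at distance [e] from the image, its iterates are pairwise [e]-separated and cannot
    cluster. *)
Lemma compact_isometry_onto {R : realType} {kappa : R} {m : nat}
    (X : set (model kappa m)) (f : model kappa m -> model kappa m) :
  seq_compact (@model_dist _ _ _) X -> (forall p, X p -> X (f p)) ->
  isometry_on (@model_dist _ _ _) (@model_dist _ _ _) X f -> X `<=` f @` X.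
Proof.
move=> cX fX iso p Xp; apply: contrapT => no.
have cfX : seq_compact (@model_dist R kappa m) (f @` X).
  move=> u Hu; have [w Hw] := choice (fun k => let: ex_intro2 a b c := Hu k in
    ex_intro (fun q => X q /\ f q = u k) a (conj b c)).
  have [q Xq cq] := cX w (fun k => proj1 (Hw k)).
  exists (f q); first by exists q.
  move=> e e0 N; have [k [Nk lt]] := cq e e0 N; exists k; split=> //.
  by rewrite -(proj2 (Hw k)) iso //; exact: proj1 (Hw k).
have [e e0 He] := seq_compact_dist_pos cfX no.
pose x k := iter k f p.
have Xx k : X (x k) by elim: k => //= k; exact: fX.
have sep k j : e <= model_dist (x k) (x (k + j.+1)%N).
  elim: k => [|k IH]; last by rewrite addSn /= iso.
  by rewrite add0n /x /=; apply: He; exists (x j).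
have [q _ cq] := cX x Xx.
have e2 : 0 < e / 2 by rewrite divr_gt0.
have [k [_ k1]] := cq _ e2 0%N; have [j [kj k2]] := cq _ e2 k.+1.
have := sep k (j - k.+1)%N; rewrite addnS -addSn subnKC // => le.
have := model_dist_triangle q (x k) (x j); rewrite (model_distC q).
by move: k1 k2 le; lra.
Qed.

Lemma seq_compact_bounded {R : realType} {kappa : R} {m : nat} (X : set (model kappa m)) :
  seq_compact (@model_dist _ _ _) X ->
  exists2 C, 0 < C & forall p q, X p -> X q -> model_dist p q <= C.
Proof.
move=> cX; have [[p0 Xp0]|no] := pselect (X !=set0); last first.
  by exists 1 => // p q Xp; case: no; exists p.
suff [C C0 HC] : exists2 C, 0 < C & forall p, X p -> model_dist p0 p <= C.
  exists (C + C) => [|p q Xp Xq]; first exact: addr_gt0.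
  apply: le_trans (model_dist_triangle p0 p q) _.
  by rewrite lerD ?HC // model_distC HC.
apply: contrapT => no.
have H (k : nat) : exists p, X p /\ k.+1%:R < model_dist p0 p.
  apply: contrapT => no'; apply: no; exists k.+1%:R; first by rewrite ltr0Sn.
  by move=> p Xp; rewrite leNgt; apply/negP => lt; apply: no'; exists p.
have [u Hu] := choice H.
have [q Xq cq] := cX u (fun k => proj1 (Hu k)).
have q0 := model_dist_ge0 p0 q.
have [k [bk kq]] := cq 1 ltr01 (Num.bound (model_dist p0 q)).
have h1 := archi_boundP q0.
have h2 : (Num.bound (model_dist p0 q))%:R <= k%:R :> R by rewrite ler_nat.
have := proj2 (Hu k); rewrite -natr1 => h3.
have := model_dist_triangle q p0 (u k); rewrite (model_distC q).
by move: kq h1 h2 h3; lra.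
Qed.

Lemma finite_uniform {R : realType} (T : eqType) (F : set T) (P : T -> R -> Prop) :
  finite_set F ->
  (forall c, exists2 r, 0 < r & forall r', 0 < r' <= r -> P c r') ->
  exists2 r, 0 < r & forall c, F c -> P c r.
Proof.
move=> /finite_seqP [s ->] HP.
suff [r r0 Hr] : exists2 r, 0 < r & forall c, c \in s -> forall r', 0 < r' <= r -> P c r'.
  by exists r => // c cs; apply: (Hr c cs); rewrite r0 lexx.
elim: s => [|c s [r r0 Hr]]; first by exists 1.
have [r1 r10 H1] := HP c.
exists (Num.min r r1) => [|c']; first by rewrite lt_min r0.
rewrite inE => /orP[/eqP ->|c's] r' /andP[r'0]; rewrite le_min => /andP[l1 l2].
  by apply: H1; rewrite r'0.
by apply: (Hr c') => //; rewrite r'0.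
Qed.

Lemma finite_pigeonhole (T : eqType) (F : set T) (u : nat -> T) : finite_set F ->
  (forall k, F (u k)) -> exists i j, (i < j)%N /\ u i = u j.
Proof.
move=> /finite_seqP [s ->] us; apply: contrapT => no.
have inj : injective u.
  move=> i j E; case: (ltngtP i j) => // ij; exfalso; apply: no.
    by exists i, j.
  by exists j, i.
have := @uniq_leq_size _ (map u (iota 0 (size s).+1)) s.
rewrite map_inj_uniq // iota_uniq size_map size_iota ltnn => /(_ isT).
by move=> H; suff : false by []; apply: H => _ /mapP[k _ ->]; exact: us.
Qed.

(** * Cells, chains and balls inside maximal cells *)

Section complex_geometry.
Context {R : realType} {kappa : R} (K : simplicial_complex kappa) (mK : complex_metric K).
Local Notation L := (label K).
Local Notation cell := (cell (s := K)).
Local Notation X := (carrier K).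
Local Notation D := (@complex_dist R kappa K).
Local Notation M l := (model kappa (amb (cell l))).
Local Notation dd := (@model_dist R kappa _).
Local Notation bod l := (body (cell l)).

Let some_point l : set_type (bod l) :=
  let p := cid (@body_extendable_exists R kappa (cell l)) in
  exist _ (projT1 p) (mem_set (proj1 (projT2 p))).

(* The map [q_l] of the paper, extended arbitrarily outside the simplex. *)
Definition cell_map l (p : M l) : X :=
  if pselect (bod l p) is left H then quo (exist _ p (mem_set H)) else quo (some_point l).

Lemma cell_map_val l (x : set_type (bod l)) : cell_map (val x) = quo x.
Proof.
rewrite /cell_map; case: pselect => [H|]; last by case; exact: set_mem (valP x).
by congr quo; exact: val_inj.
Qed.

Lemma body_pt l p : bod l p -> exists x : set_type (bod l), val x = p.
Proof. by move=> H; exists (exist _ p (mem_set H)). Qed.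

Lemma val_body l (x : set_type (bod l)) : bod l (val x).
Proof. exact: set_mem (valP x). Qed.

Lemma cell_map_inj l p p' : bod l p -> bod l p' -> cell_map p = cell_map p' -> p = p'.
Proof.
move=> /body_pt [x <-] /body_pt [x' <-]; rewrite !cell_map_val => E.
by congr val; exact: (@glue_inj _ _ K l).
Qed.

Lemma cell_map_surj (x : X) : exists l (p : M l), bod l p /\ cell_map p = x.
Proof.
have [[l p] E] : exists u, \pi_{eq_quot (glue K)} u = x.
  by exists (repr x); rewrite reprK.
by exists l, (val p); split; [exact: val_body | rewrite cell_map_val].
Qed.

Definition img l : set X := (@cell_map l) @` bod l.

Lemma imgE l : img l = range (fun x : set_type (bod l) => \pi_{eq_quot (glue K)} (existT _ l x)).
Proof.
apply/seteqP; split=> [_ [p /body_pt[x <-] <-]|_ [x _ <-]].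
  by exists x => //; rewrite cell_map_val.
by exists (val x); [exact: val_body | rewrite cell_map_val].
Qed.

(** The gluing face of [l] contains the extendable point [p], so it is the whole simplex. *)
Lemma overlap l l' (p : M l) (p' : M l') : extendable dd (bod l) p -> bod l' p' -> cell_map p = cell_map p' ->
  exists h : M l -> M l', [/\ isometry_on dd dd (bod l) h,
    forall y, bod l y -> bod l' (h y) /\ cell_map (h y) = cell_map y &
    forall y y', bod l y -> bod l' y' -> cell_map y = cell_map y' -> y' = h y].
Proof.
move=> ep Bp' E; have Bp := proj1 ep.
have [|F [F' [h [_ _ iso onto Hh]]]] := @glue_face _ _ K l l'.
  by exists (cell_map p); split; rewrite -imgE; [exists p | rewrite E; exists p'].
have hQ y y' : bod l y -> bod l' y' -> (cell_map y = cell_map y' <-> face F y /\ y' = h y).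
  by move=> /body_pt[x <-] /body_pt[x' <-]; rewrite !cell_map_val; exact: Hh.
have [Fp _] := proj1 (hQ p p' Bp Bp') E.
have Ff := extendable_face ep Fp; rewrite Ff face_fullE in iso onto hQ.
have hB y : bod l y -> bod l' (h y).
  move=> By; have : face F' (h y) by rewrite -onto; exists y.
  rewrite faceE bodyE => -[t [t0 _ Et]]; exists t; split=> // i.
  by rewrite inE.
exists h; split=> // [y By|y y' By By' Eq].
  split; first exact: hB.
  by apply/esym/(hQ y (h y) By (hB y By)).
by have [_] := proj1 (hQ y y' By By') Eq.
Qed.

(** Several labels may have the same image, so maximality is a matter of images. *)
Definition maximal l := forall l', img l `<=` img l' -> img l' `<=` img l.

Lemma overlap_sub l l' (p : M l) : extendable dd (bod l) p -> img l' (cell_map p) -> img l `<=` img l'.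
Proof.
move=> ep [p' Bp' E]; have [h [_ hB _]] := overlap ep Bp' (esym E).
by move=> _ [y By <-]; exists (h y); [exact: (proj1 (hB y By)) | exact: (proj2 (hB y By))].
Qed.

Lemma complex_dist_metric : is_metric D. Proof. exact: (proj2 mK). Qed.
Lemma complex_dist0 x : D x x = 0. Proof. by case: complex_dist_metric. Qed.
Lemma complex_distC x y : D x y = D y x. Proof. by case: complex_dist_metric. Qed.
Lemma complex_dist_eq0 x y : D x y = 0 -> x = y. Proof. by case: complex_dist_metric => _ H _ _; exact: H. Qed.
Lemma complex_dist_triangle y x z : D x z <= D x y + D y z. Proof. by case: complex_dist_metric. Qed.
Lemma complex_dist_ge0 x y : 0 <= D x y.
Proof. by have := complex_dist_triangle y x x; rewrite complex_dist0 (complex_distC y x); lra. Qed.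

Lemma complex_dist_chain x y r : chain_length x y r -> D x y <= r.
Proof.
move=> H; rewrite -lee_fin /complex_dist fineK; last by case: mK.
by apply: ereal_inf_lbound; exists r.
Qed.

Lemma chain_exists x y e : 0 < e -> exists2 r, chain_length x y r & r < D x y + e.
Proof.
move=> e0; have fin : complex_edist x y \is a fin_num by case: mK.
have [_ [r Hr <-] lt] := lb_ereal_inf_adherent e0 fin.
exists r => //; rewrite -lte_fin; apply: lt_le_trans lt _.
by rewrite EFinD /complex_dist fineK.
Qed.

Lemma simplex_stepP x y r : simplex_step x y r <->
  exists l (p q : M l), [/\ bod l p, bod l q, cell_map p = x, cell_map q = y & r = dd p q].
Proof.
split=> [[l [u [w [<- <- ->]]]]|[l [p [q [/body_pt[u <-] /body_pt[w <-] <- <- ->]]]]].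
  by exists l, (val u), (val w); rewrite !cell_map_val; split=> //; exact: val_body.
by exists l, u, w; rewrite !cell_map_val.
Qed.

Lemma complex_dist_le_model l (p q : M l) : bod l p -> bod l q -> D (cell_map p) (cell_map q) <= dd p q.
Proof.
move=> Bp Bq; apply: complex_dist_chain; exists 1%N.
exists (fun i => if i is 0%N then cell_map p else cell_map q), (fun=> dd p q); split=> //.
  by move=> [|//] _; apply/simplex_stepP; exists l, p, q.
by rewrite big_ord1.
Qed.

(** Follow the chain to the step in which the length [s] is reached, and cut this step by a geodesic
    of its simplex. *)
Lemma chain_between m (c : nat -> X) (e : nat -> R) s :
  (forall i, (i < m)%N -> simplex_step (c i) (c i.+1) (e i)) ->
  0 <= s <= \sum_(i < m) e i ->
  exists z, D (c 0%N) z <= s /\ D z (c m) <= \sum_(i < m) e i - s.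
Proof.
elim: m s => [|m IH] s Hc.
  by rewrite big_ord0 => /andP[s0 s1]; exists (c 0%N); rewrite complex_dist0; split; lra.
rewrite big_ord_recr /=; set r := \sum_(i < m) e i => /andP[s0 sr].
have Hc' i : (i < m)%N -> simplex_step (c i) (c i.+1) (e i) by move=> im; apply: Hc; exact: ltnW.
have /simplex_stepP [l [p [q [Bp Bq Ep Eq Ee]]]] := Hc m (ltnSn m).
have De : D (c m) (c m.+1) <= e m by rewrite -Ep -Eq Ee complex_dist_le_model.
have r0 : 0 <= r.
  apply: sumr_ge0 => i _; have /simplex_stepP [l' [p' [q' [_ _ _ _ ->]]]] := Hc' i (ltn_ord i).
  exact: model_dist_ge0.
have [sr'|rs] := leP s r.
  have [z [z1 z2]] := IH s Hc' (introT andP (conj s0 sr')).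
  by exists z; split=> //; have := complex_dist_triangle (c m) z (c m.+1); rewrite -/r in z2; lra.
have [|z [z1 z2]] := IH r Hc'; first by rewrite r0 lexx.
have Is : 0 <= s - r <= dd p q by rewrite -Ee; apply/andP; split; lra.
have [w [Bw w1 w2]] := body_geodesic Bp Bq Is.
exists (cell_map w); split.
  have := complex_dist_triangle z (c 0%N) (cell_map w); have := complex_dist_triangle (c m) z (cell_map w).
  have := complex_dist_le_model Bp Bw; rewrite Ep w1; rewrite -/r in z2; have := complex_dist_ge0 z (c m); lra.
by rewrite -Eq; have := complex_dist_le_model Bw Bq; rewrite w2 -Ee; lra.
Qed.

Lemma approximate_between x y s e : 0 <= s <= D x y -> 0 < e ->
  exists z, D x z <= s /\ D z y <= D x y - s + e.
Proof.
move=> /andP[s0 sD] e0; have [r Hr rD] := chain_exists x y e0.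
have Dr := complex_dist_chain Hr.
case: Hr => m [c [w [c0 cm Hc Er]]].
have [|z [z1 z2]] := @chain_between m c w s Hc.
  by rewrite -Er s0 (le_trans sD).
by exists z; rewrite -c0 -cm; split=> //; rewrite -Er cm in z2; rewrite c0 cm; lra.
Qed.

(* Chains leaving a point of a maximal simplex stay in this simplex until they
   reach points which are not extendable. *)
Lemma maximal_ball l (x : M l) r : maximal l -> bod l x ->
  (forall y, bod l y -> dd x y < r -> extendable dd (bod l) y) ->
  forall y w, bod l y -> D (cell_map y) w < r - dd x y ->
  exists2 z, bod l z & cell_map z = w /\ D (cell_map y) w = dd y z.
Proof.
move=> ml Bx Hr y w By yw.
have main m (c : nat -> X) (e : nat -> R) : c 0%N = cell_map y ->
    (forall i, (i < m)%N -> simplex_step (c i) (c i.+1) (e i)) ->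
    \sum_(i < m) e i < r - dd x y ->
    exists2 z, bod l z & cell_map z = c m /\ dd y z <= \sum_(i < m) e i.
  move=> c0; elim: m => [|m IH] Hc.
    by exists y => //; rewrite big_ord0 model_dist0.
  rewrite big_ord_recr /=; set s := \sum_(i < m) e i => ser.
  have /simplex_stepP [l' [p [q [Bp Bq Ep Eq Ee]]]] := Hc m (ltnSn m).
  have e0 : 0 <= e m by rewrite Ee model_dist_ge0.
  have [||z Bz [Ez zs]] := IH.
  - by move=> i im; apply: Hc; exact: ltnW.
  - by rewrite -/s; lra.
  rewrite -/s in zs.
  have xz : dd x z < r by have := model_dist_triangle y x z; lra.
  have ez := Hr z Bz xz.
  have [h [iso hB hQ]] := overlap ez Bp (etrans Ez (esym Ep)).
  have sub : img l `<=` img l' by apply: overlap_sub ez _; rewrite Ez -Ep; exists p.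
  (* By maximality the cell of this step has the same image as [l], so the end of the step is again
     in [l]. *)
  have [z' Bz' Ez'] : img l (cell_map q) by apply: (ml _ sub); exists q.
  exists z'; rewrite // Ez' Eq; split=> //.
  have -> : e m = dd z z'.
    have e1 : p = h z by apply: hQ => //; rewrite Ez.
    have e2 : q = h z' by apply: hQ.
    by rewrite Ee e1 e2 iso.
  by have := model_dist_triangle z y z'; lra.
have small e : 0 < e -> exists2 z, bod l z & cell_map z = w /\ dd y z <= D (cell_map y) w + e.
  (* A chain that exceeds the distance by less than [e'] is still short enough for [main]. *)
  move=> e0; pose e' := Num.min e (r - dd x y - D (cell_map y) w).
  have e'0 : 0 < e' by rewrite lt_min e0 subr_gt0.
  have [s [m [c [f [c0 cm Hc Es]]]] sl] := chain_exists (cell_map y) w e'0.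
  have : e' <= e /\ e' <= r - dd x y - D (cell_map y) w by rewrite !ge_min !lexx orbT.
  move=> [l1 l2]; have [|z Bz [Ez zs]] := main m c f c0 Hc.
    by rewrite -Es; lra.
  by exists z => //; split; [rewrite Ez | rewrite -Es in zs; lra].
have [z Bz [Ez _]] := small 1 ltr01.
exists z => //; split=> //; apply/eqP; rewrite eq_le -{1}Ez complex_dist_le_model //=.
apply: ler_add_eps => e /small [z' Bz' [Ez' zs]].
by rewrite (cell_map_inj Bz Bz') // Ez Ez'.
Qed.

End complex_geometry.

(** * Maximal cells and uniform size from finitely many shapes *)

Section finite_shapes.
Context {R : realType} {kappa : R} (K : simplicial_complex kappa) (mK : complex_metric K).
Hypothesis shapesK : finite_set (Shapes K).
Local Notation L := (label K).
Local Notation cell := (cell (s := K)).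
Local Notation X := (carrier K).
Local Notation D := (@complex_dist R kappa K).
Local Notation M l := (model kappa (amb (cell l))).
Local Notation dd := (@model_dist R kappa _).
Local Notation bod l := (body (cell l)).

Lemma card_full_gt0 l : (0 < #|finset.setTfor 'I_(sdim (cell l)).+1|)%N.
Proof. by rewrite cardsT card_ord. Qed.

(** A cell as a face of itself, which gives access to its class in [Shapes]. *)
Definition whole l : nonempty_face K :=
  existT _ l (exist _ (finset.setTfor 'I_(sdim (cell l)).+1) (card_full_gt0 l)).

Definition shape l : set (nonempty_face K) :=
  [set t' | isometric dd dd (@face_of _ _ K (whole l)) (@face_of _ _ K t')].

Lemma shape_Shapes l : Shapes K (shape l). Proof. by exists (whole l). Qed.

Lemma shape_isometric l l' : shape l = shape l' -> isometric (dd : M l -> M l -> R)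
  (dd : M l' -> M l' -> R) (bod l) (bod l').
Proof.
move=> E; have : shape l (whole l').
  by rewrite E /shape /=; exists id; split=> //; rewrite image_id.
by rewrite /shape /= /face_of /= !face_fullE.
Qed.

(** An isometry [j] of [l'] onto [l] followed by the inclusion [h] of [l] in [l'] is an isometric
    self-map of a compact simplex, hence onto. *)
Lemma shape_eq_sub (l l' : L) : shape l = shape l' -> img l `<=` img l' -> img l' `<=` img l.
Proof.
move=> E sub; have [p ep] := @body_extendable_exists R kappa (cell l).
have [p' Bp' Ep'] : img l' (cell_map p) by apply: sub; exists p => //; exact: (proj1 ep).
have [h [iso hB _]] := overlap ep Bp' (esym Ep').
have [j [jiso jonto]] := shape_isometric (esym E).
have jB q : bod l' q -> bod l (j q) by move=> Bq; rewrite -jonto; exists q.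
have := @compact_isometry_onto R kappa _ (bod l') (h \o j) (@body_seq_compact _ _ _).
move=> onto _ [q Bq <-].
have [||q' Bq' <-] := onto _ _ q Bq.
- by move=> q' /jB /hB [].
- by move=> a b Ba Bb /=; rewrite iso ?jiso //; exact: jB.
- by exists (j q'); [exact: jB | rewrite /= (proj2 (hB _ (jB _ Bq')))].
Qed.

(** A strictly increasing sequence of images would repeat a shape, against [shape_eq_sub]. *)
Lemma exists_maximal (l : L) : exists2 l' : L, maximal l' & img l `<=` img l'.
Proof.
apply: contrapT => no.
have H (l1 : L) : exists l2 : L, img l `<=` img l1 -> img l1 `<=` img l2 /\ ~ img l2 `<=` img l1.
  have [sub|nsub] := pselect (img l `<=` img l1); last by exists l.
  apply: contrapT => no2; apply: no; exists l1 => // l2 s12.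
  apply: contrapT => ns; apply: no2; exists l2 => _; split=> //.
have [f Hf] := choice H.
pose u k := iter k f l.
have u0 k : img l `<=` img (u k).
  elim: k => [|k IH] /=; first exact: subset_refl.
  by apply: (subset_trans IH); exact: (proj1 (Hf _ IH)).
have uS i k : img (u i) `<=` img (u (i + k)%N).
  elim: k => [|k IH]; first by rewrite addn0.
  rewrite addnS /=.
  by apply: subset_trans IH _; exact: (proj1 (Hf _ (u0 _))).
have [i [j [ij E]]] := finite_pigeonhole shapesK (fun k => shape_Shapes (u k)).
have sub : img (u j) `<=` img (u i).
  by apply: shape_eq_sub E _; rewrite -(subnKC (ltnW ij)); exact: uS.
have := proj2 (Hf _ (u0 i)); apply.
by have := @uS i.+1 (j - i.+1)%N; rewrite subnKC // => s; exact: subset_trans s sub.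
Qed.

Lemma extendable_isometry (l l' : L) (j : M l -> M l') p : isometry_on dd dd (bod l) j ->
  j @` bod l = bod l' -> extendable dd (bod l) p -> extendable dd (bod l') (j p).
Proof.
move=> jiso jonto [Bp ext].
have jB q : bod l q -> bod l' (j q) by move=> Bq; rewrite -jonto; exists q.
split=> [|y By yp]; first exact: jB.
have [q Bq Eq] : (j @` bod l) y by rewrite jonto.
subst y.
have qp : q <> p by move=> E; apply: yp; rewrite E.
have [z [Bz zp E]] := ext q Bq qp.
exists (j z); split; first exact: jB.
  move=> jz; apply: zp; apply: model_dist_eq0.
  by rewrite -(jiso z p) // jz model_dist0.
by rewrite !jiso.
Qed.

(** One simplex per shape is enough, by transport along isometries. The same [r] is a radius and,
    inverted, a bound on the size, so that both conditions are stable under decreasing [r], as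
    [finite_uniform] requires. *)
Lemma uniform_interior : exists2 r, 0 < r & forall l : L, exists2 o : M l, bod l o &
  (forall y, bod l y -> dd o y < r -> extendable dd (bod l) y) /\
  (forall y, bod l y -> dd o y <= r^-1).
Proof.
have [|r r0 Hr] := @finite_uniform R (set (nonempty_face K)) (Shapes K)
  (fun c r => forall l : L, shape l = c -> exists2 o : M l, bod l o &
    (forall y, bod l y -> dd o y < r -> extendable dd (bod l) y) /\
    (forall y, bod l y -> dd o y <= r^-1)) shapesK.
- move=> c; have [[l0 El0]|no] := pselect (exists l, shape l = c); last first.
    by exists 1 => // r _ l El; case: no; exists l.
  have [p ep] := @body_extendable_exists R kappa (cell l0).
  have Bp := proj1 ep.
  have [r1 r10 H1] := body_extendable_open ep.
  have [C C0 HC] := seq_compact_bounded (@body_seq_compact _ _ (cell l0)).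
  exists (Num.min r1 C^-1); first by rewrite lt_min r10 invr_gt0.
  move=> r' /andP[r'0]; rewrite le_min => /andP[l1 l2] l El.
  have [j [jiso jonto]] := shape_isometric (etrans El0 (esym El)).
  have jB q : bod l0 q -> bod l (j q) by move=> Bq; rewrite -jonto; exists q.
  exists (j p); first exact: jB.
  split=> y; rewrite -{1}jonto => -[q Bq <-]; rewrite jiso //.
    by move=> pq; apply: extendable_isometry => //; apply: H1 => //; lra.
  apply: le_trans (HC _ _ Bp Bq) _.
  by rewrite -[C]invrK lef_pV2 // ?posrE // invr_gt0.
- by exists r => // l; apply: (Hr (shape l)) => //; exact: shape_Shapes.
Qed.

End finite_shapes.

(** * Clustering of bounded sequences and the metric near an interior point *)

Section local_structure.
Context {R : realType} {kappa : R} (K : simplicial_complex kappa) (mK : complex_metric K).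
Hypothesis shapesK : finite_set (Shapes K).
Local Notation cell := (cell (s := K)).
Local Notation X := (carrier K).
Local Notation D := (@complex_dist R kappa K).
Local Notation M l := (model kappa (amb (cell l))).
Local Notation dd := (@model_dist R kappa _).
Local Notation bod l := (body (cell l)).

(* Bounded sequences cluster as soon as the space embeds isometrically in a
   Euclidean space: simplices of different maximal cells contain disjoint balls
   of the same radius. *)
Lemma embedded_complex_proper (N : nat) (E : X -> 'rV[R]_N) :
  (forall x y, euclidean_dist (E x) (E y) = D x y) ->
  forall (u : nat -> X) x0 C, (forall k, D x0 (u k) <= C) -> exists p, clusters D u p.
Proof.
move=> iso u x0 C uC.
have [r r0 Hr] := uniform_interior shapesK.
have Hl k : exists l : label K, maximal l /\ img l (u k).
  have [l0 [p [Bp Ep]]] := cell_map_surj (u k).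
  have [l ml sub] := exists_maximal shapesK l0.
  by exists l; split=> //; apply: sub; exists p.
have [l {}Hl] := choice Hl.
have Ho k : exists c, exists2 o : M (l k), cell_map o = c & bod (l k) o /\
    (forall y, bod (l k) y -> dd o y < r -> extendable dd (bod (l k)) y) /\
    (forall y, bod (l k) y -> dd o y <= r^-1).
  by have [ o Bo Ho] := Hr (l k); exists (cell_map o), o.
have [c Hc] := choice Ho.
(* A centre within [r] of another one is an extendable point of the cell of the latter, and
   maximality makes the two images equal. *)
have same i j : D (c i) (c j) < r -> img (l i) = img (l j).
  move=> cij; have [ o Eo [Bo [Hext _]]] := Hc i; have [ o' Eo' [Bo' _]] := Hc j.
  have [z Bz [Ez Dz]] : exists2 z, bod (l i) z & cell_map z = c j /\ D (cell_map o) (c j) = dd o z.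
    apply: (maximal_ball mK (proj1 (Hl i)) Bo Hext Bo).
    by rewrite model_dist0 subr0 Eo.
  have ez : extendable dd (bod (l i)) z by apply: Hext => //; rewrite -Dz Eo.
  have sub : img (l i) `<=` img (l j).
    by apply: overlap_sub ez _; rewrite Ez -Eo'; exists o'.
  by apply/seteqP; split=> //; exact: (proj1 (Hl i)).
have cu k : D (c k) (u k) <= r^-1.
  have [ o <- [Bo [_ Hdiam]]] := Hc k; have [p Bp <-] := proj2 (Hl k).
  exact: le_trans (complex_dist_le_model mK Bo Bp) (Hdiam p Bp).
have bound k i : `|E (c k) 0 i - E x0 0 i| <= C + r^-1.
  have le : euclidean_dist (E (c k)) (E x0) <= C + r^-1.
    rewrite iso; have := complex_dist_triangle mK (u k) (c k) x0; have := uC k; have := cu k.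
    by rewrite (complex_distC mK x0); lra.
  apply: le_trans le; rewrite /euclidean_dist -sqrtr_sqr ler_wsqrtr //.
  rewrite /dot (bigD1 i) //= !mxE -expr2 lerDl.
  by apply: sumr_ge0 => j _; rewrite -expr2 sqr_ge0.
have [phi [w Hw]] := @bolzano_weierstrass R N (fun k => E (c k) - E x0) (C + r^-1)
  (fun k i => ltac:(rewrite !mxE; exact: bound)).
(* Coordinates of late centres then differ by at most [r / (N + 1)], hence the centres by less than
   [r]. *)
pose e := r / (2 * N.+1%:R).
have e0 : 0 < e by rewrite divr_gt0 // mulr_gt0 // ltr0Sn.
have [K0 HK0] := invSn_lt e0.
have close k j : (K0 <= k)%N -> (K0 <= j)%N -> D (c (phi k)) (c (phi j)) < r.
  move=> Kk Kj; rewrite -iso /euclidean_dist.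
  have coord i : `|(E (c (phi k)) - E (c (phi j))) 0 i| <= r / N.+1%:R.
    have h1 := lt_trans (proj2 (Hw k) i) (HK0 k Kk).
    have h2 := lt_trans (proj2 (Hw j) i) (HK0 j Kj).
    have -> : r / N.+1%:R = e + e by rewrite /e; field; rewrite addrC natr1 pnatr_eq0.
    have := ler_distD (w 0 i) ((E (c (phi k)) - E x0) 0 i) ((E (c (phi j)) - E x0) 0 i).
    rewrite (distrC (w 0 i)) !mxE => h3; move: h1 h2 h3; rewrite !mxE => h1 h2.
    rewrite opprB addrA subrK => h3.
    by apply: le_trans h3 _; rewrite lerD // ltW.
  have lt : dot (E (c (phi k)) - E (c (phi j))) (E (c (phi k)) - E (c (phi j))) < r ^+ 2.
    apply: le_lt_trans (_ : _ <= \sum_(i < N) (r / N.+1%:R) ^+ 2) _.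
      apply: ler_sum => i _; rewrite -expr2 -[X in X <= _]real_normK ?num_real //.
      by rewrite lerXn2r ?nnegrE // divr_ge0 // ltW.
    rewrite sumr_const card_ord -[ltLHS]mulr_natr expr_div_n -[ltLHS]mulrA.
    rewrite -[ltRHS]mulr1 ltr_pM2l ?exprn_gt0 //.
    rewrite mulrC ltr_pdivrMr ?exprn_gt0 ?ltr0Sn // mul1r -natrX ltr_nat.
    by nia.
  by rewrite -[ltRHS](gtr0_norm r0) -sqrtr_sqr ltr_sqrt // exprn_gt0.
have Hp k : exists p : M (l (phi K0)), bod _ p /\ ((K0 <= k)%N -> cell_map p = u (phi k)).
  have [Kk|nK] := leqP K0 k; last first.
    by have [ o _ [Bo _]] := Hc (phi K0); exists o.
  have [p Bp Ep] : img (l (phi K0)) (u (phi k)).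
    by rewrite (same _ (phi k)) ?close //; exact: (proj2 (Hl (phi k))).
  by exists p.
have [p {}Hp] := choice Hp.
have [q Bq cq] := body_seq_compact (fun k => proj1 (Hp k)).
exists (cell_map q) => e1 e10 n; have [k [nk lt]] := cq _ e10 (maxn n K0).
exists (phi k); split.
  by apply: leq_trans (leq_trans (leq_maxl n K0) nk) (proj1 (Hw k)).
rewrite -(proj2 (Hp k)); last exact: leq_trans (leq_maxr n K0) nk.
by apply: le_lt_trans lt; apply: complex_dist_le_model => //; exact: (proj1 (Hp k)).
Qed.

Definition clustering_ball (o : X) (r : R) :=
  forall u : nat -> X, (forall k, D o (u k) <= r) -> exists p, clusters D u p.

(* Near an interior point of a maximal simplex the metric is that of a model
   space; [th] records initial directions of geodesics from [o]. *)
Lemma exists_smooth_point (x0 : X) : exists (N : nat) (o : X) (r : R)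
    (th : X -> 'rV[R]_N) (W W' : X -> R -> X),
  [/\ 0 < r, clustering_ball o r & forall z, z <> o -> D o z <= r ->
    [/\ dot (th z) (th z) = 1,
      exists2 t0, 0 < t0 & forall t, 0 < t < t0 ->
        [/\ D o (W z t) = t, D o (W' z t) = t & D (W z t) (W' z t) = 2 * t] &
      forall z', z' <> o -> D o z' <= r -> forall e, 0 < e -> exists2 dl, 0 < dl &
        forall t, 0 < t < dl ->
          D z' (W z t) <= D z' o - t * dot (th z') (th z) + e * t /\
          D z' (W' z t) <= D z' o + t * dot (th z') (th z) + e * t]].
Proof.
have [l0 _] := cell_map_surj x0; have [l ml _] := exists_maximal shapesK l0.
have [r r0 Hr] := uniform_interior shapesK; have [ o Bo [Hext _]] := Hr l.
have eo : extendable dd (bod l) o by apply: Hext => //; rewrite model_dist0.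
have [th [W [W' HW]]] := local_directions eo.
have mball := maximal_ball mK ml Bo Hext.
(* With a third of the radius, the pairs of points compared below stay within reach of [mball]. *)
pose r3 := r / 3; have r30 : 0 < r3 by rewrite divr_gt0.
have Hrep (x : X) : exists z : M l, D (cell_map o) x <= r3 -> [/\ bod l z, cell_map z = x & dd o z = D (cell_map o) x].
  have [le|nle] := pselect (D (cell_map o) x <= r3); last by exists o.
  have [|z Bz [Ez Dz]] := mball o x Bo; first by rewrite model_dist0 subr0 /r3 in le *; lra.
  by exists z.
have [z_ Hz] := choice Hrep.
have z_neq x : x <> cell_map o -> D (cell_map o) x <= r3 -> z_ x <> o.
  by move=> xo /Hz [_ E _] zo; apply: xo; rewrite -E zo.
exists (amb (cell l)).+1, (cell_map o), r3, (th \o z_), (fun x t => cell_map (W (z_ x) t)),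
  (fun x t => cell_map (W' (z_ x) t)); split=> //.
  move=> u uo; have Bu k : bod l (z_ (u k)) by case: (Hz _ (uo k)).
  have [p Bp cp] := body_seq_compact Bu.
  exists (cell_map p) => e e0 n; have [k [nk lt]] := cp e e0 n; exists k; split=> //.
  have [Bz Ez _] := Hz _ (uo k).
  by rewrite -Ez; apply: le_lt_trans lt; exact: complex_dist_le_model.
move=> z zo zr; have [Bz Ez dz] := Hz z zr; have zo' := z_neq z zo zr.
have [th1 [t0 t00 Ht0] HF] := HW (z_ z) Bz zo'.
split=> //=.
  exists (Num.min t0 r3); first by rewrite lt_min t00.
  move=> t /andP[tt]; rewrite lt_min => /andP[tt0 ttr].
  have It : 0 < t < t0 by rewrite tt.
  have [B1 B2 d1 d2 d3] := Ht0 t It.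
  have DE y w : bod l y -> bod l w -> dd y w < r - dd o y -> D (cell_map y) (cell_map w) = dd y w.
    move=> By Bw lt; have [|w' Bw' [Ew' Dw']] := mball y (cell_map w) By.
      by apply: le_lt_trans lt; exact: complex_dist_le_model.
    by rewrite Dw' (cell_map_inj Bw' Bw Ew').
  have rr : r = r3 + r3 + r3 by rewrite /r3; field.
  split; rewrite DE ?d1 ?d2 ?d3 ?model_dist0 //; lra.
move=> z' z'o z'r e e0; have [Bz' Ez' dz'] := Hz z' z'r.
have [dl dl0 Hdl] := HF (z_ z') Bz' (z_neq z' z'o z'r) e e0.
exists (Num.min dl t0); first by rewrite lt_min dl0.
move=> t /andP[tt]; rewrite lt_min => /andP[tdl tt0].
have [B1 B2 _ _ _] := Ht0 t (introT andP (conj tt tt0)).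
have [h1 h2] := Hdl t (introT andP (conj tt tdl)).
have le w : bod l w -> D z' (cell_map w) <= dd (z_ z') w.
  by move=> Bw; rewrite -[X in D X _]Ez'; exact: complex_dist_le_model.
rewrite (complex_distC mK z' (cell_map o)) -dz' (model_distC o).
by split; [apply: le_trans (le _ B1) h1 | apply: le_trans (le _ B2) h2].
Qed.

End local_structure.

(** * Ptolemaic spaces whose inversions are length spaces *)

Lemma le_of_small {R : realType} (a b C : R) :
  (forall e, 0 < e < 1 -> a <= b + e * C) -> a <= b.
Proof.
move=> H; rewrite leNgt; apply/negP => ba.
pose D := `|C| + 1; have D0 : 0 < D by rewrite ltr_wpDl.
pose e := Num.min (1 / 2) ((a - b) / (2 * D)).
have e0 : 0 < e by rewrite lt_min !divr_gt0 ?subr_gt0 // mulr_gt0.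
have [e1 e2] : e <= 1 / 2 /\ e <= (a - b) / (2 * D) by rewrite !ge_min !lexx orbT.
have := H e; rewrite e0 /= => /(_ ltac:(lra)).
have : e * C <= e * D.
  by rewrite ler_pM2l // /D; have := ler_norm C; lra.
move: e2; rewrite ler_pdivlMr ?mulr_gt0 // => e2.
by move: ba e2; rewrite mulrCA; lra.
Qed.

(** * Euclidean embedding of a Ptolemaic space *)

Section ptolemaic_embedding.
Context {R : realType} (T : Type) (D : T -> T -> R).
Hypothesis D0 : forall x, D x x = 0.
Hypothesis D_eq0 : forall x y, D x y = 0 -> x = y.
Hypothesis DC : forall x y, D x y = D y x.
Hypothesis D_tri : forall y x z, D x z <= D x y + D y z.
Hypothesis ptolemy : forall x y z w, D x z * D y w <= D x y * D z w + D y z * D x w.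
Hypothesis between : forall x y s e, 0 <= s <= D x y -> 0 < e ->
  exists z, D x z <= s /\ D z y <= D x y - s + e.
Hypothesis inversion_between : forall p x y s e, x <> p -> y <> p ->
  0 <= s <= D x y / (D x p * D y p) -> 0 < e ->
  exists z, [/\ z <> p, D x z / (D x p * D z p) <= s + e &
    D z y / (D z p * D y p) <= D x y / (D x p * D y p) - s + e].

Let D_ge0 x y : 0 <= D x y.
Proof. by have := D_tri y x x; rewrite D0 (DC y x); lra. Qed.

Let D_gt0 x y : x <> y -> 0 < D x y.
Proof. by move=> xy; rewrite lt_def D_ge0 andbT; apply/eqP => /D_eq0. Qed.

Variables (o : T) (r : R) (N : nat) (th : T -> 'rV[R]_N) (W W' : T -> R -> T).
Hypothesis r0 : 0 < r.
Hypothesis cluster_o : forall u : nat -> T, (forall k, D o (u k) <= r) ->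
  exists p, clusters D u p.
Hypothesis th_unit : forall z, z <> o -> D o z <= r -> dot (th z) (th z) = 1.
Hypothesis W_dist : forall z, z <> o -> D o z <= r -> exists2 t0, 0 < t0 &
  forall t, 0 < t < t0 -> [/\ D o (W z t) = t, D o (W' z t) = t & D (W z t) (W' z t) = 2 * t].
Hypothesis first_variation : forall z z', z <> o -> D o z <= r -> z' <> o -> D o z' <= r ->
  forall e, 0 < e -> exists2 dl, 0 < dl & forall t, 0 < t < dl ->
    D z' (W z t) <= D z' o - t * dot (th z') (th z) + e * t /\
    D z' (W' z t) <= D z' o + t * dot (th z') (th z) + e * t.

(** Turns approximate inequalities along a sequence into exact ones at a cluster point. *)
Lemma cluster_le (u : nat -> T) p (f : T -> R) C b : 0 <= C -> clusters D u p ->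
  (forall x y, f x <= f y + C * D y x) -> (forall k, f (u k) <= b + k.+1%:R^-1) -> f p <= b.
Proof.
move=> C0 cp fC ub; apply: (@le_of_small _ _ _ (1 + C)) => e /andP[e0 _].
have [K HK] := invSn_lt e0; have [k [Kk kp]] := cp e e0 K.
apply: le_trans (fC p (u k)) _; have := ub k; have := HK k Kk.
have : C * D (u k) p <= C * e by rewrite ler_wpM2l // ltW.
by move: (k.+1%:R^-1) => i; lra.
Qed.

(** Points nearly between [o] and [x] can be taken in the ball where sequences cluster, so near [o]
    there is a point exactly between. *)
Lemma local_foot x : x <> o -> exists z, [/\ z <> o, D o z <= r & D o z + D z x = D o x].
Proof.
move=> xo; have x0 : 0 < D o x by apply: D_gt0; exact: nesym.
pose s := Num.min r (D o x).
have s0 : 0 < s by rewrite lt_min r0.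
have [sr sx] : s <= r /\ s <= D o x by rewrite !ge_min !lexx orbT.
have Hz (k : nat) : exists z, D o z <= s /\ D z x <= D o x - s + k.+1%:R^-1.
  by apply: between; [rewrite ltW | exact: invSn_gt0].
have [u Hu] := choice Hz.
have [z cz] := cluster_o (fun k => le_trans (proj1 (Hu k)) sr).
have z1 : D o z <= s.
  apply: (cluster_le ler01 cz) => [y w|k]; first by rewrite mul1r; exact: D_tri.
  by apply: le_trans (proj1 (Hu k)) _; rewrite lerDl ltW // invSn_gt0.
have z2 : D z x <= D o x - s.
  apply: (cluster_le (f := D^~ x) ler01 cz) => [y w|k]; last exact: (proj2 (Hu k)).
  by rewrite mul1r addrC (DC w y); exact: D_tri.
have tri := D_tri z o x.
exists z; split; [|lra|lra].
by move=> zo; move: z2; rewrite zo lerBrDr gerDl leNgt s0.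
Qed.

(** The value at [o] is a placeholder: in the embedding [dir o] is multiplied by [D o o = 0]. *)
Definition foot x := if pselect (x <> o) is left H then projT1 (cid (local_foot H)) else o.

Lemma footP x : x <> o -> [/\ foot x <> o, D o (foot x) <= r & D o (foot x) + D (foot x) x = D o x].
Proof. by move=> xo; rewrite /foot; case: pselect => // H; case: cid. Qed.

Definition dir x := th (foot x).

Lemma dir_unit x : x <> o -> dot (dir x) (dir x) = 1.
Proof. by move=> /footP[? ? _]; exact: th_unit. Qed.

(** The upper bounds come from the first variation at [foot x] and the triangle inequality.
    Ptolemy's inequality for [x], [o] and the two opposite points gives
    [2 * D x o <= D x (W z t) + D x (W' z t)], so the upper bound on each side yields the lower
    bound on the other. *)
Lemma distance_derivative x z e : x <> o -> z <> o -> D o z <= r -> 0 < e ->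
  exists2 dl, 0 < dl & forall t, 0 < t < dl ->
    `|D x (W z t) - (D x o - t * dot (dir x) (th z))| <= e * t /\
    `|D x (W' z t) - (D x o + t * dot (dir x) (th z))| <= e * t.
Proof.
move=> xo zo zr e0; have [fo fr fx] := footP xo.
have [d1 d10 H1] := first_variation zo zr fo fr e0.
have [d2 d20 H2] := W_dist zo zr.
exists (Num.min d1 d2); first by rewrite lt_min d10.
move=> t /andP[t0]; rewrite lt_min => /andP[t1 t2].
have [h1 h2] := H1 t (introT andP (conj t0 t1)).
have [e1 e2 e3] := H2 t (introT andP (conj t0 t2)).
have u1 := D_tri (foot x) x (W z t); have u2 := D_tri (foot x) x (W' z t).
rewrite -/(dir x) in h1 h2; move: fx; rewrite (DC o x) (DC o (foot x)) (DC _ x) => fx.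
have P := ptolemy x (W z t) o (W' z t).
have : 2 * D x o <= D x (W z t) + D x (W' z t).
  rewrite -(ler_pM2r t0); move: P; rewrite e3 (DC (W z t) o) e1 e2; lra.
by rewrite !ler_norml => c; split; apply/andP; split; lra.
Qed.

(** Ptolemy's inequality for [p], [x], [z] and a moving fourth point is an equality at [o], so its
    derivative vanishes along [dir y], the opposite direction being available too. Hence [V] is
    orthogonal to all directions; as a combination of directions it is 0. *)
Lemma collinear_dir p x z : p <> o -> x <> o -> z <> o ->
  D p x * D z o + D x z * D p o = D p z * D x o ->
  D p z *: dir x = D x z *: dir p + D p x *: dir z.
Proof.
move=> po xo zo E.
pose V := D p z *: dir x - D x z *: dir p - D p x *: dir z.
pose C := D p z + D x z + D p x.
have V0 y : y <> o -> dot V (dir y) = 0.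
  move=> yo; have [fo fr _] := footP yo.
  have ED : dot V (dir y) = D p z * dot (dir x) (dir y) - D x z * dot (dir p) (dir y)
     - D p x * dot (dir z) (dir y) by rewrite /V !dotE.
  have H e : 0 < e < 1 -> `|dot V (dir y)| <= 0 + e * C.
    move=> /andP[e0 _].
    have [d1 d10 H1] := distance_derivative xo fo fr e0.
    have [d2 d20 H2] := distance_derivative po fo fr e0.
    have [d3 d30 H3] := distance_derivative zo fo fr e0.
    pose t := Num.min d1 (Num.min d2 d3) / 2.
    have m0 : 0 < Num.min d1 (Num.min d2 d3) by rewrite !lt_min d10 d20.
    have t0 : 0 < t by rewrite divr_gt0.
    have : t < Num.min d1 (Num.min d2 d3) by rewrite /t; lra.
    rewrite !lt_min => /and3P[t1 t2 t3].
    have [a1 b1] := H1 t (introT andP (conj t0 t1)).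
    have [a2 b2] := H2 t (introT andP (conj t0 t2)).
    have [a3 b3] := H3 t (introT andP (conj t0 t3)).
    have P1 := ptolemy p x z (W (foot y) t).
    have P2 := ptolemy p x z (W' (foot y) t).
    have xz0 := D_ge0 x z; have pz0 := D_ge0 p z; have px0 := D_ge0 p x.
    rewrite -/(dir y) in a1 a2 a3 b1 b2 b3.
    rewrite add0r -(ler_pM2r t0) -{1}(gtr0_norm t0) -normrM ED /C.
    move: a1 b1 a2 b2 a3 b3 P1 P2; rewrite !ler_norml.
    move: (D x (W _ t)) (D x (W' _ t)) (D p (W _ t)) (D p (W' _ t)) (D z (W _ t)) (D z (W' _ t)).
    move=> wx wx' wp wp' wz wz' /andP[a1 a1'] /andP[b1 b1'] /andP[a2 a2'] /andP[b2 b2']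
      /andP[a3 a3'] /andP[b3 b3'] P1 P2.
    move: (dot (dir x) (dir y)) (dot (dir p) (dir y)) (dot (dir z) (dir y)) a1 a1' b1 b1' a2 a2' b2 b2' a3 a3' b3 b3' => gx gp gz.
    move: (D p x) (D x z) (D p z) (D x o) (D p o) (D z o) E P1 P2 xz0 pz0 px0 => px xz pz x_ p_ z_ E P1 P2 xz0 pz0 px0 a1 a1' b1 b1' a2 a2' b2 b2' a3 a3' b3 b3'.
    have k1 : 0 <= pz * (wx - (x_ - t * gx) + e * t) by rewrite mulr_ge0 //; lra.
    have k2 : 0 <= xz * (e * t - (wp - (p_ - t * gp))) by rewrite mulr_ge0 //; lra.
    have k3 : 0 <= px * (e * t - (wz - (z_ - t * gz))) by rewrite mulr_ge0 //; lra.
    have k4 : 0 <= pz * (wx' - (x_ + t * gx) + e * t) by rewrite mulr_ge0 //; lra.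
    have k5 : 0 <= xz * (e * t - (wp' - (p_ + t * gp))) by rewrite mulr_ge0 //; lra.
    have k6 : 0 <= px * (e * t - (wz' - (z_ + t * gz))) by rewrite mulr_ge0 //; lra.
    by apply/andP; split; lra.
  apply/eqP; rewrite -normr_eq0 eq_le normr_ge0 andbT.
  exact: le_of_small H.
have VV : dot V V = 0.
  have EV : V = D p z *: dir x - D x z *: dir p - D p x *: dir z by [].
  move: (V) EV V0 => U EU U0.
  by rewrite {2}EU !dotE !U0 // !mulr0 !subr0.
have /eqP := dot_eq0 VV; rewrite /V subr_eq0 subr_eq => /eqP ->.
by rewrite addrC.
Qed.

(* [z] lies near the end of a geodesic of the inversion at [x] from [y] to [o]. *)
Lemma ptolemy_extension x y e : x <> o -> y <> o -> x <> y -> 0 < e ->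
  exists z, [/\ z <> o, D o z < e & D x y * D z o + D y z * D x o = D x z * D y o].
Proof.
move=> xo yo xy e0.
have x0 := D_gt0 xo; have y0 := D_gt0 yo; have xy0 := D_gt0 xy.
have ox0 : 0 < D o x by rewrite DC.
have yx0 : 0 < D y x by rewrite DC.
pose a := D o x; pose I := D y o / (D y x * D o x).
have I0 : 0 < I by rewrite divr_gt0 // mulr_gt0.
pose m := Num.min (Num.min e r) a.
have m0 : 0 < m by rewrite !lt_min e0 r0.
(* A distance from [o] in the inversion at [x], so small that even its double forces
   [D o (u k) <= m / 2]. Then the sequence clusters, and as [m <= a] its cluster point is not
   [x]. *)
pose s := Num.min I (Num.min ((4 * a)^-1) (m / (8 * a ^+ 2))).
have s0 : 0 < s by rewrite !lt_min I0 invr_gt0 !divr_gt0 ?mulr_gt0 ?exprn_gt0.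
have [sI [sa sm]] : s <= I /\ s <= (4 * a)^-1 /\ s <= m / (8 * a ^+ 2).
  by rewrite !ge_min !lexx !orbT.
have Hz (k : nat) : exists z, [/\ z <> x,
    D y z / (D y x * D z x) <= I - s + Num.min s k.+1%:R^-1 &
    D z o / (D z x * D o x) <= s + Num.min s k.+1%:R^-1].
  have [||z [z1 z2 z3]] := @inversion_between x y o (I - s) (Num.min s k.+1%:R^-1)
    (nesym xy) (nesym xo).
  - by rewrite subr_ge0 sI /= lerBlDr lerDl ltW.
  - by rewrite lt_min s0 invSn_gt0.
  by exists z; split=> //; move: z3; rewrite -/I; lra.
have [u Hu] := choice Hz.
have Hu1 k : D y (u k) <= (I - s + k.+1%:R^-1) * (D y x * D (u k) x).
  have [z1 z2 _] := Hu k; have z0 := D_gt0 z1.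
  rewrite -ler_pdivrMr ?mulr_gt0 //; apply: le_trans z2 _.
  by rewrite lerD2l ge_min lexx orbT.
have Hu2 k : D (u k) o <= (s + k.+1%:R^-1) * (D (u k) x * D o x).
  have [z1 _ z2] := Hu k; have z0 := D_gt0 z1.
  rewrite -ler_pdivrMr ?mulr_gt0 //; apply: le_trans z2 _.
  by rewrite lerD2l ge_min lexx orbT.
have a0 : 0 < a by [].
have small k : D o (u k) <= m / 2.
  have [z1 _ z2] := Hu k; have z0 := D_gt0 z1.
  have : D (u k) o / (D (u k) x * D o x) <= 2 * s.
    by apply: le_trans z2 _; have : Num.min s k.+1%:R^-1 <= s by [rewrite ge_min lexx]; lra.
  rewrite ler_pdivrMr ?mulr_gt0 // -/a => h.
  have tr := D_tri o (u k) x; rewrite -/a in tr.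
  rewrite DC; set c := D (u k) o in h tr *.
  have c0 : 0 <= c by exact: D_ge0.
  have h1 : c <= 2 * s * ((c + a) * a).
    apply: le_trans h _; rewrite ler_pM2l ?mulr_gt0 // ler_pM2r //.
  have h2 : 2 * s * a <= 1 / 2.
    have : s * (4 * a) <= 1 by rewrite -ler_pdivlMr ?mulr_gt0 // div1r.
    by lra.
  have h3 : s * (8 * a ^+ 2) <= m by rewrite -ler_pdivlMr ?mulr_gt0 ?exprn_gt0.
  have h4 : 0 <= c * (1 / 2 - 2 * s * a) by rewrite mulr_ge0 // subr_ge0.
  have h5 : 2 * s * ((c + a) * a) = c * (2 * s * a) + s * (8 * a ^+ 2) / 4 by field.
  by move: h1; rewrite h5; move: h3 h4; lra.
have [me [mr ma]] : m <= e /\ m <= r /\ m <= a by rewrite !ge_min !lexx !orbT.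
have [z cz] : exists z, clusters D u z.
  by apply: cluster_o => k; apply: le_trans (small k) _; lra.
have zm : D o z <= m / 2.
  apply: (cluster_le ler01 cz) => [p q|k]; first by rewrite mul1r; exact: D_tri.
  by apply: le_trans (small k) _; rewrite lerDl ltW // invSn_gt0.
have zx0 : 0 < D z x by have := D_tri z o x; rewrite -/a; lra.
have lim1 : D y z <= (I - s) * (D y x * D z x).
  have sI0 : 0 <= I - s by rewrite subr_ge0.
  apply: (@le_of_small _ _ _ (1 + (I - s) * D y x + D y x * (D z x + 1))) => f /andP[f0 f1].
  have [K HK] := invSn_lt f0; have [k [Kk kz]] := cz f f0 K.
  have h1 := D_tri (u k) y z; have h2 := Hu1 k; have h3 := D_tri z (u k) x.
  have h4 := HK k Kk; have h5 := invSn_gt0 (R := R) k; move: h2 h4 h5.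
  move: (k.+1%:R^-1) => i h2 h4 h5.
  have h6 : (I - s + i) * (D y x * D (u k) x) <= (I - s + f) * (D y x * (D z x + f)).
    apply: ler_pM; [lra | by rewrite mulr_ge0 ?D_ge0 | lra | rewrite ler_pM2l //; lra].
  have h7 : 0 <= f * D y x * (1 - f) by rewrite !mulr_ge0 //; lra.
  by lra.
have lim2 : D z o <= s * (D z x * D o x).
  apply: (@le_of_small _ _ _ (1 + s * D o x + D o x * (D z x + 1))) => f /andP[f0 f1].
  have [K HK] := invSn_lt f0; have [k [Kk kz]] := cz f f0 K.
  have h1 := D_tri (u k) z o; rewrite (DC z (u k)) in h1; have h2 := Hu2 k; have h3 := D_tri z (u k) x.
  have h4 := HK k Kk; have h5 := invSn_gt0 (R := R) k; move: h2 h4 h5.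
  move: (k.+1%:R^-1) => i h2 h4 h5.
  have h6 : (s + i) * (D (u k) x * D o x) <= (s + f) * ((D z x + f) * D o x).
    apply: ler_pM; [lra | by rewrite mulr_ge0 ?D_ge0 | lra | rewrite ler_pM2r //; lra].
  have h7 : 0 <= f * D o x * (1 - f) by rewrite !mulr_ge0 //; lra.
  by lra.
have Iyo : I * (D y x * D o x) = D y o by rewrite /I divfK // gt_eqF // mulr_gt0.
exists z; split.
(* For [z = o] the inverted distance [I] from [y] to [o] would be at most [I - s]. *)
- move=> zo; move: lim1; rewrite zo; clear zo.
  have : 0 < s * (D y x * D o x) by rewrite !mulr_gt0.
  by move: Iyo; lra.
- by lra.
- apply/eqP; rewrite eq_le; apply/andP; split; last exact: ptolemy.
  have k1 : D o x * D y z <= D o x * ((I - s) * (D y x * D z x)) by rewrite ler_pM2l.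
  have k2 : D y x * D z o <= D y x * (s * (D z x * D o x)) by rewrite ler_pM2l.
  have k3 : D o x * (I * (D y x * D z x)) = D z x * D y o by rewrite -Iyo; ring.
  by rewrite (DC x y) (DC x o) (DC x z); lra.
Qed.

(** For the points [z] of [ptolemy_extension], [collinear_dir] gives [D x y *: dir z = D x z *: dir
    y - D y z *: dir x]. Take squared norms and let [z] tend to [o]. *)
Lemma cosine_rule x y : x <> o -> y <> o -> x <> y ->
  D x y ^+ 2 = D x o ^+ 2 + D y o ^+ 2 - 2 * D x o * D y o * dot (dir x) (dir y).
Proof.
move=> xo yo xy; set g := dot _ _.
have /andP[g1 g2] : -1 <= g <= 1 by apply: dot_unit_le1; exact: dir_unit.
have x0 := D_ge0 x o; have y0 := D_ge0 y o.
(* Collects the errors of replacing [D x z] and [D y z] by [D x o] and [D y o], each off by at most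
   [e < 1]. *)
pose C := 4 * (D x o + D y o + 1).
have key e : 0 < e < 1 ->
   `|D x y ^+ 2 - (D x o ^+ 2 + D y o ^+ 2 - 2 * D x o * D y o * g)| <= 0 + e * C.
  move=> /andP[e0 e1]; have [z [zo ze E]] := ptolemy_extension xo yo xy e0.
  have V := collinear_dir xo yo zo E.
  have xz0 := D_ge0 x z; have yz0 := D_ge0 y z.
  have : D x y ^+ 2 = D x z ^+ 2 + D y z ^+ 2 - 2 * D x z * D y z * g.
    have V2 : D x y *: dir z = D x z *: dir y - D y z *: dir x.
      by rewrite V addrAC subrr add0r.
    have := congr1 (fun v => dot v v) V2; rewrite /= !dotE !dir_unit // (dotC (dir y)) -/g.
    by clear V V2; lra.
  move=> ->; clear V.
  have t1 := D_tri o x z; have t2 := D_tri z x o; have t3 := D_tri o y z; have t4 := D_tri z y o.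
  rewrite (DC z o) in t2 t4.
  have A : exists2 p, `|p| <= e & D x z = D x o + p.
    by exists (D x z - D x o); [rewrite ler_norml; apply/andP; split; lra | ring].
  have B : exists2 q, `|q| <= e & D y z = D y o + q.
    by exists (D y z - D y o); [rewrite ler_norml; apply/andP; split; lra | ring].
  case: A B xz0 yz0 => p pe -> [q qe ->] xz0 yz0.
  rewrite add0r; move: pe qe; rewrite !ler_norml => /andP[p1 p2] /andP[q1 q2].
  rewrite /C; move: (D x o) (D y o) x0 y0 xz0 yz0 => a b x0 y0 xz0 yz0.
  have -> : (a + p) ^+ 2 + (b + q) ^+ 2 - 2 * (a + p) * (b + q) * g -
    (a ^+ 2 + b ^+ 2 - 2 * a * b * g) =
    2 * a * (p - q * g) + 2 * b * (q - p * g) + (p ^+ 2 + q ^+ 2 - 2 * (p * q) * g) by ring.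
  have bnd (u v : R) : - e <= u -> u <= e -> - e <= v -> v <= e -> `|u - v * g| <= 2 * e.
    move=> u1 u2 v1 v2; apply: le_trans (ler_normB _ _) _.
    have h1 : `|u| <= e by rewrite ler_norml u1.
    have h2 : `|v * g| <= e.
      rewrite normrM -[e]mulr1 ler_pM // ler_norml ?v1 ?v2 // g1 g2 //.
    by lra.
  have k1 : `|2 * a * (p - q * g)| <= 2 * a * (2 * e).
    by rewrite normrM ger0_norm ?mulr_ge0 // ler_wpM2l ?mulr_ge0 // bnd.
  have k2 : `|2 * b * (q - p * g)| <= 2 * b * (2 * e).
    by rewrite normrM ger0_norm ?mulr_ge0 // ler_wpM2l ?mulr_ge0 // bnd.
  have k3 : `|p ^+ 2 + q ^+ 2 - 2 * (p * q) * g| <= 4 * e.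
    have ee : e ^+ 2 <= e by rewrite expr2 ger_pMr // ltW.
    have np : `|p| <= e by rewrite ler_norml p1.
    have nq : `|q| <= e by rewrite ler_norml q1.
    have ng : `|g| <= 1 by rewrite ler_norml g1.
    have hp : `|p ^+ 2| <= e ^+ 2 by rewrite normrX lerXn2r ?nnegrE // ltW.
    have hq : `|q ^+ 2| <= e ^+ 2 by rewrite normrX lerXn2r ?nnegrE // ltW.
    have hpq : `|2 * (p * q) * g| <= 2 * e ^+ 2.
      rewrite !normrM gtr0_norm // -[2 * e ^+ 2]mulr1 ler_pM ?mulr_ge0 //.
      by rewrite ler_pM2l // expr2 ler_pM.
    apply: le_trans (ler_normB _ _) _; apply: le_trans (lerD (ler_normD _ _) (lexx _)) _.
    by lra.
  move: k1 k2 k3; rewrite !ler_norml => /andP[a1 a2] /andP[b1 b2] /andP[c1 c2].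
  by apply/andP; split; lra.
apply/eqP; rewrite -subr_eq0 -normr_eq0 eq_le normr_ge0 andbT.
exact: le_of_small key.
Qed.

Theorem ptolemaic_isometric_embedding : exists E : T -> 'rV[R]_N, E o = 0 /\
  forall x y, euclidean_dist (E x) (E y) = D x y.
Proof.
exists (fun x => D x o *: dir x); split; first by rewrite D0 scale0r.
move=> x y; rewrite /euclidean_dist -[RHS](ger0_norm (D_ge0 x y)) -sqrtr_sqr; congr Num.sqrt.
have [->|xy] := pselect (x = y); first by rewrite subrr dot0l D0 expr0n.
have [xo|xo] := pselect (x = o).
  rewrite xo D0 scale0r sub0r !dotE dir_unit; last by move=> yo; apply: xy; rewrite xo yo.
  by rewrite (DC o); ring.
have [yo|yo] := pselect (y = o).
  by rewrite yo D0 scale0r subr0 !dotE dir_unit //; ring.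
rewrite (cosine_rule xo yo xy) !dotE !dir_unit // (dotC (dir y)); ring.
Qed.

End ptolemaic_embedding.

(** * Approximate betweenness in length spaces and inversions *)

Lemma mdist_continuous {R : realType} (Y : metricType R) (a : Y) : continuous (@mdist R Y a).
Proof.
move=> y; apply/(@pseudometric_normed_Zmodule.cvgrPdist_lt _ R^o) => e e0.
apply: filterS (proj1 (@metricType_numDomainType.fcvgrPdist_lt _ Y (nbhs y) _ y) cvg_id e e0) => z yz.
have := metric_triangle a y z; have := metric_triangle a z y; rewrite (metric_sym z y) => h1 h2.
by rewrite ltr_norml; apply/andP; split; lra.
Qed.

(** By the intermediate value theorem a nearly shortest path has a point at distance [s] from [a],
    and the path is at least as long as the broken line through this point. *)
Lemma length_space_between {R : realType} (Y : metricType R) (a b : Y) (s e : R) :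
  length_space Y -> 0 <= s <= mdist a b -> 0 < e ->
  exists c, mdist a c <= s /\ mdist c b <= mdist a b - s + e.
Proof.
move=> lenY /andP[s0 sab] e0.
have fin : ereal_inf [set path_length g | g in path_between a b] \is a fin_num.
  by rewrite -lenY.
have [_ [g [gc g0 g1] <-]] := lb_ereal_inf_adherent e0 fin; rewrite -lenY -EFinD => glen.
have dist_len (t : R) : 0 < t < 1 -> mdist a (g t) + mdist (g t) b <= mdist a b + e.
  move=> /andP[t0 t1]; rewrite -lee_fin; apply: le_trans (ltW glen).
  apply: ereal_sup_ubound; exists [:: t; 1]; first by split; rewrite //= t0 t1.
  by rewrite /= big_nat_recl // big_nat1 /= g0 g1.
have [||t] := @IVT R (mdist a \o g) 0 1 s ler01.
- by move=> t; exact: (continuous_comp (gc t) (@mdist_continuous _ Y a (g t))).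
- by rewrite /= g0 g1 mdistxx ge_min s0 le_max sab orbT.
rewrite in_itv /= => /andP[t0 t1] gts; exists (g t); rewrite gts lexx; split=> //.
move: t0; rewrite le_eqVlt => /predU1P[t0|t0].
  by move: gts; rewrite -t0 g0 mdistxx => <-; lra.
move: t1; rewrite le_eqVlt => /predU1P[t1|t1].
  by move: gts; rewrite t1 g1 mdistxx => ?; lra.
by have := dist_len t; rewrite t0 t1 gts => /(_ isT); lra.
Qed.

Section inversion_spaces.
Context {R : realType} (X : metricType R).
Implicit Types p x y z : X.

Lemma ptolemy_of_inversion x y z p : is_metric (inv_dist p) ->
  mdist x z * mdist y p <= mdist x y * mdist z p + mdist y z * mdist x p.
Proof.
move=> [_ _ _ tri].
have [->|/eqP xp] := eqVneq x p.
  by rewrite mdistxx mulr0 addr0 (metric_sym p z) (metric_sym p y) mulrC.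
have [->|/eqP yp] := eqVneq y p.
  by rewrite mdistxx mulr0 addr_ge0 ?mulr_ge0 ?mdist_ge0.
have [->|/eqP zp] := eqVneq z p.
  by rewrite mdistxx mulr0 add0r mulrC.
have h q : q <> p -> q \in [set~ p] by move=> ?; apply/mem_set.
have gt0 q : q <> p -> 0 < mdist q p by move=> /eqP; rewrite mdist_gt0.
have := tri (exist _ y (h y yp)) (exist _ x (h x xp)) (exist _ z (h z zp)).
rewrite /inv_dist /=; move: (gt0 x xp) (gt0 y yp) (gt0 z zp).
move: (mdist x p) (mdist y p) (mdist z p) (mdist x z) (mdist x y) (mdist y z).
move=> a b c u v w a0 b0 c0 H.
have : u / (a * c) * (a * b * c) <= (v / (a * b) + w / (b * c)) * (a * b * c).
  by apply: ler_wpM2r H; rewrite !mulr_ge0 // ltW.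
have -> : u / (a * c) * (a * b * c) = u * b by field; rewrite !gt_eqF.
have -> : (v / (a * b) + w / (b * c)) * (a * b * c) = v * c + w * a.
  by field; rewrite !gt_eqF.
by [].
Qed.

(** A point nearly between exists in the completion, and density of the image moves it into the
    space, at a cost of [e / 2] each. *)
Lemma inversion_approximate_between (Y : metricType R) p x y (s e : R) :
  is_inversion p Y -> length_space Y -> x <> p -> y <> p ->
  0 <= s <= mdist x y / (mdist x p * mdist y p) -> 0 < e ->
  exists z, [/\ z <> p, mdist x z / (mdist x p * mdist z p) <= s + e &
    mdist z y / (mdist z p * mdist y p) <= mdist x y / (mdist x p * mdist y p) - s + e].
Proof.
move=> [f [fiso fdense _]] lenY xp yp sxy e0.
have h q : q <> p -> q \in [set~ p] by move=> ?; apply/mem_set.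
pose x' : set_type [set~ p] := exist _ x (h x xp).
pose y' : set_type [set~ p] := exist _ y (h y yp).
have e2 : 0 < e / 2 by rewrite divr_gt0.
have fE u v : mdist (f u) (f v) = inv_dist p u v by apply: fiso.
have [|c [xc cy]] := @length_space_between R Y (f x') (f y') s (e / 2) lenY _ e2.
  by rewrite fE.
have [||w [cz [z _ zE]]] := fdense (ball c (e / 2))^°.
- by exists c; apply: nbhsx_ballx.
- exact: open_interior.
move: cz => /interior_subset; rewrite ballEmdist -zE /= => {}cz.
exists (val z); have := set_valP z => zp; split=> //.
- have := metric_triangle (f x') c (f z); rewrite fE {1}/inv_dist /=.
  by move=> ?; lra.
- have := metric_triangle (f z) c (f y'); rewrite (metric_sym (f z) c) fE {1}/inv_dist /=.
  by move: cy; rewrite fE {1}/inv_dist /=; lra.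
Qed.

End inversion_spaces.

(** * The image of the embedding is a linear subspace *)

Section linear_image.
Context {R : realType} (T : Type) (D : T -> T -> R) (N : nat) (E : T -> 'rV[R]_N) (o : T).
Hypothesis D0 : forall x, D x x = 0.
Hypothesis D_eq0 : forall x y, D x y = 0 -> x = y.
Hypothesis DC : forall x y, D x y = D y x.
Hypothesis D_tri : forall y x z, D x z <= D x y + D y z.
Hypothesis between : forall x y s e, 0 <= s <= D x y -> 0 < e ->
  exists z, D x z <= s /\ D z y <= D x y - s + e.
Hypothesis inversion_between : forall p x y s e, x <> p -> y <> p ->
  0 <= s <= D x y / (D x p * D y p) -> 0 < e ->
  exists z, [/\ z <> p, D x z / (D x p * D z p) <= s + e &
    D z y / (D z p * D y p) <= D x y / (D x p * D y p) - s + e].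
Hypothesis proper : forall u C, (forall k, D o (u k) <= C) -> exists p, clusters D u p.
Hypothesis unbounded : forall C, exists y, C < D o y.
Hypothesis E0 : E o = 0.
Hypothesis E_isometry : forall x y, euclidean_dist (E x) (E y) = D x y.

Let dist_sqr x y : dot (E x - E y) (E x - E y) = D x y ^+ 2.
Proof. by rewrite -E_isometry /euclidean_dist sqr_sqrtr ?dot_ge0. Qed.

Let D_ge0 x y : 0 <= D x y.
Proof. by rewrite -E_isometry sqrtr_ge0. Qed.

Let D_gt0 x y : x <> y -> 0 < D x y.
Proof. by move=> xy; rewrite lt_def D_ge0 andbT; apply/eqP => /D_eq0. Qed.

(** Stewart's identity expresses the squared distance from [E z] to the affine point through values
    of [D], and the bounds make it nonpositive. *)
Lemma affine_point x y z (l : R) : 0 <= l <= 1 ->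
  D z x <= l * D x y -> D z y <= (1 - l) * D x y ->
  E z = (1 - l) *: E x + l *: E y.
Proof.
move=> /andP[l0 l1] zx zy; apply/eqP; rewrite -subr_eq0; apply/eqP/dot_eq0.
apply/eqP; rewrite eq_le dot_ge0 andbT.
have -> : dot (E z - ((1 - l) *: E x + l *: E y)) (E z - ((1 - l) *: E x + l *: E y)) =
    (1 - l) * D z x ^+ 2 + l * D z y ^+ 2 - l * (1 - l) * D x y ^+ 2.
  rewrite -!dist_sqr !dotE (dotC (E y) (E x)) (dotC (E x) (E z)) (dotC (E y) (E z)).
  by ring.
have sq (a b : R) : 0 <= a -> a <= b -> a ^+ 2 <= b ^+ 2 by move=> a0 ab; nra.
have := sq _ _ (D_ge0 _ _) zx; have := sq _ _ (D_ge0 _ _) zy.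
move: (D z x ^+ 2) (D z y ^+ 2) (D x y) => a b c hb ha.
have : (1 - l) * a <= (1 - l) * (l * c) ^+ 2 by rewrite ler_wpM2l ?subr_ge0.
have : l * b <= l * ((1 - l) * c) ^+ 2 by rewrite ler_wpM2l.
have : (1 - l) * (l * c) ^+ 2 + l * ((1 - l) * c) ^+ 2 = l * (1 - l) * c ^+ 2 by ring.
by move: (_ * (_ * c) ^+ 2) (l * _ ^+ 2) => u v; lra.
Qed.

Lemma image_convex x y (l : R) : 0 <= l <= 1 -> exists z, E z = (1 - l) *: E x + l *: E y.
Proof.
move=> /andP[l0 l1]; have d0 := D_ge0 x y.
have ld : 0 <= l * D x y <= D x y by rewrite mulr_ge0 //= ler_piMl.
have /choice[u uP] : forall k, exists z, D x z <= l * D x y /\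
    D z y <= D x y - l * D x y + k.+1%:R^-1.
  by move=> k; apply: between.
have [|q qP] := proper (u := u) (C := D o x + l * D x y).
  by move=> k; apply: le_trans (D_tri x _ _) _; rewrite lerD2l; case: (uP k).
exists q; apply: affine_point; first exact/andP.
- rewrite DC; apply: (cluster_le (f := D x) ler01 qP) => [a b|k]; first by rewrite mul1r D_tri.
  by apply: le_trans (proj1 (uP k)) _; rewrite lerDl ltW ?invSn_gt0.
- rewrite mulrBl mul1r; apply: (cluster_le (f := D^~ y) ler01 qP) => [a b|k].
    by rewrite mul1r (DC b a) addrC D_tri.
  exact: proj2 (uP k).
Qed.

(* In the inversion at [p] the segment from [x] to a very distant [y] is close
   to the ray from [x] away from [p]. *)
Lemma extension_approximation p x (l e : R) : p <> x -> 0 <= l < 1 -> 0 < e ->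
  exists z, [/\ D x z <= l * D z p + e, D x p <= (1 - l) * D z p + e &
    D z p <= 2 * D x p / (1 - l)].
Proof.
move=> px /andP[l0 l1] e0; pose a := D x p; pose m := 1 - l; pose B := 2 * a / m.
have a0 : 0 < a by rewrite /a D_gt0 //; apply: nesym.
have m0 : 0 < m by rewrite subr_gt0.
have B0 : 0 < B by rewrite /B !mulr_gt0 ?invr_gt0.
have [y yL] := unbounded (D o p + 6 * a / m + 3 * a * B / e).
pose L := D y p.
have [L1 L2] : 6 * a / m < L /\ 3 * a * B / e < L.
  have := D_tri p o y; rewrite (DC p y) -/L => ?.
  have h1 : 0 < 6 * a / m by rewrite !mulr_gt0 ?invr_gt0.
  have h2 : 0 < 3 * a * B / e by rewrite !mulr_gt0 ?invr_gt0.
  by move: yL; split; lra.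
have L0 : 0 < L by apply: le_lt_trans L1; rewrite !mulr_ge0 ?invr_ge0 ?ltW.
have yp : y <> p by move=> yp; move: L0; rewrite /L yp D0 ltxx.
have d0 := D_ge0 x y; have dL := D_tri p x y; rewrite (DC p y) -/a -/L in dL.
(* With [y] at infinity, whose inverted distance to [z] is [1 / D z p], division of the inverted
   segment in the ratio [l] would give exactly [D x z = l * D z p] and [D x p = (1 - l) * D z p].
   The tolerance is [1 / L]. *)
have [||z [zp z1 z2]] := @inversion_between p x y (l * (D x y / (a * L))) (a / (a * L)) (nesym px) yp.
- have c0 : 0 <= D x y / (a * L) by rewrite divr_ge0 // ltW // mulr_gt0.
  by rewrite mulr_ge0 //= ler_piMl // ltW.
- by rewrite !mulr_gt0 ?invr_gt0 ?mulr_gt0.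
have Z0 : 0 < D z p by apply: D_gt0.
have yz := D_tri z y p; rewrite -/L in yz; have xz := D_tri x z p; rewrite -/a in xz.
rewrite (DC y z) in yz; rewrite (DC z x) in xz.
exists z; move: z1 z2 Z0 yz xz; rewrite -/a -/m -/L -/B.
move: d0 dL; move: (D x y) (D x z) (D z y) (D z p) => d u v Z d0 dL z1 z2 Z0 yz xz.
have {}z1 : u * L <= (l * d + a) * Z.
  have : u / (a * Z) * (a * Z * L) <= (l * (d / (a * L)) + a / (a * L)) * (a * Z * L).
    by apply: ler_wpM2r z1; rewrite !mulr_ge0 // ltW.
  have -> : u / (a * Z) * (a * Z * L) = u * L by field; rewrite !gt_eqF.
  by have -> : (l * (d / (a * L)) + a / (a * L)) * (a * Z * L) = (l * d + a) * Z
    by field; rewrite !gt_eqF.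
have {}z2 : v * a <= (m * d + a) * Z.
  have : v / (Z * L) * (a * Z * L) <=
      (d / (a * L) - l * (d / (a * L)) + a / (a * L)) * (a * Z * L).
    by apply: ler_wpM2r z2; rewrite !mulr_ge0 // ltW.
  have -> : v / (Z * L) * (a * Z * L) = v * a by field; rewrite !gt_eqF.
  by have -> : (d / (a * L) - l * (d / (a * L)) + a / (a * L)) * (a * Z * L) = (m * d + a) * Z
    by rewrite /m; field; rewrite !gt_eqF.
(* The error due to a finite [L]; the bounds [L1] and [L2] were chosen to give [tm] and [tB]. *)
pose t := 3 * a / L.
have tL : t * L = 3 * a by rewrite /t divfK ?gt_eqF.
have t0 : 0 < t by rewrite /t !mulr_gt0 ?invr_gt0.
have tm : t <= m / 2.
  rewrite -(ler_pM2r L0) tL.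
  by move: L1; rewrite ltr_pdivrMr //; lra.
have tB : t * B <= e.
  rewrite -(ler_pM2r L0) mulrAC tL.
  by move: L2; rewrite ltr_pdivrMr //; lra.
have ZM (c c' : R) : c <= c' -> c * Z <= c' * Z by apply: ler_wpM2r; apply: ltW.
have {}z1 : u <= (l + t) * Z.
  rewrite -(ler_pM2r L0); apply: le_trans z1 _; rewrite mulrAC; apply: ZM.
  have : l * d <= l * (a + L) by rewrite ler_wpM2l.
  have : l * a <= a by rewrite ler_piMl ?(ltW a0) ?(ltW l1).
  by rewrite mulrDl tL; lra.
have {}z2 : a <= (m + t) * Z.
  rewrite -(ler_pM2r L0); have : (L - Z) * a <= v * a by apply: (ler_wpM2r (ltW a0)); lra.
  have : m * d <= m * (a + L) by apply: (ler_wpM2l (ltW m0)).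
  have : (m + t) * Z * L = (m * L + 3 * a) * Z by rewrite -tL; ring.
  move=> -> h1 h2; have : (m * d + a) * Z <= (m * (a + L) + a) * Z by apply: ZM; lra.
  have : m * a * Z <= a * Z by apply: ZM; rewrite ler_piMl ?(ltW a0) // /m; lra.
  by move: z2 h2; lra.
have ZB : Z <= B.
  rewrite /B ler_pdivlMr //; have := ZM _ _ tm; move: xz z1; rewrite /m; lra.
have : t * Z <= e by apply: le_trans tB; apply: (ler_wpM2l (ltW t0)).
by split=> //; lra.
Qed.

(** At a cluster point the approximations become the hypotheses of [affine_point], with [x] dividing
    the segment from [p] to [q]; the resulting equation is solved for [E q]. *)
Lemma image_extension p x (l : R) : p <> x -> 0 <= l < 1 ->
  exists q, E q = E p + (1 - l)^-1 *: (E x - E p).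
Proof.
move=> px /andP[l0 l1]; have m0 : 0 < 1 - l by rewrite subr_gt0.
have /choice[u uP] : forall k, exists z, [/\ D x z <= l * D z p + k.+1%:R^-1,
    D x p <= (1 - l) * D z p + k.+1%:R^-1 & D z p <= 2 * D x p / (1 - l)].
  by move=> k; apply: extension_approximation => //; rewrite ?l0 //= invSn_gt0.
have [|q qP] := proper (u := u) (C := D o p + 2 * D x p / (1 - l)).
  by move=> k; apply: le_trans (D_tri p _ _) _; rewrite lerD2l DC; case: (uP k).
have lip a b : D b p <= D a p + D a b by rewrite addrC (DC a b) D_tri.
have h1 : D x q - l * D q p <= 0.
  apply: (cluster_le (f := fun q => D x q - l * D q p) (C := 2) _ qP) => // [a b|k].
    have := D_tri b x a; have : l * D b p <= l * (D a p + D a b) by apply: (ler_wpM2l l0).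
    have : l * D a b <= D a b by rewrite ler_piMl // ltW.
    by rewrite (DC b a); lra.
  by rewrite add0r lerBlDl; case: (uP k).
have h2 : D x p - (1 - l) * D q p <= 0.
  apply: (cluster_le (f := fun q => D x p - (1 - l) * D q p) (C := 1) _ qP) => // [a b|k].
    have : (1 - l) * D b p <= (1 - l) * (D a p + D a b) by apply: (ler_wpM2l (ltW m0)).
    have : 0 <= l * D a b by rewrite mulr_ge0.
    by rewrite (DC b a); lra.
  by rewrite add0r lerBlDl; case: (uP k).
exists q.
have -> : E x = (1 - (1 - l)) *: E p + (1 - l) *: E q.
  apply: affine_point; rewrite ?(DC p q); first by apply/andP; split; lra.
    by lra.
  by lra.
apply/rowP => i; rewrite !mxE; move: (E p 0 i) (E q 0 i) => a b.
by field; rewrite gt_eqF.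
Qed.

(** Prolong the segment from [x] to [o] to twice its length. *)
Lemma image_opp x : exists y, E y = - E x.
Proof.
have [->|xo] := pselect (x = o); first by exists o; rewrite E0 oppr0.
have [|y yE] := @image_extension x o (1 / 2) xo; first by apply/andP; split; lra.
by exists y; apply/rowP => i; rewrite yE E0 !mxE; field.
Qed.

Lemma image_scale_ge0 (a : R) x : 0 <= a -> exists y, E y = a *: E x.
Proof.
move=> a0; have [xo|xo] := pselect (o = x); first by exists o; rewrite -xo E0 scaler0.
have [a1|a1] := leP a 1.
  have [|y yE] := @image_convex o x a; first by rewrite a0.
  by exists y; rewrite yE E0 scaler0 add0r.
have [|y yE] := @image_extension o x (1 - a^-1) xo.
  by rewrite subr_ge0 invf_le1 ?ltW //= ?gtrBl ?invr_gt0 (lt_trans ltr01).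
by exists y; rewrite yE E0 add0r subr0 opprB addrC subrK invrK.
Qed.

Lemma image_scale (a : R) x : exists y, E y = a *: E x.
Proof.
have [a0|a0] := leP 0 a; first exact: image_scale_ge0.
have [|y yE] := @image_scale_ge0 (- a) x; first by rewrite oppr_ge0 ltW.
by have [z zE] := image_opp y; exists z; rewrite zE yE scaleNr opprK.
Qed.

Lemma image_add x y : exists z, E z = E x + E y.
Proof.
have [|z zE] := @image_convex x y (1 / 2); first by apply/andP; split; lra.
have [w wE] := image_scale 2 z; exists w; rewrite wE zE.
by apply/rowP => i; rewrite !mxE; field.
Qed.

Lemma image_sum (I : Type) (s : seq I) (F : I -> 'rV[R]_N) : (forall i, range E (F i)) ->
  exists z, E z = \sum_(i <- s) F i.
Proof.
move=> FE; elim: s => [|i s [z zE]]; first by exists o; rewrite big_nil.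
have [x _ xE] := FE i; have [w wE] := image_add x z.
by exists w; rewrite big_cons wE xE zE.
Qed.

Lemma dot_mulmx n (x y : 'rV[R]_n) : dot x y = (x *m y^T) 0 0.
Proof. by rewrite mxE; apply: eq_bigr => i _; rewrite mxE. Qed.

(** [V] is a maximal orthonormal family in the image, and [P] takes coordinates with respect to it.
    A nonzero component of [E x] orthogonal to [V] again lies in the image and, normalised, would
    enlarge the family. *)
Theorem isometric_linear_image : exists (k : nat) (P : T -> 'rV[R]_k),
  (forall x y, euclidean_dist (P x) (P y) = D x y) /\ forall w, exists x, P x = w.
Proof.
pose orthonormal k := `[< exists V : 'M[R]_(k, N), V *m V^T = 1%:M /\
  forall i, range E (row i V) >].
have ex0 : exists k, orthonormal k.
  by exists 0%N; apply/asboolP; exists 0; split=> [|[]//]; apply/matrixP => -[].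
have bound k : orthonormal k -> (k <= N)%N.
  by move=> /asboolP[V [/mulmx1_min]].
have [k /asboolP[V [VV VE]] kmax] := ex_maxnP ex0 bound.
have rangeV (w : 'rV[R]_k) : exists z, E z = w *m V.
  rewrite mulmx_sum_row; apply: image_sum => i.
  by have [x _ <-] := VE i; have [y yE] := image_scale (w 0 i) x; exists y.
have decomposition x : E x = E x *m V^T *m V.
  have [z zE] := rangeV (E x *m V^T); have [z' z'E] := image_opp z.
  have [y] := image_add x z'; rewrite z'E zE; set w := _ - _ => yE.
  apply/eqP; rewrite -subr_eq0 -/w; apply/eqP; apply: contrapT => w0.
  have n0 : 0 < dot w w.
    by rewrite lt_def dot_ge0 andbT; apply/eqP => /dot_eq0.
  pose v := (Num.sqrt (dot w w))^-1 *: w.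
  have wV : w *m V^T = 0 by rewrite /w mulmxBl -(mulmxA _ V) VV mulmx1 subrr.
  have vV : v *m V^T = 0 by rewrite -scalemxAl wV scaler0.
  have vv : v *m v^T = 1%:M.
    apply/matrixP => i j; rewrite !ord1 -dot_mulmx /v dotZl dotZr mxE /=.
    rewrite mulrA -expr2 exprVn sqr_sqrtr ?dot_ge0 // mulVf ?gt_eqF //.
  suff /kmax : orthonormal (1 + k)%N by rewrite ltnn.
  apply/asboolP.
  exists (col_mx v V); split.
    rewrite tr_col_mx mul_col_row vv vV VV -(trmxK (V *m v^T)) trmx_mul trmxK vV trmx0.
    by rewrite -scalar_mx_block.
  move=> i; rewrite -(splitK i); case: (fintype.split i) => j /=.
    have [q qE] := image_scale (Num.sqrt (dot w w))^-1 y; exists q => //.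
    by rewrite rowKu row_id qE yE.
  by rewrite rowKd; apply: VE.
exists k, (fun x => E x *m V^T); split=> [x y|w].
  rewrite -E_isometry /euclidean_dist -mulmxBl; congr Num.sqrt.
  rewrite !dot_mulmx trmx_mul trmxK mulmxA; congr (_ 0 0); congr (_ *m _).
  by rewrite {2}(decomposition x) {2}(decomposition y) -mulmxBl mulmxBl.
have [x xE] := rangeV w; exists x.
by rewrite xE -mulmxA VV mulmx1.
Qed.

End linear_image.

(** * Identification of the image with R^n *)

Section euclidean_norm.
Context {R : realType} {n : nat}.
Implicit Types v w : 'rV[R]_n.

Lemma norm_le_euclidean v w : `|v - w| <= euclidean_dist v w.
Proof.
apply: ler_add_eps => e e0; apply: ltW; apply: norm_row_lt => [|i].
  by rewrite ltr_wpDl ?sqrtr_ge0.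
apply: (@le_lt_trans _ _ (euclidean_dist v w)); last by rewrite ltrDl.
rewrite -sqrtr_sqr ler_wsqrtr // /dot (bigD1 i) //= -expr2 lerDl.
by apply: sumr_ge0 => j _; rewrite -expr2 sqr_ge0.
Qed.

Lemma euclidean_le_norm v w : euclidean_dist v w <= n%:R * `|v - w|.
Proof.
rewrite -[leRHS]ger0_norm ?mulr_ge0 // -sqrtr_sqr ler_wsqrtr //.
apply: (@le_trans _ _ (\sum_(i < n) `|v - w| ^+ 2)).
  apply: ler_sum => i _; rewrite -expr2 -[leLHS]ger0_norm ?sqr_ge0 // normrX.
  by rewrite lerXn2r ?nnegrE // norm_coord_le.
rewrite sumr_const card_ord -[leLHS]mulr_natl exprMn ler_wpM2r ?sqr_ge0 //.
by rewrite -natrX ler_nat; case: (n) => // m; rewrite expnS expn1 leq_pmulr.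
Qed.

End euclidean_norm.

(** Otherwise the preimages of the vectors with all coordinates equal to [k] would cluster, and
    continuity of [f] at the cluster point would bound arbitrarily large [k]. *)
Lemma homeomorphic_unbounded {R : realType} (X : metricType R) (n : nat) (o : X) :
  (forall u C, (forall k, mdist o (u k) <= C) -> exists p, clusters (@mdist R X) u p) ->
  homeomorphic X 'rV[R]_n.+1 -> forall C, exists y, C < mdist o y.
Proof.
move=> proper [f [g [fg gf cf cg]]] C; apply: contrapT => /forallNP bd.
have [|p pP] := proper (fun k => g (const_mx k%:R)) C.
  by move=> k; rewrite leNgt; apply/negP; apply: bd.
have : nbhs p (f @^-1` ball (f p) 1) by apply: cf; apply: nbhsx_ballx.
rewrite -metricType_numDomainType.filter_from_mdist_nbhs => -[d /= d0 dP].
have [k [Nk kp]] := pP d d0 (Num.bound (`|f p| + 1)).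
have := dP (g (const_mx k%:R)); rewrite /= metric_sym => /(_ kp); rewrite gf.
rewrite -ball_normE /= => far.
have := archi_boundP (addr_ge0 (normr_ge0 (f p)) ler01).
have : (Num.bound (`|f p| + 1))%:R <= k%:R :> R by rewrite ler_nat.
have := norm_coord_le (f p) ord0; have := norm_coord_le (f p - const_mx k%:R) ord0.
rewrite !mxE; move: (Num.bound _)%:R (k%:R) far (f p 0 ord0) => b q far c h1 h2 h3 h4.
have := ler_norm c; have := ler_norm (q - c); rewrite distrC.
by move: far h1 h2 h3 h4; move: `|c| `|f p - _| `|f p| `|c - q| => *; lra.
Qed.

(** [P \o g] and [f \o Q] are continuous injections between R^n and R^k in the two directions, so
    [n = k]. *)
Lemma homeomorphic_isometric {R : realType} (X : metricType R) (n k : nat) (P : X -> 'rV[R]_k) :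
  homeomorphic X 'rV[R]_n -> (forall x y, euclidean_dist (P x) (P y) = mdist x y) ->
  (forall w, exists x, P x = w) ->
  isometric (@mdist R X) (@euclidean_dist R n) [set: X] [set: 'rV[R]_n].
Proof.
move=> [f [g [fg gf cf cg]]] Piso /choice[Q QP].
have Pinj : injective P.
  move=> x y xy; apply/eqP; rewrite eq_sym -[_ == _]negbK -mdist_gt0 -Piso xy.
  by rewrite /euclidean_dist subrr dot0l sqrtr0 ltxx.
have Pc : continuous P.
  move=> x.
  apply/(@pseudometric_normed_Zmodule.cvgrPdist_lt R 'rV[R]_k X (nbhs x) _ P (P x)) => e e0.
  apply/metricType_numDomainType.nbhs_mdistP; exists e => // y /= xy.
  by rewrite (le_lt_trans (norm_le_euclidean _ _)) // Piso.
have Qc : continuous Q.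
  move=> v.
  apply/(@metricType_numDomainType.cvgrPdist_lt R X 'rV[R]_k (nbhs v) _ Q (Q v)) => e e0.
  have k0 : 0 < k%:R + 1 :> R by rewrite ltr_wpDl.
  apply/nbhs_ballP; exists (e / (k%:R + 1)) => [|w]; rewrite /= ?divr_gt0 //.
  rewrite -ball_normE /= ltr_pdivlMr // => vw.
  rewrite -Piso !QP; apply: le_lt_trans (euclidean_le_norm _ _) _.
  by apply: le_lt_trans vw; rewrite mulrC ler_wpM2l // lerDl.
have nk : n = k.
  apply/eqP; rewrite eqn_leq; apply/andP; split.
    apply: (@injective_continuous_leq R n k (P \o g)).
      by move=> v; apply: continuous_comp; [exact: cg|exact: Pc].
    by move=> v w /Pinj; apply: can_inj.
  apply: (@injective_continuous_leq R k n (f \o Q)).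
    by move=> v; apply: continuous_comp; [exact: Qc|exact: cf].
  by move=> v w /= /(can_inj fg) vw; rewrite -(QP v) vw QP.
subst k; exists P; split=> [x y _ _|]; first exact: Piso.
by rewrite -subTset => v _; exists (Q v).
Qed.

Theorem theoremB (R : realType) (n : nat) (n_ge2 : (2 <= n)%N)
    (kappa : R) (K : simplicial_complex kappa) (mK : complex_metric K)
    (shapesK : finite_set (Shapes K))
    (homeoK : homeomorphic (complex_space mK) 'rV[R]_n)
    (invK : forall p : complex_space mK,
       is_metric (inv_dist p) /\
       exists2 Y : metricType R, is_inversion p Y & length_space Y) :
  isometric (@mdist R (complex_space mK)) (@euclidean_dist R n)
    [set: complex_space mK] [set: 'rV[R]_n].
Proof.
case: n n_ge2 homeoK => // n _ homeoK.
pose X : metricType R := complex_space mK.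
have [f [g _]] := homeoK.
(* The homeomorphism supplies a point, hence a cell in which to choose [o]. *)
have [N [ o [r [th [W [W' [r0 clo smooth]]]]]]] := exists_smooth_point mK shapesK (g 0 : X).
have ptolemy (x y z w : X) : complex_dist x z * complex_dist y w <=
    complex_dist x y * complex_dist z w + complex_dist y z * complex_dist x w.
  by have [inv_metric _] := invK w; apply: (@ptolemy_of_inversion R X).
have inversion_between (p x y : X) (s e : R) : x <> p -> y <> p ->
    0 <= s <= complex_dist x y / (complex_dist x p * complex_dist y p) -> 0 < e ->
    exists z : X, [/\ z <> p,
      complex_dist x z / (complex_dist x p * complex_dist z p) <= s + e &
      complex_dist z y / (complex_dist z p * complex_dist y p) <=
        complex_dist x y / (complex_dist x p * complex_dist y p) - s + e].
  have [_ [Y invY lenY]] := invK p; exact: (inversion_approximate_between invY lenY).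
have [|||E [E0 Eiso]] := ptolemaic_isometric_embedding (complex_dist0 mK)
  (complex_dist_eq0 mK) (complex_distC mK) (complex_dist_triangle mK) ptolemy
  (@approximate_between _ _ _ mK) inversion_between r0 clo (th := th) (W := W) (W' := W').
- by move=> z zo zr; case: (smooth z zo zr).
- by move=> z zo zr; case: (smooth z zo zr).
- by move=> z z' zo zr z'o z'r e e0; case: (smooth z zo zr) => _ _; apply.
have proper : forall (u : nat -> X) C, (forall k, complex_dist o (u k) <= C) ->
    exists p : X, clusters (@complex_dist R kappa K) u p.
  by move=> u C; apply: (embedded_complex_proper mK shapesK Eiso).
have [k [P [Piso Psurj]]] := isometric_linear_image (complex_dist0 mK)
  (complex_dist_eq0 mK) (complex_distC mK) (complex_dist_triangle mK)
  (@approximate_between _ _ _ mK) inversion_between proper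
  (homeomorphic_unbounded (X := X) proper homeoK) E0 Eiso.
exact: (homeomorphic_isometric (X := X) homeoK Piso Psurj).
Qed.
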